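(* Let $\vec L$ and $\vec L^*$ be welded-concordant $m$-component virtual string links. Then their Artin representations agree: $A^{(q)}(\vec L)=A^{(q)}(\vec L^* )$ for all $q\ge1$.
   Context: An $m$-component virtual string link diagram $\vec L=\vec K_1\cup\dots\cup\vec K_m$ is a proper generic immersion $\bigsqcup_{i=1}^m[0,1]\to[0,1]\times[0,m+1]$ whose $i$-th interval satisfies $0\mapsto(0,i)$, $1\mapsto(1,i)$, oriented from left to right, with transverse double points marked as classical (over/under) or virtual crossings. Moves (all fixing endpoints): Reidemeister moves; the detour move (an arc containing only virtual crossings may be replaced by any generic arc with the same endpoints all of whose crossings are virtual); the forbidden overpass move (an arc crossing over two strands that meet in a virtual crossing may be moved across that virtual crossing while staying over both strands); births (adding a disjoint crossing-free circle), deaths (deleting such a circle), saddles (oriented band surgery). Two $m$-component virtual string links are welded concordant if they are related by a finite sequence of these moves whose restriction to each component is a concordance, i.e. connected and with $\#(\text{births})-\#(\text{saddles})+\#(\text{deaths})=0$. The arcs of $\vec L$ are the paths along $\vec L$ between consecutive undercrossings, or between an undercrossing and a string endpoint (virtual crossings ignored). Let $a_{i,1},\dots,a_{i,n_i}$ be the arcs of $\vec K_i$ in order from left endpoint to right endpoint. The group $G(\vec L)$ is generated by all arcs, with relations $a_{i,j+1}=o^{-\varepsilon}a_{i,j}o^{\varepsilon}$ for $1\le j\le n_i-1$, where $o$ is the overcrossing arc and $\varepsilon$ the sign of the crossing separating $a_{i,j}$ and $a_{i,j+1}$. For a group $G$, $G_1=G$, $G_{k+1}=[G_k,G]$ and $Q_q(G)=G/G_q$.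 Let $F$ be the free group on $a_1,\dots,a_m$. The homomorphisms $\psi_0^{(q)},\psi_1^{(q)}:Q_q(F)\to Q_q(G(\vec L))$ given by $\psi_0^{(q)}(a_i)=a_{i,1}$ and $\psi_1^{(q)}(a_i)=a_{i,n_i}$ are isomorphisms for all $q\ge2$. The Artin representation of $\vec L$ is the automorphism $A^{(q)}(\vec L)=\left(\psi_1^{(q+1)}\right)^{-1}\circ\psi_0^{(q+1)}$ of $Q_{q+1}(F)$. *)

(* Defs.v *)
From HB Require Import structures.
From mathcomp Require Import all_boot all_order all_algebra.
From mathcomp Require Import finmap.
From mathcomp Require Import all_classical all_reals all_analysis.
From Stdlib Require Import Relation_Operators.

Set Implicit Arguments.
Unset Strict Implicit.
Unset Printing Implicit Defensive.
Import Order.TTheory GRing.Theory Num.Theory.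
Import numFieldNormedType.Exports.

Local Open Scope classical_set_scope.
Local Open Scope ring_scope.

Section QuotientGroup.
Local Open Scope group_scope.
Variable G : groupType.

Record normal_subgroup := NormalSubgroup {
  nsub :> set G;
  nsub1 : nsub 1;
  nsubM : forall x y, nsub x -> nsub y -> nsub (x * y);
  nsubV : forall x, nsub x -> nsub x^-1;
  nsubJ : forall x y, nsub x -> nsub (x ^ y) }.

Variable N : normal_subgroup.

Definition coset_rel (x y : G) : bool := `[< nsub N (x^-1 * y) >].

Lemma coset_rel_equiv : equiv_class_of coset_rel.
Proof.
split=> [x|x y|y x z].
- by rewrite /coset_rel mulVg; apply/asboolP; exact: nsub1.
- apply/idP/idP => /asboolP h; apply/asboolP; move/nsubV: h;
    by rewrite invgM invgK.
- move=> /asboolP hxy /asboolP hyz; apply/asboolP.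
  by move: (nsubM hxy hyz); rewrite -mulgA mulVKg.
Qed.

Canonical coset_equiv := EquivRelPack coset_rel_equiv.

Definition quo : Type := {eq_quot coset_equiv}%qT.
HB.instance Definition _ := Choice.on quo.
HB.instance Definition _ := EqQuotient.on quo.

Definition to_quo (x : G) : quo := (\pi_quo x)%qT.

Lemma to_quoP (x y : G) : to_quo x = to_quo y <-> nsub N (x^-1 * y).
Proof.
rewrite /to_quo; split=> [/eqquotP/asboolP|h] //.
by apply/eqquotP/asboolP.
Qed.

Lemma to_quoK (x : quo) : to_quo (repr x) = x.
Proof. exact: reprK. Qed.

Definition quo_one : quo := to_quo 1.
Definition quo_mul (x y : quo) : quo := to_quo (repr x * repr y).
Definition quo_inv (x : quo) : quo := to_quo (repr x)^-1.

Lemma quo_mulE (x y : G) : quo_mul (to_quo x) (to_quo y) = to_quo (x * y).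
Proof.
apply/to_quoP.
have hx : nsub N ((repr (to_quo x))^-1 * x) by apply/to_quoP; rewrite to_quoK.
have hy : nsub N ((repr (to_quo y))^-1 * y) by apply/to_quoP; rewrite to_quoK.
move: (nsubM hy (nsubJ y hx)).
by rewrite conjgE invgM -!mulgA mulVKg.
Qed.

Lemma quo_invE (x : G) : quo_inv (to_quo x) = to_quo x^-1.
Proof.
apply/to_quoP; rewrite invgK.
have hx : nsub N ((repr (to_quo x))^-1 * x) by apply/to_quoP; rewrite to_quoK.
move: (nsubJ (repr (to_quo x))^-1 (nsubV hx)).
by rewrite conjgE !invgM !invgK -!mulgA mulgV mulg1.
Qed.

Fact quo_mulA : associative quo_mul.
Proof.
move=> x y z; rewrite -(to_quoK x) -(to_quoK y) -(to_quoK z).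
by rewrite !quo_mulE mulgA.
Qed.

Fact quo_mul1 : left_id quo_one quo_mul.
Proof. by move=> x; rewrite -(to_quoK x) quo_mulE mul1g. Qed.

Fact quo_mulr1 : right_id quo_one quo_mul.
Proof. by move=> x; rewrite -(to_quoK x) quo_mulE mulg1. Qed.

Fact quo_mulV : left_inverse quo_one quo_inv quo_mul.
Proof. by move=> x; rewrite -(to_quoK x) quo_invE quo_mulE mulVg. Qed.

Fact quo_mulrV : right_inverse quo_one quo_inv quo_mul.
Proof. by move=> x; rewrite -(to_quoK x) quo_invE quo_mulE mulgV. Qed.

HB.instance Definition _ := isGroup.Build quo
  quo_mulA quo_mul1 quo_mulr1 quo_mulV quo_mulrV.

Fact to_quoM : {morph to_quo : x y / x * y}.
Proof. by move=> x y; rewrite -quo_mulE. Qed.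

HB.instance Definition _ := isMultiplicative.Build G quo to_quo to_quoM.
End QuotientGroup.

Section Subgroups.
Local Open Scope group_scope.
Variable G : groupType.

Inductive generated (S : set G) : set G :=
| gen_incl x : S x -> generated S x
| gen_one : generated S 1
| gen_mul x y : generated S x -> generated S y -> generated S (x * y)
| gen_inv x : generated S x -> generated S x^-1.

Lemma generatedJ (S : set G) :
  (forall x y, S x -> generated S (x ^ y)) ->
  forall x y, generated S x -> generated S (x ^ y).
Proof.
move=> SJ x y; elim=> {x} [x /SJ //||x z _ hx _ hz|x _ hx].
- by rewrite conj1g; exact: gen_one.
- by rewrite conjMg; exact: gen_mul.
- by rewrite conjVg; exact: gen_inv.
Qed.

Definition conjugates (S : set G) : set G :=
  [set z | exists x y, S x /\ z = x ^ y].

Fact conjugatesJ (S : set G) x y :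
  conjugates S x -> generated (conjugates S) (x ^ y).
Proof.
move=> [u [v [Su ->]]]; apply: gen_incl; exists u, (v * y); split=> //.
by rewrite conjgM.
Qed.

Definition normal_closure (S : set G) : normal_subgroup G :=
  NormalSubgroup (gen_one _) (@gen_mul (conjugates S)) (@gen_inv _)
    (generatedJ (@conjugatesJ S)).

Definition whole_group : normal_subgroup G :=
  @NormalSubgroup G setT I (fun _ _ _ _ => I) (fun _ _ => I) (fun _ _ _ => I).

Definition commutators (N : set G) : set G :=
  [set z | exists x y, N x /\ z = [~ x, y]].

Fact commutatorsJ (N : normal_subgroup G) x y :
  commutators N x -> generated (commutators N) (x ^ y).
Proof.
move=> [u [v [Nu ->]]]; apply: gen_incl; exists (u ^ y), (v ^ y).
by split; [exact: nsubJ | rewrite conjRg].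
Qed.

Definition commutator_subgroup (N : normal_subgroup G) : normal_subgroup G :=
  NormalSubgroup (gen_one _) (@gen_mul (commutators N)) (@gen_inv _)
    (generatedJ (@commutatorsJ N)).

(* Indexed from 1: lower_central 1 is G itself; the value at 0 is junk. *)
Fixpoint lower_central (k : nat) : normal_subgroup G :=
  if k is (k'.+1 as k1).+1 then commutator_subgroup (lower_central k1)
  else whole_group.
End Subgroups.

(* written Q_q(G) in the literature on Milnor invariants *)
Definition nilquo (q : nat) (G : groupType) : groupType :=
  quo (lower_central G q).

Section FreeGroup.
Variable X : choiceType.

(* The letter (x, b) stands for x if b = false, and for x^-1 if b = true. *)
Definition word := seq (X * bool).

Inductive free_eq : word -> word -> Prop :=
| free_refl u : free_eq u u
| free_sym u v : free_eq u v -> free_eq v u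
| free_trans u v w : free_eq u v -> free_eq v w -> free_eq u w
| free_cancel u x b v :
    free_eq (u ++ (x, b) :: (x, ~~ b) :: v) (u ++ v).

Definition free_rel (u v : word) : bool := `[< free_eq u v >].

Lemma free_rel_equiv : equiv_class_of free_rel.
Proof.
split=> [u|u v|v u w].
- by apply/asboolP; exact: free_refl.
- by apply/idP/idP => /asboolP h; apply/asboolP; exact: free_sym.
- by move=> /asboolP h1 /asboolP h2; apply/asboolP; exact: free_trans h2.
Qed.

Canonical free_equiv := EquivRelPack free_rel_equiv.

Definition free_group : Type := {eq_quot free_equiv}%qT.
HB.instance Definition _ := Choice.on free_group.
HB.instance Definition _ := EqQuotient.on free_group.

Definition of_word (u : word) : free_group := (\pi_free_group u)%qT.

Lemma of_wordP (u v : word) : of_word u = of_word v <-> free_eq u v.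
Proof.
rewrite /of_word; split=> [/eqquotP/asboolP|h] //.
by apply/eqquotP/asboolP.
Qed.

Lemma of_wordK (x : free_group) : of_word (repr x) = x.
Proof. exact: reprK. Qed.

Lemma free_eq_repr (u : word) : free_eq (repr (of_word u)) u.
Proof. by apply/of_wordP; rewrite of_wordK. Qed.

Definition inv_word (u : word) : word := rev [seq (a.1, ~~ a.2) | a <- u].

Lemma inv_wordK : involutive inv_word.
Proof.
move=> u; rewrite /inv_word map_rev revK -map_comp -[RHS]map_id.
by apply: eq_map => -[x b] /=; rewrite negbK.
Qed.

Lemma free_eq_cat u u' v v' :
  free_eq u u' -> free_eq v v' -> free_eq (u ++ v) (u' ++ v').
Proof.
move=> hu hv; apply: (@free_trans _ (u' ++ v)).
  elim: hu v {v' hv} => {u u'} [u|u v _ IH|u v w _ IH1 _ IH2|u x b v] z.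
  - exact: free_refl.
  - by apply: free_sym.
  - exact: free_trans (IH1 z) (IH2 z).
  - by rewrite -!catA /=; exact: free_cancel.
elim: hv u' {u hu} => {v v'} [u|u v _ IH|u v w _ IH1 _ IH2|u x b v] z.
- exact: free_refl.
- by apply: free_sym.
- exact: free_trans (IH1 z) (IH2 z).
- by rewrite !catA; exact: free_cancel.
Qed.

Lemma free_eq_inv u v : free_eq u v -> free_eq (inv_word u) (inv_word v).
Proof.
elim=> {u v} [u|u v _ IH|u v w _ IH1 _ IH2|u x b v].
- exact: free_refl.
- exact: free_sym.
- exact: free_trans IH1 IH2.
- rewrite /inv_word !map_cat !rev_cat /= !rev_cons -!cats1 -!catA /=.
  by rewrite negbK; exact: free_cancel.
Qed.

Lemma free_eq_mulV u : free_eq (inv_word u ++ u) [::].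
Proof.
elim: u => [|[x b] u IH]; first exact: free_refl.
rewrite /inv_word /= rev_cons cat_rcons; apply: free_trans IH.
by have := free_cancel (inv_word u) x (~~ b) u; rewrite negbK.
Qed.

Definition free_one : free_group := of_word [::].
Definition free_mul (x y : free_group) : free_group :=
  of_word (repr x ++ repr y).
Definition free_inv (x : free_group) : free_group :=
  of_word (inv_word (repr x)).

Lemma free_mulE u v : free_mul (of_word u) (of_word v) = of_word (u ++ v).
Proof. by apply/of_wordP/free_eq_cat; exact: free_eq_repr. Qed.

Lemma free_invE u : free_inv (of_word u) = of_word (inv_word u).
Proof. by apply/of_wordP/free_eq_inv; exact: free_eq_repr. Qed.

Fact free_mulA : associative free_mul.
Proof.
move=> x y z; rewrite -(of_wordK x) -(of_wordK y) -(of_wordK z).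
by rewrite !free_mulE catA.
Qed.

Fact free_mul1 : left_id free_one free_mul.
Proof. by move=> x; rewrite -(of_wordK x) free_mulE. Qed.

Fact free_mulr1 : right_id free_one free_mul.
Proof. by move=> x; rewrite -(of_wordK x) free_mulE cats0. Qed.

Fact free_mulV : left_inverse free_one free_inv free_mul.
Proof.
move=> x; rewrite -(of_wordK x) free_invE free_mulE.
by apply/of_wordP; exact: free_eq_mulV.
Qed.

Fact free_mulrV : right_inverse free_one free_inv free_mul.
Proof.
move=> x; rewrite -(of_wordK x) free_invE free_mulE; apply/of_wordP.
by rewrite -{1}(inv_wordK (repr x)); exact: free_eq_mulV.
Qed.

HB.instance Definition _ := isGroup.Build free_group
  free_mulA free_mul1 free_mulr1 free_mulV free_mulrV.

Definition free_gen (x : X) : free_group := of_word [:: (x, false)].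

Section Lift.
Local Open Scope group_scope.
Variables (H : groupType) (f : X -> H).

Definition eval_word (u : word) : H :=
  \prod_(a <- u) (if a.2 then (f a.1)^-1 else f a.1).

Definition free_lift (x : free_group) : H := eval_word (repr x).

Lemma eval_word_eq u v : free_eq u v -> eval_word u = eval_word v.
Proof.
elim=> {u v} // [u v w _ -> //|u x b v].
rewrite /eval_word !big_cat !big_cons /=; congr (_ * _).
by case: b => /=; rewrite ?mulKg ?mulVKg.
Qed.

Lemma free_lift_word u : free_lift (of_word u) = eval_word u.
Proof. exact/eval_word_eq/free_eq_repr. Qed.

Lemma free_lift_gen x : free_lift (free_gen x) = f x.
Proof. by rewrite free_lift_word /eval_word big_seq1. Qed.

Fact free_liftM : {morph free_lift : x y / x * y}.
Proof.
move=> x y; rewrite -(of_wordK x) -(of_wordK y).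
rewrite [_ * _]free_mulE !free_lift_word.
by rewrite /eval_word big_cat.
Qed.

HB.instance Definition _ :=
  isMultiplicative.Build free_group H free_lift free_liftM.
End Lift.

Definition presented (rels : set free_group) : groupType :=
  quo (normal_closure rels).
End FreeGroup.

Section NilquoMap.
Local Open Scope group_scope.
Variables (q : nat) (G H : groupType) (f : {multiplicative G -> H}).

Definition nilquo_map (x : nilquo q G) : nilquo q H :=
  to_quo (lower_central H q) (f (repr x)).

Lemma lower_central_map x :
  nsub (lower_central G q) x -> nsub (lower_central H q) (f x).
Proof.
have f1 : f 1 = 1 by apply: (mulgI (f 1)); rewrite -gmulfM !mulg1.
have fV y : f y^-1 = (f y)^-1 by apply: (mulgI (f y)); rewrite -gmulfM !mulgV.
case: q x => [|k] // x; elim: k x => [|k IH] // x.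
elim=> {x} [x [u [v [/IH fu ->]]]||x y _ hx _ hy|x _ hx].
- apply: gen_incl; exists (f u), (f v); split=> //.
  by rewrite /commg !conjgE !gmulfM !fV.
- by rewrite f1; exact: gen_one.
- by rewrite gmulfM; exact: gen_mul.
- by rewrite fV; exact: gen_inv.
Qed.

Lemma nilquo_mapE x :
  nilquo_map (to_quo (lower_central G q) x) = to_quo (lower_central H q) (f x).
Proof.
apply/to_quoP.
have fV y : f y^-1 = (f y)^-1.
  by apply: (mulgI (f y)); rewrite -gmulfM !mulgV;
    apply: (mulgI (f 1)); rewrite -gmulfM !mulg1.
by rewrite -fV -gmulfM; apply/lower_central_map/to_quoP; rewrite to_quoK.
Qed.

Fact nilquo_mapM : {morph nilquo_map : x y / x * y}.
Proof.
move=> x y; rewrite -(to_quoK x) -(to_quoK y) -gmulfM !nilquo_mapE.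
by rewrite !gmulfM.
Qed.

HB.instance Definition _ :=
  isMultiplicative.Build (nilquo q G) (nilquo q H) nilquo_map nilquo_mapM.
End NilquoMap.

Section Plane.
Variable R : realType.

Fixpoint class_C (k : nat) (U V : normedModType R) (f : U -> V) : Prop :=
  if k is k'.+1 then
    (forall x, differentiable f x) /\ forall v, class_C k' (fun x => 'D_v f x)
  else continuous f.

Definition smooth (U V : normedModType R) (f : U -> V) : Prop :=
  forall k, class_C k f.

Definition plane : normedModType R := 'rV[R]_2.

Definition mkpt (a b : R) : plane := \row_(k < 2) (if k == 0 then a else b).

Definition det2 (v w : plane) : R := v 0 0 * w 0 1 - v 0 1 * w 0 0.

Definition box (m : nat) : set plane :=
  [set p | 0 <= p 0 0 <= 1 /\ 0 <= p 0 1 <= m.+1%:R].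
Definition box_interior (m : nat) : set plane :=
  [set p | 0 < p 0 0 < 1 /\ 0 < p 0 1 < m.+1%:R].

(* the open round disc; [ball] is a square for the sup norm of 'rV_2 *)
Definition disc (c : plane) (r : R) : set plane :=
  [set p | (p 0 0 - c 0 0) ^+ 2 + (p 0 1 - c 0 1) ^+ 2 < r ^+ 2].

(* Diagrams occurring in the course of a concordance: m strings together with
   finitely many closed curves ("loops"), each loop being assigned by [lab] to
   one of the m components.  All curves are given by maps on R: a string is
   the restriction to [0,1], a loop is 1-periodic.  [over p q] says that the
   strand through p passes over the strand through q at a classical crossing. *)
Record prediagram (m : nat) := Prediagram {
  loop : finType;
  lab : loop -> 'I_m;
  curve_path : 'I_m + loop -> R -> plane;
  over : ('I_m + loop) * R -> ('I_m + loop) * R -> Prop }.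

Section Prediagram.
Variables (m : nat) (D : prediagram m).

Definition curve : Type := ('I_m + loop D)%type.
Definition point : Type := (curve * R)%type.

Definition link_comp (x : curve) : 'I_m :=
  match x with inl i => i | inr l => lab l end.

Definition dom (p : point) : Prop :=
  match p.1 with inl _ => 0 <= p.2 <= 1 | inr _ => 0 <= p.2 < 1 end.

Definition at_ (p : point) : plane := curve_path p.1 p.2.
Definition velocity (p : point) : plane := derive1 (curve_path p.1) p.2.

Definition crossing (p q : point) : Prop :=
  [/\ dom p, dom q, p <> q & at_ p = at_ q].
Definition classical (p q : point) : Prop := over p q \/ over q p.
Definition virtual (p q : point) : Prop := crossing p q /\ ~ classical p q.

(* Sign of the crossing, p being the overcrossing point: the positive frame is
   (overstrand, understrand). *)
Definition positive (p q : point) : bool := 0 < det2 (velocity p) (velocity q).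

Record is_diagram : Prop := IsDiagram {
  diag_smooth : forall x : curve, smooth (curve_path x : R^o -> plane);
  diag_immersed_string : forall (i : 'I_m) t, 0 <= t <= 1 ->
    velocity (inl i, t) <> 0;
  diag_immersed_loop : forall (l : loop D) t, velocity (inr l, t) <> 0;
  diag_left : forall i : 'I_m, at_ (inl i, 0) = mkpt 0 i.+1%:R;
  diag_right : forall i : 'I_m, at_ (inl i, 1) = mkpt 1 i.+1%:R;
  diag_proper : forall (i : 'I_m) t, 0 < t < 1 ->
    box_interior m (at_ (inl i, t));
  diag_periodic : forall (l : loop D) t,
    at_ (inr l, t + 1) = at_ (inr l, t);
  diag_inside : forall (l : loop D) t, box_interior m (at_ (inr l, t));
  diag_double : forall p q r, crossing p q -> crossing p r -> q = r;
  diag_transverse : forall p q, crossing p q ->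
    det2 (velocity p) (velocity q) != 0;
  diag_finite : finite_set [set pq | crossing pq.1 pq.2];
  diag_over_crossing : forall p q : point, over p q -> crossing p q;
  diag_over_asym : forall p q : point, over p q -> ~ over q p }.
End Prediagram.

Record diagram (m : nat) := Diagram {
  prediag :> prediagram m;
  diagP : is_diagram prediag }.

Definition string_link (m : nat) (D : diagram m) : Prop := loop D -> False.

Section Moves.
Variables (m : nat) (D D' : diagram m).
Variable s : loop D -> loop D'.

(* [s] matches the loops of D with loops of D'; strings match themselves *)
Definition curve_map (x : curve D) : curve D' :=
  match x with inl i => inl i | inr l => inr (s l) end.
Definition point_map (p : point D) : point D' := (curve_map p.1, p.2).

Definition same_loops : Prop := bijective s /\ forall l, lab (s l) = lab l.
Definition one_more_loop (z : loop D') : Prop :=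
  [/\ injective s, forall l', (exists l, s l = l') <-> l' <> z
    & forall l, lab (s l) = lab l].

Definition open_arc (E : diagram m) (x : curve E) (a b : R) : set (point E) :=
  [set p | p.1 = x /\ a < p.2 < b].

Definition crossing_free (E : diagram m) (A : set (point E)) : Prop :=
  forall p q, A p -> ~ crossing p q.

Definition disc_meets (E : diagram m) (c : plane) (r : R) (A : set (point E)) :=
  disc c r `<=` box_interior m /\
  forall p : point E, dom p -> (disc c r (at_ p) <-> A p).

(* Planar isotopy and reparametrization.  An orientation preserving
   diffeomorphism of the box fixing its boundary pointwise is isotopic to the
   identity through such diffeomorphisms. *)
Definition box_diffeo (Phi : plane -> plane) : Prop :=
  [/\ smooth Phi, set_bij (box m) (box m) Phi,
      forall p, box m p -> 0 < \det (jacobian Phi p)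
    & forall p, box m p -> ~ box_interior m p -> Phi p = p].

Definition reparam (x : curve D) (rho : R -> R) : Prop :=
  smooth (rho : R^o -> R^o) /\
  match x with
  | inl _ => [/\ rho 0 = 0, rho 1 = 1
               & forall t, 0 <= t <= 1 -> 0 < derive1 rho t]
  | inr _ => (forall t, rho (t + 1) = rho t + 1) /\
             (forall t, 0 < derive1 rho t)
  end.

(* parameters on a loop are reduced to [0,1) *)
Definition reduce (x : curve D) (t : R) : R :=
  match x with inl _ => t | inr _ => t - (Num.floor t)%:~R end.

Definition isotopy : Prop :=
  same_loops /\ exists Phi (rho : curve D -> R -> R),
  [/\ box_diffeo Phi, forall x, reparam x (rho x),
      forall p : point D, dom p ->
        at_ (point_map p) = Phi (at_ (p.1, rho p.1 p.2))
    & forall p q : point D, dom p -> dom q ->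
        (over (point_map p) (point_map q) <->
         over (p.1, reduce p.1 (rho p.1 p.2))
              (q.1, reduce q.1 (rho q.1 q.2)))].

(* The parameters outside ]a, b[ are kept: reparametrizations and changes of
   the base point of a loop are part of [isotopy]. *)
Definition replace_arc (x : curve D) (a b : R) : Prop :=
  [/\ same_loops, 0 < a < b /\ b < 1,
      forall p, dom p -> ~ open_arc x a b p -> at_ (point_map p) = at_ p
    & forall p q, dom p -> dom q ->
        ~ open_arc x a b p -> ~ open_arc x a b q ->
        (over (point_map p) (point_map q) <-> over p q)].

Definition reidemeister1 : Prop :=
  exists (x : curve D) (a b : R) (c : plane) (r : R) (t1 t2 : R),
  [/\ replace_arc x a b,
      disc_meets c r (open_arc x a b)
        /\ disc_meets c r (open_arc (curve_map x) a b),
      a < t1 < b /\ a < t2 < b,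
      (forall t q, a < t < b -> (crossing (x, t) q <->
         (t = t1 /\ q = (x, t2)) \/ (t = t2 /\ q = (x, t1))))
        /\ over (x, t1) (x, t2)
    & crossing_free (open_arc (curve_map x) a b)].

(* Together with [disc_meets], this makes y|(a,b) a diameter of the disc.  Any
   strand through a small disc takes this form after an isotopy. *)
Definition diameter (y : curve D) (a b : R) (c : plane) : Prop :=
  0 < a < b /\ b < 1 /\ exists v : plane,
  forall t, a <= t <= b -> at_ (y, t) = c + (t - (a + b) / 2) *: v.

(* the crossings of the arc x|(a,b) are, in this order along the arc, one
   with the strand through p1 and one with the strand through p2 *)
Definition two_crossings (E : diagram m) (x : curve E) (a b t1 t2 : R)
    (p1 p2 : point E) : Prop :=
  a < t1 < t2 /\ t2 < b /\
  forall t q, a < t < b -> (crossing (x, t) q <->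
    (t = t1 /\ q = p1) \/ (t = t2 /\ q = p2)).

Definition reidemeister2 : Prop :=
  exists (x : curve D) (a b : R) (y : curve D) (a1 b1 : R) (c : plane) (r : R)
         (t1 t2 u1 u2 : R),
  let arc := open_arc x a b in let chord := open_arc y a1 b1 in
  [/\ replace_arc x a b /\ diameter y a1 b1 c,
      arc `&` chord = set0,
      disc_meets c r (arc `|` chord)
        /\ disc_meets c r (open_arc (curve_map x) a b
                            `|` open_arc (curve_map y) a1 b1),
      two_crossings x a b t1 t2 (y, u1) (y, u2)
        /\ ((over (x, t1) (y, u1) /\ over (x, t2) (y, u2)) \/
            (over (y, u1) (x, t1) /\ over (y, u2) (x, t2)))
    & crossing_free (open_arc (curve_map x) a b)].

(* An arc passing over two strands, which cross in the centre of the disc, is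
   moved across that crossing while staying over both strands.
   If the crossing is classical, this is the third Reidemeister move (of the
   three strands of such a move one is over the two others, and the move can
   be performed by moving that strand); if it is virtual, this is the
   forbidden overpass move. *)
Definition overpass (kind : point D -> point D -> Prop) : Prop :=
  exists (x : curve D) (a b : R) (y1 : curve D) (a1 b1 : R)
         (y2 : curve D) (a2 b2 : R) (c : plane) (r : R)
         (t1 t2 t1' t2' u1 u2 u1' u2' : R),
  let arc := open_arc x a b in
  let chord1 := open_arc y1 a1 b1 in let chord2 := open_arc y2 a2 b2 in
  let arc' := open_arc (curve_map x) a b in
  let chord1' := open_arc (curve_map y1) a1 b1 in
  let chord2' := open_arc (curve_map y2) a2 b2 in
  [/\ [/\ replace_arc x a b, diameter y1 a1 b1 c & diameter y2 a2 b2 c],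
      [/\ arc `&` chord1 = set0, arc `&` chord2 = set0
        & chord1 `&` chord2 = set0] /\
      disc_meets c r (arc `|` chord1 `|` chord2) /\
      disc_meets c r (arc' `|` chord1' `|` chord2'),
      kind (y1, (a1 + b1) / 2) (y2, (a2 + b2) / 2),
      two_crossings x a b t1 t2 (y1, u1) (y2, u2)
        /\ over (x, t1) (y1, u1) /\ over (x, t2) (y2, u2)
    & two_crossings (curve_map x) a b t2' t1'
                    (curve_map y2, u2') (curve_map y1, u1')
        /\ over (curve_map x, t2') (curve_map y2, u2')
        /\ over (curve_map x, t1') (curve_map y1, u1')].

Definition reidemeister3 : Prop := overpass (@classical m D).
Definition forbidden_overpass : Prop := overpass (@virtual m D).

Definition detour : Prop :=
  exists (x : curve D) (a b : R),
  [/\ replace_arc x a b,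
      forall p q, open_arc x a b p -> crossing p q -> virtual p q
    & forall p q, open_arc (curve_map x) a b p ->
        crossing p q -> virtual p q].

Definition birth (z : loop D') : Prop :=
  [/\ one_more_loop z, forall p, dom p -> at_ (point_map p) = at_ p,
      forall p q, dom p -> dom q ->
        (over (point_map p) (point_map q) <-> over p q)
    & forall t q, ~ crossing (inr z, t) q].

(* Band surgery splitting the loop z off the curve x: in a disc, the arcs
   x|(a1,b1) and x|(a2,b2) are replaced by an arc from x(a1) to x(b2), traversed
   by the curve matching x, and an arc from x(a2) to x(b1), traversed by z. *)
Definition split_arcs (x : curve D) (a1 b1 a2 b2 : R) : set (point D) :=
  open_arc x a1 b1 `|` open_arc x a2 b2.
Definition split_arcs' (x : curve D) (z : loop D') (a1 b1 a2 b2 : R) :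
    set (point D') :=
  open_arc (curve_map x) a1 b2
    `|` [set p | p.1 = inr z /\ (0 <= p.2 < b1 \/ a2 < p.2 < 1)].
Definition split_map (x : curve D) (z : loop D') (b1 a2 : R) (p : point D) :
    point D' :=
  if `[< p.1 = x /\ b1 <= p.2 <= a2 >] then (inr z, p.2) else point_map p.

Definition split_off (x : curve D) (z : loop D') : Prop :=
  exists (a1 b1 a2 b2 : R) (c : plane) (r : R),
  let arcs := split_arcs x a1 b1 a2 b2 in
  let arcs' := split_arcs' x z a1 b1 a2 b2 in
  let mv := split_map x z b1 a2 in
  [/\ one_more_loop z /\ lab z = link_comp x,
      [/\ 0 < a1 < b1, b1 < a2 < b2 & b2 < 1],
      disc_meets c r arcs /\ crossing_free arcs,
      disc_meets c r arcs' /\ crossing_free arcs'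
    & (forall p, dom p -> ~ arcs p -> at_ (mv p) = at_ p) /\
      (forall p q, dom p -> dom q -> ~ arcs p -> ~ arcs q ->
        (over (mv p) (mv q) <-> over p q))].
End Moves.

Inductive event (m : nat) :=
  Neutral | Birth of 'I_m | Death of 'I_m | Saddle of 'I_m.
Arguments Neutral {m}.

Definition reverse_event m (e : event m) : event m :=
  match e with Birth i => Death i | Death i => Birth i | _ => e end.

(* contribution to #births - #saddles + #deaths on the i-th component *)
Definition euler m (i : 'I_m) (e : event m) : int :=
  match e with
  | Neutral => 0
  | Birth j | Death j => (i == j)%:R
  | Saddle j => - (i == j)%:R
  end.

Section Concordance.
Variable m : nat.

(* [T x x'] says that the curves x of D and x' of D' belong to the same
   connected component of the surface swept out by the move. *)
Inductive elementary (D D' : diagram m) :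
    event m -> (curve D -> curve D' -> Prop) -> Prop :=
| Elem_isotopy s of isotopy s :
    elementary Neutral (fun x x' => x' = curve_map s x)
| Elem_R1 s of reidemeister1 s :
    elementary Neutral (fun x x' => x' = curve_map s x)
| Elem_R2 s of reidemeister2 s :
    elementary Neutral (fun x x' => x' = curve_map s x)
| Elem_R3 s of reidemeister3 s :
    elementary Neutral (fun x x' => x' = curve_map s x)
| Elem_overpass s of forbidden_overpass s :
    elementary Neutral (fun x x' => x' = curve_map s x)
| Elem_detour s of detour s :
    elementary Neutral (fun x x' => x' = curve_map s x)
| Elem_birth s z of birth s z :
    elementary (Birth (lab z)) (fun x x' => x' = curve_map s x)
| Elem_split s x0 z of split_off s x0 z :
    elementary (Saddle (lab z))
      (fun x x' => x' = curve_map s x \/ (x = x0 /\ x' = inr z)).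

Definition move (D D' : diagram m) (e : event m)
    (T : curve D -> curve D' -> Prop) : Prop :=
  elementary e T \/ elementary (reverse_event e) (fun x' x => T x x').

Section Movie.
Variables (N : nat) (D : nat -> diagram m).
Variable T : forall k, curve (D k) -> curve (D k.+1) -> Prop.

Definition movie_curve : Type := {k : nat & curve (D k)}.

Inductive trace_step : movie_curve -> movie_curve -> Prop :=
| Trace_step k x x' of (k < N)%N & T x x' :
    trace_step (existT _ k x) (existT _ k.+1 x').

Definition connected_trace : Prop :=
  forall k (x : curve (D k)), (k <= N)%N ->
    clos_refl_sym_trans movie_curve trace_step
      (existT _ 0%N (inl (link_comp x))) (existT _ k x).
End Movie.

Definition welded_concordant (L L' : diagram m) : Prop :=
  exists (N : nat) (D : nat -> diagram m) (e : nat -> event m)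
    (T : forall k, curve (D k) -> curve (D k.+1) -> Prop),
  [/\ D 0%N = L /\ D N = L',
      forall k, (k < N)%N -> move (e k) (@T k),
      connected_trace N T
    & forall i : 'I_m, \sum_(k < N) euler i (e k) = 0].
End Concordance.

Section Artin.
Variables (m : nat) (D : diagram m).

Definition unders (i : 'I_m) : seq R :=
  sort <=%R (fset_set [set t | exists p : point D, over p (inl i, t)]).

(* Tagged _ j stands for the arc a_{i,j+1}, between the j-th and the (j+1)-st
   undercrossing *)
Definition link_arc : finType := {i : 'I_m & 'I_(size (unders i)).+1}.

(* the arc of the i-th string passing through the parameter t, for t not an
   undercrossing *)
Definition arc_at (i : 'I_m) (t : R) : link_arc :=
  Tagged (fun i => 'I_(size (unders i)).+1)
    (inord (count (fun u => u < t) (unders i)) : 'I_(size (unders i)).+1).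

Definition arc_nth (i : 'I_m) (j : nat) : link_arc :=
  Tagged (fun i => 'I_(size (unders i)).+1)
    (inord j : 'I_(size (unders i)).+1).

Definition first_arc (i : 'I_m) : link_arc := arc_nth i 0.
Definition last_arc (i : 'I_m) : link_arc := arc_nth i (size (unders i)).

Local Open Scope group_scope.

(* a_{i,j+1} = o^(-eps) a_{i,j} o^eps, where o is the arc through p; the number
   j < n_i - 1 is 0-based here.  On a string link, the overcrossing strand is
   always a string. *)
Definition arc_relations : set (free_group link_arc) :=
  [set w | exists (i : 'I_m) (j : nat) (k : 'I_m) (t : R),
    let p : point D := (inl k, t) in
    let q : point D := (inl i, nth 0%R (unders i) j) in
    let o := free_gen (arc_at k t) in
    [/\ (j < size (unders i))%N, over p q
      & w = (free_gen (arc_nth i j.+1))^-1 *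
            (free_gen (arc_nth i j) ^ (if positive p q then o else o^-1))]].

Definition link_group : groupType := presented arc_relations.

Definition meridian (a : link_arc) : link_group := to_quo _ (free_gen a).

Definition psi0 (q : nat) : nilquo q (free_group 'I_m) -> nilquo q link_group :=
  nilquo_map (free_lift (fun i => meridian (first_arc i))).
Definition psi1 (q : nat) : nilquo q (free_group 'I_m) -> nilquo q link_group :=
  nilquo_map (free_lift (fun i => meridian (last_arc i))).

(* Total version of f^-1, meant for bijective f; psi1 is an isomorphism on
   Q_q for every string link and every q >= 2. *)
Definition inverse (G H : groupType) (f : G -> H) (y : H) : G :=
  xget 1 [set x | f x = y].

Definition artin (q : nat) :
    nilquo q.+1 (free_group 'I_m) -> nilquo q.+1 (free_group 'I_m) :=
  inverse (@psi1 q.+1) \o @psi0 q.+1.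
End Artin.
End Plane.

Arguments artin {R m} D q x.

(* Main.v *)
From HB Require Import structures.
From mathcomp Require Import all_boot all_order all_algebra.
From mathcomp Require Import finmap.
From mathcomp Require Import all_classical all_reals all_analysis.
From mathcomp Require Import ring lra zify.
From Stdlib Require Import Relation_Operators.
Require Import Defs.

Set Implicit Arguments.
Unset Strict Implicit.
Unset Printing Implicit Defensive.
Import Order.TTheory GRing.Theory Num.Theory.
Import numFieldNormedType.Exports.

Local Open Scope classical_set_scope.
Local Open Scope ring_scope.

(** The points of a diagram are coloured by elements of a group so that passing
    under a strand conjugates the colour by the colour of that strand, or by its
    inverse, according to the sign of the crossing; virtual crossings impose no
    condition.  The curves are cut open at the parameter 0, so that a loop may have
    different colours at its two ends.  In a nilpotent group the colours at the
    parameter 0 can be prescribed arbitrarily and determine the colouring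
    ([coloring_exists], [coloring_unique]): the colours modulo one term of the lower
    central series determine the conjugations modulo the next one.

    On a string link, a colouring by Q_{q+1}(F) with the generators at the left
    ends is a homomorphism from the link group which inverts psi_0, and the
    colours at the right ends describe psi_1.  So the Artin representation is
    determined by these right-hand colours ([artin_of_colorings]), and it remains
    to see that they are the same at both ends of a concordance.

    The colours at the left ends of the strings, in a nilpotent group, extend to
    all the diagrams of the concordance, with loops that close up and colours that
    match along each move ([movie_coloring]).  This is where the genus zero
    condition enters.  By induction on the class, there is such an extension modulo
    a central subgroup; lift it.  The defects of the loops are then central, and
    each move relates the defects before and after it: they form a flow, with
    values in the centre, along the connections of the curves by the moves.  The
    graph formed by the loops at all stages and by these connections, with the
    strings collapsed to a point, is connected, and it is a tree because the Euler
    numbers vanish ([movie_flow_eq0]).  A tree carries no nonzero flow, so that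
    the loops close up.  The failure of the colours to match along the moves is a
    function on the edges of the tree, hence the coboundary of a function on the
    loops ([movie_potential]), by which the colours are corrected.

    What this argument needs from a move is collected in [step_spec] and proved
    for each kind of move.  An isotopy preserves the crossings and their signs, as
    the diffeomorphism and the reparametrizations preserve orientations.  The other
    moves take place in a disc, off which the colours can be kept, up to a central
    factor after a saddle.  For the second Reidemeister move, the signs of the two
    crossings are opposite because an arc meets a line successively in opposite
    directions.  When an arc is pushed over the crossing of two strands
    ([over_arc_transfers]), the colour of each point of these strands is conjugated
    by a power of the colour of the arc; the exponent counts how often the arc has
    been pushed over this point, so that it is the same for both strands at their
    crossing, be it classical or virtual. *)

(** * Nilpotent groups and their central quotients *)

Section Homs.
Local Open Scope group_scope.
Variables (G H : groupType) (f : {multiplicative G -> H}).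

Lemma hom1 : f 1 = 1.
Proof. by apply: (mulgI (f 1)); rewrite -gmulfM !mulg1. Qed.

Lemma homV x : f x^-1 = (f x)^-1.
Proof. by apply: (mulgI (f x)); rewrite -gmulfM !mulgV hom1. Qed.

Lemma homJ x y : f (x ^ y) = f x ^ f y.
Proof. by rewrite !conjgE !gmulfM homV. Qed.

Lemma hom_normal_closure (S : set G) :
  (forall x, S x -> f x = 1) -> forall x, nsub (normal_closure S) x -> f x = 1.
Proof.
move=> fS x; elim=> {x} [x [u [v [Su ->]]]||x y _ hx _ hy|x _ hx].
- by rewrite homJ fS // conj1g.
- exact: hom1.
- by rewrite gmulfM hx hy mulg1.
- by rewrite homV hx invg1.
Qed.

Lemma quo_hom (M : normal_subgroup G) : (forall x, nsub M x -> f x = 1) ->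
  exists g : {multiplicative quo M -> H}, forall x, g (to_quo M x) = f x.
Proof.
move=> fM; pose g (x : quo M) := f (repr x).
have gE x : g (to_quo M x) = f x.
  apply/(mulgI (f (repr (to_quo M x)))^-1); rewrite mulVg -homV -gmulfM fM //.
  by apply/to_quoP; rewrite to_quoK.
have gM : {morph g : x y / x * y}.
  by move=> x y; rewrite -(to_quoK x) -(to_quoK y) -gmulfM !gE gmulfM.
by exists (HB.pack_for {multiplicative quo M -> H} g (isMultiplicative.Build _ _ g gM)).
Qed.

End Homs.

Section FreeHoms.
Local Open Scope group_scope.
Variables (X : choiceType) (H : groupType).

Lemma free_hom_ext (f g : free_group X -> H) :
  {morph f : x y / x * y} -> {morph g : x y / x * y} ->
  (forall x, f (free_gen x) = g (free_gen x)) -> forall w, f w = g w.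
Proof.
move=> fM gM.
pose f' : {multiplicative free_group X -> H} :=
  HB.pack_for {multiplicative free_group X -> H} f (isMultiplicative.Build _ _ f fM).
pose g' : {multiplicative free_group X -> H} :=
  HB.pack_for {multiplicative free_group X -> H} g (isMultiplicative.Build _ _ g gM).
rewrite -[f]/(f' : _ -> _) -[g]/(g' : _ -> _) => fg w.
rewrite -(of_wordK w); elim: (repr w) => [|[x b] u IH].
  by rewrite -[of_word _]/(1 : free_group X) !hom1.
have -> : of_word ((x, b) :: u) =
    (if b then (free_gen x)^-1 else free_gen x) * of_word u.
  have -> : (if b then (free_gen x)^-1 else free_gen x) = of_word [:: (x, b)].
    by case: b => //; rewrite [LHS]free_invE.
  by rewrite [RHS]free_mulE.
by rewrite !gmulfM IH; case: b; rewrite ?homV fg.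
Qed.

End FreeHoms.

Section Central.
Local Open Scope group_scope.
Variable N : groupType.

Lemma conjgg (x : N) : x ^ x = x.
Proof. by rewrite conjgE mulKg. Qed.

Lemma conjgVg (x : N) : x ^ x^-1 = x.
Proof. by rewrite conjgE invgK mulgV mulg1. Qed.

Definition central (z : N) : Prop := forall x, z * x = x * z.

Lemma central1 : central 1.
Proof. by move=> x; rewrite mulg1 mul1g. Qed.

Lemma centralM y z : central y -> central z -> central (y * z).
Proof. by move=> hy hz x; rewrite -mulgA hz !mulgA hy. Qed.

Lemma centralV z : central z -> central z^-1.
Proof.
by move=> hz x; apply: (mulgI z); rewrite mulVKg mulgA hz mulgK.
Qed.

Lemma centralJ z x : central z -> z ^ x = z.
Proof. by move=> hz; rewrite conjgE hz mulKg. Qed.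

Lemma conj_centralM x z g : central z -> (x * z) ^ g = x ^ g * z.
Proof. by move=> hz; rewrite conjMg (centralJ g hz). Qed.

Lemma conjg_centralM x z g : central z -> x ^ (g * z) = x ^ g.
Proof.
move=> hz; rewrite conjgM; have := hz (x ^ g); move: (x ^ g) => y hy.
by rewrite conjgE -hy mulKg.
Qed.

(** Congruence modulo the centre. *)
Definition ceq (x y : N) : Prop := central (x^-1 * y).

Lemma ceqE x y : ceq x y -> exists2 z, central z & y = x * z.
Proof. by move=> h; exists (x^-1 * y) => //; rewrite mulVKg. Qed.

Lemma ceqM x z : central z -> ceq x (x * z).
Proof. by rewrite /ceq mulKg. Qed.

Lemma ceq_refl x : ceq x x.
Proof. by rewrite /ceq mulVg; exact: central1. Qed.

Lemma ceq_sym x y : ceq x y -> ceq y x.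
Proof. by move=> /centralV; rewrite /ceq invgM invgK. Qed.

Lemma ceqV x y : ceq x y -> ceq x^-1 y^-1.
Proof.
by move=> /ceqE [z hz ->]; rewrite invgM (centralV hz); apply/ceqM/centralV.
Qed.

Lemma ceqJ x g h : ceq g h -> x ^ h = x ^ g.
Proof. by move=> /ceqE [z hz ->]; exact: conjg_centralM. Qed.

End Central.

Section Nilpotent.
Local Open Scope group_scope.

(** The index is shifted because the lower central series starts at 1. *)
Definition nilpotent_of_class (n : nat) (N : groupType) : Prop :=
  forall x : N, nsub (lower_central N n.+1) x -> x = 1.

Lemma lower_central_quo (G : groupType) (N : normal_subgroup G) k (x : quo N) :
  nsub (lower_central (quo N) k) x ->
  exists2 g, nsub (lower_central G k) g & x = to_quo N g.
Proof.
case: k x => [|k] x; first by exists (repr x); rewrite ?to_quoK.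
elim: k x => [|k IH] x; first by exists (repr x); rewrite ?to_quoK.
elim=> {x} [x [u [v [/IH [g hg ->] ->]]]||x y _ [g hg ->] _ [h hh ->]|x _ [g hg ->]].
- exists [~ g, repr v].
    by apply: gen_incl; exists g, (repr v).
  by rewrite [in RHS]commgEl gmulfM homV homJ /= to_quoK.
- by exists 1; [exact: gen_one|].
- by exists (g * h); [exact: gen_mul|rewrite gmulfM].
- by exists g^-1; [exact: gen_inv|rewrite homV].
Qed.

Lemma nilquo_nilpotent n (G : groupType) :
  nilpotent_of_class n (nilquo n.+1 G).
Proof.
move=> x /lower_central_quo [g hg ->].
apply/to_quoP; rewrite mulg1; exact: (nsubV hg).
Qed.

Lemma nilpotent0 (N : groupType) : nilpotent_of_class 0 N ->
  forall x y : N, x = y.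
Proof. by move=> h x y; rewrite (h x) // (h y). Qed.

(** Conjugation raises the precision by one: conjugating elements known modulo
    the next term of the lower central series by elements known modulo the
    current one. *)
Lemma lower_central_conj (N : groupType) k (x y g h : N) :
  nsub (lower_central N k.+1) (g^-1 * h) ->
  nsub (lower_central N k.+2) (x^-1 * y) ->
  nsub (lower_central N k.+2) ((x ^ g)^-1 * y ^ h).
Proof.
move=> hgh hxy.
have -> : (x ^ g)^-1 * y ^ h = ((x ^ g)^-1 * x ^ h) * (x^-1 * y) ^ h.
  by rewrite conjMg conjVg -[RHS]mulgA mulVKg.
apply: (nsubM _ (nsubJ h hxy)).
have -> : (x ^ g)^-1 * x ^ h = [~ g^-1 * h, x ^ g]^-1.
  by rewrite invgR commgEl -conjgM mulVKg.
by apply: gen_inv; apply: gen_incl; exists (g^-1 * h), (x ^ g).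
Qed.

Lemma nilquo_ker_central n (N : groupType) : nilpotent_of_class n.+1 N ->
  forall x y : N, to_quo (lower_central N n.+1) x = to_quo _ y -> ceq x y.
Proof.
move=> hN x y /to_quoP h u.
by rewrite commgC [[~ _, _]]hN ?mulg1 //; apply: gen_incl; exists (x^-1 * y), u.
Qed.
End Nilpotent.

(** * Transport along an interval with finitely many jumps *)

Section Transport.
Variable R : realType.
Implicit Types (s t u lo hi a b : R) (S : seq R).

(** [f] is the colour of a strand whose undercrossings multiply it, by
    conjugation, with the elements [g u]; the element 1 stands for the absence
    of an undercrossing.  The value of [f] at a jump is the one before it. *)
Definition transport (N : groupType) (g : R -> N) lo hi (f : R -> N) : Prop :=
  forall s t, lo <= s -> s < t -> t <= hi ->
    (forall u, s < u < t -> g u = 1%g) -> f t = (f s ^ g s)%g.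

Lemma jump_ind S (P : R -> Prop) lo hi :
  (forall s t, lo <= s -> s < t -> t <= hi ->
     (forall u, u \in S -> s < u < t -> False) -> P s -> P t) ->
  forall s t, lo <= s -> s <= t -> t <= hi -> P s -> P t.
Proof.
elim: S => [|v S IH] step s t los st thi.
  move: st; rewrite le_eqVlt => /orP[/eqP <- //|st]; exact: step.
apply: (IH _ s t los st thi) => {los st thi} {}s {}t los st thi noS Ps.
have [sv|sv] := ltP s v; last first.
  apply: step Ps => // u; rewrite inE => /orP[/eqP ->|/noS //].
  by rewrite ltNge sv.
have [vt|vt] := ltP v t; last first.
  apply: step Ps => // u; rewrite inE => /orP[/eqP ->|/noS //].
  by rewrite [v < t]ltNge vt andbF.
apply: (step v t) => //.
- exact: le_trans (ltW sv).
- move=> u; rewrite inE => /orP[/eqP ->|uS]; first by rewrite ltxx.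
  by move=> /andP[vu ut]; apply: (noS u) => //; rewrite ut (lt_trans sv vu).
apply: (step s v) => //.
- exact: le_trans (ltW vt) thi.
- move=> u; rewrite inE => /orP[/eqP ->|uS]; first by rewrite ltxx andbF.
  by move=> /andP[su uv]; apply: (noS u) => //; rewrite su (lt_trans uv vt).
Qed.

Section OneGroup.
Local Open Scope group_scope.
Variable N : groupType.
Implicit Types (f g : R -> N).

Definition supported g S : Prop := forall u, g u <> 1 -> u \in S.

Lemma supportedN g S u : supported g S -> (u \in S -> False) -> g u = 1.
Proof. by move=> gS uS; apply: contrapT => /gS. Qed.

Lemma transport_eq g g' f f' lo hi :
  (forall u, (lo <= u < hi)%R -> g u = g' u) ->
  (forall u, (lo <= u <= hi)%R -> f u = f' u) ->
  transport g lo hi f -> transport g' lo hi f'.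
Proof.
move=> gg ff tr s t los st thi free.
have lot := le_trans los (ltW st); have shi := lt_le_trans st thi.
rewrite -!ff ?los ?(ltW shi) ?thi ?lot // -gg ?los //.
apply: tr => // u /andP[su ut]; rewrite gg ?free ?su //.
by rewrite (le_trans los (ltW su)) (lt_le_trans ut thi).
Qed.

Lemma transport_sub g f lo hi lo' hi' : lo <= lo' -> hi' <= hi ->
  transport g lo hi f -> transport g lo' hi' f.
Proof.
move=> h1 h2 tr s t los st thi; apply: tr => //; first exact: le_trans los.
exact: le_trans h2.
Qed.

Lemma transport_glue g f lo mid hi :
  transport g lo mid f -> transport g mid hi f -> transport g lo hi f.
Proof.
move=> tr1 tr2 s t los st thi free.
have [tm|mt] := leP t mid; first exact: tr1.
have [ms|sm] := leP mid s; first exact: tr2.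
rewrite (tr2 mid t) //; last first.
  by move=> u /andP[mu ut]; apply: free; rewrite ut (lt_trans sm mu).
rewrite free ?sm ?mt // conjg1; apply: tr1 => // u /andP[su um].
by apply: free; rewrite su (lt_trans um mt).
Qed.

(** The solution is f t = x ^ W t, where W t is the product of the jumps before
    t; W is built by inserting the jumps one at a time. *)
Lemma transport_exists g S lo hi (x : N) : supported g S ->
  exists f, transport g lo hi f /\ f lo = x.
Proof.
move=> gS.
suff [W hW] : exists W : R -> N, forall s t, s < t ->
    (forall u, (s < u < t)%R -> g u = 1) -> W t = W s * g s.
  exists (fun t => x ^ ((W lo)^-1 * W t)); split; last by rewrite mulVg conjg1.
  by move=> s t los st thi free; rewrite (hW s t) // -conjgM -mulgA.
elim: S g gS => [|v S IH] g gS.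
  exists (fun=> 1) => s t _ _; rewrite mul1g; apply/esym/(supportedN gS).
  by rewrite in_nil.
pose g0 u := if u == v then 1 else g u.
have [|W hW] := IH g0.
  move=> u; rewrite /g0; case: eqP => // uv /gS.
  by rewrite inE => /orP[/eqP|].
have g0free s t : (forall u, (s < u < t)%R -> g u = 1) ->
    forall u, (s < u < t)%R -> g0 u = 1.
  by move=> free u su; rewrite /g0; case: eqP => // _; exact: free.
exists (fun t => if t <= v then W t else W v * g v * ((W v)^-1 * W t)).
move=> s t st free; have [tv|vt] := leP t v.
  have sv := lt_le_trans st tv.
  by rewrite (ltW sv) (hW s t) ?/g0 ?(lt_eqF sv) //; exact: g0free.
have [sv|vs] := leP s v.
  have [svE|sv'] := eqVneq s v.
    rewrite svE (hW v t) //; last by apply: g0free => u uv; apply: free; rewrite svE.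
    by rewrite /g0 eqxx mulg1 mulVg mulg1.
  have {}sv : (s < v)%R by rewrite lt_neqAle sv'.
  rewrite (free v) ?sv // mulg1 mulVKg (hW s t) //; last exact: g0free.
  by rewrite /g0 (negbTE sv').
rewrite (hW s t) //; last exact: g0free.
by rewrite /g0 (gt_eqF vs) !mulgA.
Qed.

End OneGroup.

(** By uniqueness of the transported function, only the consecutive points of a
    finite set containing the jumps matter; some points of the set may carry a
    trivial jump. *)
Lemma transport_steps (N : groupType) (g f : R -> N) S lo hi : supported g S ->
  (forall s t, lo <= s -> s < t -> t <= hi ->
     (forall u, u \in S -> s < u < t -> False) -> f t = (f s ^ g s)%g) ->
  transport g lo hi f.
Proof.
move=> gS step.
have [f' [tr' f'lo]] := transport_exists lo hi (f lo) gS.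
have ff t : lo <= t <= hi -> f' t = f t.
  move=> /andP[lot thi].
  apply: (@jump_ind S (fun t => f' t = f t) lo hi) lot thi f'lo => //.
  move=> {}t u lot tu uhi noS ft; rewrite (step t u) //.
  rewrite (tr' t u) ?ft // => v tvu.
  by apply: (supportedN gS) => /noS; apply.
by apply: transport_eq tr' => [//|t /ff].
Qed.

(** The common finite set is there because [F] may make some jumps trivial, so
    that a piece of the strand can be free of jumps after [F] but not before. *)
Lemma transport_map (N N' : groupType) (F : N -> N') (g : R -> N) (g' : R -> N')
    S lo hi (f : R -> N) :
  supported g S -> supported g' S ->
  (forall u, lo <= u < hi -> F (f u ^ g u)%g = (F (f u) ^ g' u)%g) ->
  transport g lo hi f -> transport g' lo hi (F \o f).
Proof.
move=> gS g'S Fg tr; apply: (transport_steps g'S) => s t los st thi noS /=.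
rewrite (tr s t) // => [|v svt]; last by apply: (supportedN gS) => /noS; apply.
by rewrite Fg // los (lt_le_trans st thi).
Qed.

Lemma transport_patch (N : groupType) (g g' f f' : R -> N) lo hi a b :
  lo <= a -> a <= b -> b <= hi ->
  (forall u, ~ (a < u < b) -> g' u = g u) ->
  (forall u, ~ (a < u < b) -> f' u = f u) ->
  transport g' a b f' -> transport g lo hi f -> transport g' lo hi f'.
Proof.
move=> loa ab bhi gg ff trab tr.
apply: (@transport_glue _ _ _ lo a hi); [|apply: (@transport_glue _ _ _ a b hi) => //].
- apply: transport_eq (transport_sub (lexx lo) (le_trans ab bhi) tr).
    by move=> u /andP[_ ua]; rewrite gg //= => /andP[/(lt_trans ua)]; rewrite ltxx.
  by move=> u /andP[_ ua]; rewrite ff //= => /andP[/(le_lt_trans ua)]; rewrite ltxx.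
- apply: transport_eq (transport_sub (le_trans loa ab) (lexx hi) tr).
    by move=> u /andP[bu _]; rewrite gg //= => /andP[_ /(le_lt_trans bu)]; rewrite ltxx.
  by move=> u /andP[bu _]; rewrite ff //= => /andP[_ /(le_lt_trans bu)]; rewrite ltxx.
Qed.

End Transport.

(** * Colourings of diagrams by a group *)

Section Coloring.
Variables (R : realType) (m : nat) (D : diagram R m).
Implicit Types (p q : point D) (x : curve D).

Lemma crossing_sym p q : crossing p q -> crossing q p.
Proof. by case=> dp dq pq e; split => //; exact: nesym. Qed.

Lemma over_crossing p q : over p q -> crossing p q.
Proof. exact: (diag_over_crossing (diagP D)). Qed.

Lemma over_unique p p' q : over p q -> over p' q -> p = p'.
Proof.
move=> /over_crossing/crossing_sym h /over_crossing/crossing_sym h'.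
exact: (diag_double (diagP D)) h h'.
Qed.

Definition under p : Prop := exists q, over q p.

Lemma dom01 p : dom p -> 0 <= p.2 <= 1.
Proof. by rewrite /dom; case: p.1 => // _ /andP[-> /ltW ->]. Qed.

Lemma over_dom p q : over p q -> dom p /\ dom q.
Proof. by move=> /over_crossing[]. Qed.

Lemma under_seq : exists S : seq R, forall p, under p -> p.2 \in S.
Proof.
have /finite_seqP[s hs] := diag_finite (diagP D).
exists [seq pq.2.2 | pq <- s] => p [q /over_crossing qp].
have : [set` s] (q, p) by rewrite -hs.
by move=> /= h; apply/mapP; exists (q, p).
Qed.

Section OneGroup.
Variable N : groupType.
Implicit Types c d : point D -> N.

(** The conjugating element of the Wirtinger relation.  Being defined at all
    points, and trivial off the undercrossings, it allows colours to be attached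
    to points instead of arcs. *)
Definition jump c p : N :=
  if pselect (exists q, over q p) is left h then
    let q := sval (cid h) in if positive q p then c q else (c q)^-1%g
  else 1%g.

Lemma jump_over c p q : over q p ->
  jump c p = if positive q p then c q else (c q)^-1%g.
Proof.
move=> qp; rewrite /jump; case: pselect => [h|]; last by case; exists q.
by rewrite (over_unique (svalP (cid h)) qp).
Qed.

Lemma jump1 c p : ~ under p -> jump c p = 1%g.
Proof. by rewrite /jump; case: pselect. Qed.

(** Loops are cut open at the parameter 0: closing up is a separate condition, which
    is lost when the colours are lifted to a central extension. *)
Definition coloring c : Prop :=
  forall x, transport (fun t => jump c (x, t)) 0 1 (fun t => c (x, t)).

Lemma jump_supported : exists S, forall c x, supported (fun t => jump c (x, t)) S.
Proof.
have [S hS] := under_seq; exists S => c x u h.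
by apply: (hS (x, u)); apply: contrapT => /(jump1 c).
Qed.

Lemma jump_ext c d p :
  (forall q, over q p -> c q = d q) -> jump c p = jump d p.
Proof.
move=> h; have [[q qp]|np] := pselect (under p); last by rewrite !jump1.
by rewrite !(jump_over _ qp) h.
Qed.

Lemma jump_ceq c d p :
  (forall q, over q p -> ceq (c q) (d q)) -> ceq (jump c p) (jump d p).
Proof.
move=> h; have [[q qp]|np] := pselect (under p); last first.
  by rewrite !jump1 //; exact: ceq_refl.
rewrite !(jump_over _ qp); case: positive; first exact: h.
exact/ceqV/h.
Qed.

Lemma jump_lower_central k c d p :
  (forall q, over q p -> nsub (lower_central N k) ((c q)^-1 * d q)%g) ->
  nsub (lower_central N k) ((jump c p)^-1 * jump d p)%g.
Proof.
move=> h; have [[q qp]|np] := pselect (under p); last first.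
  by rewrite !jump1 // mulVg; exact: nsub1.
rewrite !(jump_over _ qp); case: positive; first exact: h.
have := nsubJ (c q)^-1%g (nsubV (h q qp)).
by rewrite conjgE !invgM !invgK -!mulgA mulgV mulg1.
Qed.

(** Central factors do not affect the conjugations at the undercrossings. *)
Lemma coloring_shift c (z : curve D -> N) : (forall x, central (z x)) ->
  coloring c -> coloring (fun p => c p * z p.1)%g.
Proof.
have [S hS] := jump_supported.
move=> hz hc x.
apply: (@transport_map _ _ _ (fun y => y * z x)%g _ _ S) (hc x) => // u _ /=.
rewrite conj_centralM //; congr (_ * _)%g.
by apply: ceqJ; apply/ceq_sym/jump_ceq => q _; exact: ceqM.
Qed.

(** If two colourings agree modulo a term of the lower central series, they are
    transported in the same way modulo the next term. *)
Lemma coloring_unique n c d : nilpotent_of_class n N ->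
  coloring c -> coloring d -> (forall x, c (x, 0) = d (x, 0)) ->
  forall p, 0 <= p.2 <= 1 -> c p = d p.
Proof.
have [S hS] := jump_supported.
move=> hN hc hd cd0.
suff cd k p : 0 <= p.2 <= 1 -> nsub (lower_central N k.+1) ((c p)^-1 * d p)%g.
  by move=> p /(cd n) /hN h; apply/esym/(mulgI (c p)^-1%g); rewrite h mulVg.
elim: k p => [|k IH] [x t]; first by [].
move=> /= /andP[t0 t1].
apply: (@jump_ind _ S (fun t => nsub (lower_central N k.+2)
   ((c (x, t))^-1 * d (x, t))%g) 0 1) (lexx 0) t0 t1 _; last first.
  by rewrite cd0 mulVg; exact: nsub1.
move=> {}t u t0 tu u1 noS h.
have free e v : t < v < u -> jump e (x, v) = 1%g.
  by move=> tvu; apply: (supportedN (hS e x)) => /noS; apply.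
rewrite (hc x t u) // => [|v]; last exact: free.
rewrite (hd x t u) // => [|v]; last exact: free.
apply: lower_central_conj h; apply: jump_lower_central => q /over_dom[/dom01 hq _].
exact: IH.
Qed.

(** Picard iteration: recomputing the colours with the jumps given by the previous
    approximation gains one term of the lower central series at each round. *)
Lemma coloring_exists n (a : curve D -> N) : nilpotent_of_class n N ->
  exists2 c, coloring c & forall x, c (x, 0) = a x.
Proof.
have [S hS] := jump_supported.
move=> hN.
have step c : exists d : point D -> N, (forall x,
    transport (fun t => jump c (x, t)) 0 1 (fun t => d (x, t))) /\
    forall x, d (x, 0) = a x.
  have /choice[f hf] x := transport_exists 0 1 (a x) (hS c x).
  by exists (fun p => f p.1 p.2); split => x; case: (hf x).
have /choice[F hF] := step.
pose c k := iter k F (fun=> 1%g).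
have cc k p : 0 <= p.2 <= 1 ->
    nsub (lower_central N k.+1) ((c k p)^-1 * c k.+1 p)%g.
  elim: k p => [|k IH] [x t]; first by [].
  move=> /= /andP[t0 t1].
  have [tr1 a1] := hF (c k); have [tr2 a2] := hF (c k.+1).
  apply: (@jump_ind _ S (fun t => nsub (lower_central N k.+2)
     ((c k.+1 (x, t))^-1 * c k.+2 (x, t))%g) 0 1) (lexx 0) t0 t1 _; last first.
    by rewrite [c k.+1 _]a1 [c k.+2 _]a2 mulVg; exact: nsub1.
  move=> {}t u t0 tu u1 noS h.
  have free e v : t < v < u -> jump e (x, v) = 1%g.
    by move=> tvu; apply: (supportedN (hS e x)) => /noS; apply.
  rewrite [c k.+1 _](tr1 x t u) // => [|v]; last exact: free.
  rewrite [c k.+2 _](tr2 x t u) // => [|v]; last exact: free.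
  apply: lower_central_conj h; apply: jump_lower_central => q /over_dom[/dom01 hq _].
  exact: IH.
have [tr a1] := hF (c n); exists (c n.+1) => // x.
apply: transport_eq (tr x) => // t _.
apply: jump_ext => q /over_dom[/dom01 /(cc n)/hN h _].
by apply/esym/(mulgI (c n q)^-1%g); rewrite h mulVg.
Qed.

End OneGroup.

Lemma coloring_hom (N N' : groupType) (f : {multiplicative N -> N'})
    (c : point D -> N) : coloring c -> coloring (fun p => f (c p)).
Proof.
have [S hS] := jump_supported N; have [S' hS'] := jump_supported N'.
move=> hc x.
have fJ p : jump (fun p => f (c p)) p = f (jump c p).
  have [[q qp]|np] := pselect (under p); last by rewrite !jump1 // hom1.
  by rewrite !(jump_over _ qp); case: positive; rewrite ?homV.
apply: (@transport_map _ _ _ f _ _ (S ++ S')) (hc x).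
- by move=> u /hS; rewrite mem_cat => ->.
- by move=> u /hS'; rewrite mem_cat orbC => ->.
- by move=> u _ /=; rewrite homJ fJ.
Qed.

(** The ends of a string are not crossings, because the rest of the diagram lies
    in the interior of the box. *)
Lemma string_end_no_crossing (i : 'I_m) t p : t = 0 \/ t = 1 ->
  ~ crossing (inl i, t) p.
Proof.
have mkE (a b : R) : (mkpt a b 0 0 = a) * (mkpt a b 0 1 = b).
  by rewrite !mxE.
move=> t01 [_ dp ip e].
have et : exists b : bool, t = b%:R /\ at_ ((inl i, t) : point D) = mkpt b%:R i.+1%:R :> plane R.
  case: t01 => ->; [exists false|exists true]; split => //; rewrite ?mulr0n ?mulr1n.
    exact: (diag_left (diagP D)).
  exact: (diag_right (diagP D)).
case: et => b [tb e']; rewrite e' in e.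
have notin : ~ box_interior m (mkpt b%:R i.+1%:R : plane R).
  by move=> [+ _]; rewrite mkE; case: (b); rewrite ltxx ?andbF.
case: p => [[j|l] s] in dp ip e *; last first.
  by apply: notin; rewrite e; exact: (diag_inside (diagP D)).
have [s01|s01] := boolP (0 < s < 1).
  by apply: notin; rewrite e; exact: (diag_proper (diagP D)).
have [b' [sb' e'']] : exists b' : bool, s = b'%:R /\
    at_ ((inl j, s) : point D) = mkpt b'%:R j.+1%:R :> plane R.
  move: dp s01; rewrite /dom /= => /andP[s0 s1].
  have [->|sn0] := eqVneq s 0.
    by exists false; split => //; rewrite mulr0n; exact: (diag_left (diagP D)).
  have [->|sn1] := eqVneq s 1.
    by exists true; split => //; rewrite mulr1n; exact: (diag_right (diagP D)).
  by rewrite !lt_neqAle s0 s1 sn1 eq_sym sn0.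
apply: ip; rewrite tb sb'; rewrite e'' in e.
have eb : b%:R = b'%:R :> R by have := congr1 (fun v : plane R => v 0 0) e; rewrite !mkE.
have ej : i.+1%:R = j.+1%:R :> R by have := congr1 (fun v : plane R => v 0 1) e; rewrite !mkE.
by move/eqP: ej; rewrite eqr_nat eqSS => /eqP/val_inj ->; rewrite eb.
Qed.

End Coloring.

(** * The surface of a concordance has no first cohomology *)

Section Center.
Local Open Scope group_scope.
Variable N : groupType.

Definition center : Type := {z : N | `[< central z >]}.
HB.instance Definition _ := Choice.on center.

Definition to_center (z : N) (hz : central z) : center := exist _ z (asboolT hz).

Lemma centerP (z : center) : central (val z).
Proof. exact/asboolP/(valP z). Qed.

Definition center_add (y z : center) : center :=
  to_center (centralM (centerP y) (centerP z)).
Definition center_opp (z : center) : center := to_center (centralV (centerP z)).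
Definition center_zero : center := to_center (@central1 N).

Fact center_addA : associative center_add.
Proof. by move=> x y z; apply: val_inj; rewrite /= mulgA. Qed.
Fact center_addC : commutative center_add.
Proof. by move=> x y; apply: val_inj; exact: (centerP x). Qed.
Fact center_add0 : left_id center_zero center_add.
Proof. by move=> x; apply: val_inj; rewrite /= mul1g. Qed.
Fact center_addN : left_inverse center_zero center_opp center_add.
Proof. by move=> x; apply: val_inj; rewrite /= mulVg. Qed.

HB.instance Definition _ := GRing.isZmodule.Build center
  center_addA center_addC center_add0 center_addN.

Lemma val_centerD (y z : center) : val (y + z)%R = val y * val z.
Proof. by []. Qed.

Lemma ceq_center (x y : N) : ceq x y -> exists z : center, y = x * val z.
Proof. by move=> /ceqE[z hz ->]; exists (to_center hz). Qed.

End Center.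

Section SquareIncidence.
Variables (E V : finType) (A : {pred E}).
Variables (B : E -> V -> int) (P : V -> E -> int).
Hypothesis cardA : #|A| = #|V|.
Hypothesis PB : forall v w, \sum_(e in A) P v e * B e w = (v == w)%:R.

(** A left inverse of a square integer matrix is a right inverse.  The incidence
    matrix of the movie is square because its Euler numbers vanish, and paths from
    the strings to the loops give the left inverse. *)
Lemma square_inverse e e' : e \in A -> e' \in A ->
  \sum_v B e v * P v e' = (e == e')%:R.
Proof.
move=> eA e'A.
have cardV := cardA.
pose bV (i : 'I_#|A|) : V := enum_val (cast_ord cardV i).
pose MB := \matrix_(i < #|A|, j < #|A|) B (enum_val i) (bV j).
pose MP := \matrix_(i < #|A|, j < #|A|) P (bV i) (enum_val j).
have bV_bij : bijective bV.
  exists (fun v => cast_ord (esym cardV) (enum_rank v)) => [i|v].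
    by rewrite /bV enum_valK cast_ordK.
  by rewrite /bV cast_ordKV enum_rankK.
have : MP *m MB = 1%:M.
  apply/matrixP => i j; rewrite !mxE.
  under eq_bigr do rewrite !mxE.
  rewrite -(big_enum_val (fun e => P (bV i) e * B e (bV j))) PB.
  by rewrite (inj_eq (bij_inj bV_bij)).
move=> /mulmx1C /matrixP /(_ (enum_rank_in eA e) (enum_rank_in eA e')).
rewrite !mxE -(inj_eq enum_val_inj) !enum_rankK_in // => <-.
under [RHS]eq_bigr do rewrite !mxE !enum_rankK_in //.
by rewrite (reindex bV) //; exact: onW_bij.
Qed.

Variable Z : zmodType.

Lemma flow_eq0 (f : E -> Z) :
  (forall v, \sum_(e in A) f e *~ B e v = 0) -> forall e, e \in A -> f e = 0.
Proof.
move=> f0 e eA.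
have -> : f e = \sum_(e' in A) f e' *~ (\sum_v B e' v * P v e).
  rewrite (bigD1 e) //= square_inverse // eqxx mulr1z big1 ?addr0 //.
  by move=> e' /andP[e'A /negPf ne]; rewrite square_inverse // ne mulr0z.
transitivity (\sum_v (\sum_(e' in A) f e' *~ B e' v) *~ P v e); last first.
  by apply: big1 => v _; rewrite f0 mul0rz.
under [RHS]eq_bigr do rewrite mulrz_suml; rewrite [RHS]exchange_big /=.
apply: eq_bigr => e' _; rewrite mulrz_sumr; apply: eq_bigr => v _.
by rewrite mulrzA.
Qed.

Lemma potential_exists (d : E -> Z) :
  exists z : V -> Z, forall e, e \in A -> \sum_v z v *~ B e v = d e.
Proof.
exists (fun v => \sum_(e in A) d e *~ P v e) => e eA.
under eq_bigr do rewrite mulrz_suml; rewrite exchange_big /=.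
transitivity (\sum_(e' in A) d e' *~ (\sum_v B e v * P v e')).
  apply: eq_bigr => e' _; rewrite mulrz_sumr; apply: eq_bigr => v _.
  by rewrite mulrC mulrzA.
rewrite (bigD1 e) //= square_inverse // eqxx mulr1z big1 ?addr0 //.
by move=> e' /andP[e'A ne]; rewrite square_inverse // eq_sym (negPf ne) mulr0z.
Qed.

End SquareIncidence.

Section LoopEdges.
Variables (R : realType) (m : nat).
Implicit Types D : diagram R m.

Definition is_loop D (x : curve D) : bool := if x is inr _ then true else false.

(** Connections between two strings are left out: the strings are collapsed to a
    base point, relative to which the loops are connected. *)
Definition loop_edges D D' (T : curve D -> curve D' -> Prop) :
    {pred curve D * curve D'} :=
  fun e => `[< T e.1 e.2 >] && (is_loop e.1 || is_loop e.2).

Definition euler_total (e : event m) : int := \sum_(i < m) euler i e.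

End LoopEdges.

Section MovieGraph.
Variables (R : realType) (m Nn : nat) (D : nat -> diagram R m).
Variables (T : forall k, curve (D k) -> curve (D k.+1) -> Prop).
Variables (ev : nat -> event m).
Hypothesis no_loop_first : string_link (D 0).
Hypothesis no_loop_last : string_link (D Nn).
Hypothesis connected : connected_trace Nn T.
Hypothesis euler0 : forall i : 'I_m, \sum_(k < Nn) euler i (ev k) = 0.
Hypothesis edge_count : forall k, (k < Nn)%N ->
  #|loop_edges (T (k := k))|%:Z *+ 2 + euler_total (ev k) =
  #|loop (D k)|%:Z + #|loop (D k.+1)|%:Z.

Let vertex : finType := {k : 'I_Nn.+1 & loop (D k)}.
Let edge : finType := {k : 'I_Nn & (curve (D k) * curve (D k.+1))%type}.
Let edges : {pred edge} := fun e => loop_edges (T (k := tag e)) (tagged e).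

Let node (v : vertex) : movie_curve D :=
  Tagged (fun k => curve (D k)) (inr (tagged v)).
Let source (e : edge) : movie_curve D :=
  Tagged (fun k => curve (D k)) (tagged e).1.
Let target (e : edge) : movie_curve D :=
  @Tagged _ (tag e).+1 (fun k => curve (D k)) (tagged e).2.

Let incidence (e : edge) (v : vertex) : int :=
  `[< target e = node v >]%:R - `[< source e = node v >]%:R.

Let string_node k i v : Tagged (fun k => curve (D k)) (inl i : curve (D k)) <> node v.
Proof. by move=> /(congr1 (fun u : movie_curve D => is_loop (tagged u))). Qed.

Let chain_exists (u w : movie_curve D) :
  clos_refl_sym_trans _ (trace_step Nn T) u w ->
  exists q : edge -> int, forall v,
    \sum_(e in edges) q e * incidence e v =
    `[< w = node v >]%:R - `[< u = node v >]%:R.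
Proof.
elim=> {u w} [u w [k x x' kN Txx']|u|u w _ [q hq]|u w y _ [q hq] _ [q' hq']].
- pose e0 : edge := Tagged (fun k : 'I_Nn => (curve (D k) * curve (D k.+1))%type)
    ((x, x') : curve (D (Ordinal kN)) * curve (D (Ordinal kN).+1)).
  have [e0E|/negP e0E] := boolP (e0 \in edges).
    exists (fun e => (e == e0)%:R) => v.
    rewrite (bigD1 e0) //= eqxx mul1r big1 ?addr0 //.
    by move=> e /andP[_ /negPf ->]; rewrite mul0r.
  exists (fun=> 0) => v; rewrite big1 => [|e _]; last by rewrite mul0r.
  have : ~~ (is_loop x || is_loop x').
    by apply/negP => xx'; apply: e0E; rewrite unfold_in /loop_edges /= xx' andbT; apply/asboolP.
  case: x x' {Txx' e0 e0E} => [i|//] [j|//] _.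
  by rewrite !asboolF ?subrr //; apply: string_node.
- by exists (fun=> 0) => v; rewrite subrr big1 // => e _; rewrite mul0r.
- exists (fun e => - q e) => v; rewrite -opprB -hq -sumrN.
  by apply: eq_bigr => e _; rewrite mulNr.
- exists (fun e => q e + q' e) => v.
  under eq_bigr do rewrite mulrDl.
  by rewrite big_split /= hq hq' addrC addrA subrK.
Qed.

Let node_inj : injective node.
Proof.
move=> [k l] [k' l'] h; have kk : k = k' by apply/val_inj/(congr1 tag h).
by subst k'; congr existT; move/eqP: h; rewrite eq_Tagged => /eqP[].
Qed.

Let paths : exists P : vertex -> edge -> int, forall v w,
  \sum_(e in edges) P v e * incidence e w = (v == w)%:R.
Proof.
have /choice[P hP] : forall v : vertex, exists q : edge -> int, forall w,
    \sum_(e in edges) q e * incidence e w = (v == w)%:R.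
  move=> v; have [q hq] := chain_exists (connected (inr (tagged v)) (ltn_ord (tag v))).
  exists q => w; rewrite hq [X in _ - (nat_of_bool X)%:R]asboolF ?subr0; last exact: string_node.
  congr (nat_of_bool _)%:R; apply/asboolP/eqP => [/(@node_inj v w)//|->//].
by exists P.
Qed.

Let card_edges : #|edges| = #|vertex|.
Proof.
have cV : #|vertex| = (\sum_(k < Nn.+1) #|loop (D k)|)%N.
  by rewrite card_tagged sumnE big_map big_enum.
have cE : #|edges| = (\sum_(k < Nn) #|loop_edges (T (k := k))|)%N.
  rewrite -sum1_card; under [RHS]eq_bigr do rewrite -sum1_card.
  by rewrite (@sig_big_dep _ _ _ _ (fun k : 'I_Nn => (curve (D k) * curve (D k.+1))%type : finType) predT
     (fun k => mem (loop_edges (T (k := k)))) (fun k _ => 1%N)).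
have n0 : #|loop (D 0)| = 0%N.
  by apply: eq_card0 => l; have := no_loop_first l.
have nN : #|loop (D Nn)| = 0%N.
  by apply: eq_card0 => l; have := no_loop_last l.
have tot : \sum_(k < Nn) euler_total (ev k) = 0.
  by rewrite exchange_big /=; apply: big1 => i _; exact: euler0.
have : (\sum_(k < Nn) #|loop_edges (T (k := k))|%:Z) *+ 2 =
       \sum_(k < Nn) #|loop (D k)|%:Z + \sum_(k < Nn) #|loop (D k.+1)|%:Z.
  rewrite -big_split /= -[LHS]addr0 -[X in _ + X = _]tot -sumrMnl -[LHS]big_split /=.
  by apply: eq_bigr => k _; exact: edge_count.
have V1 : \sum_(k < Nn) #|loop (D k)|%:Z = #|vertex|%:Z.
  by rewrite cV big_ord_recr /= nN addn0 -natz natr_sum; under [RHS]eq_bigr do rewrite natz.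
have V2 : \sum_(k < Nn) #|loop (D k.+1)|%:Z = #|vertex|%:Z.
  by rewrite cV big_ord_recl /= n0 add0n -natz natr_sum; under [RHS]eq_bigr do rewrite natz.
have E1 : \sum_(k < Nn) #|loop_edges (T (k := k))|%:Z = #|edges|%:Z.
  by rewrite cE -[RHS]natz natr_sum; under [RHS]eq_bigr do rewrite natz.
by rewrite V1 V2 E1; lia.
Qed.

Variable Z : zmodType.

(** Modulo the strings, the graph of the movie is connected, and it has as many
    edges as loops because the Euler numbers vanish; being a tree, it carries no
    flow. *)
Lemma movie_flow_eq0 (f : forall k, curve (D k) -> curve (D k.+1) -> Z) :
  (forall k x x', (k < Nn)%N -> ~ T x x' -> f k x x' = 0) ->
  (forall k (l : loop (D k.+1)), (k.+1 < Nn)%N ->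
     \sum_x f k x (inr l) = \sum_x' f k.+1 (inr l) x') ->
  forall k x x', (k < Nn)%N -> is_loop x || is_loop x' -> f k x x' = 0.
Proof.
move=> fT cons k x x' kN xx'.
have [Txx'|/fT ->//] := pselect (T x x').
have [P hP] := paths.
pose F (e : edge) : Z := f (tag e) (tagged e).1 (tagged e).2.
suff F0 v : \sum_(e in edges) F e *~ incidence e v = 0.
  pose e0 : edge := Tagged (fun k : 'I_Nn => (curve (D k) * curve (D k.+1))%type)
    ((x, x') : curve (D (Ordinal kN)) * curve (D (Ordinal kN).+1)).
  apply: (flow_eq0 card_edges hP F0 (e := e0)).
  by rewrite unfold_in /loop_edges /= xx' andbT; apply/asboolP.
have sumE (Q : movie_curve D -> movie_curve D -> bool) :
  (forall k i j, Q (Tagged (fun k => curve (D k)) (inl i : curve (D k)))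
                   (@Tagged _ k.+1 (fun k => curve (D k)) (inl j)) = false) ->
  \sum_(e in edges) F e *~ (Q (source e) (target e))%:R =
  \sum_(k < Nn) \sum_y \sum_y' f k y y' *~
     (Q (Tagged (fun k => curve (D k)) y) (@Tagged _ k.+1 (fun k => curve (D k)) y'))%:R.
  move=> hQ; under [RHS]eq_bigr do rewrite pair_big /=.
  rewrite (@sig_big_dep _ _ _ _ (fun k : 'I_Nn => (curve (D k) * curve (D k.+1))%type : finType) predT
     (fun k => predT) (fun k p => f k p.1 p.2 *~
     (Q (Tagged (fun k => curve (D k)) p.1) (@Tagged _ k.+1 (fun k => curve (D k)) p.2))%:R)) /=.
  rewrite big_mkcond /=; apply: eq_bigr => -[j [y y']] _ /=.
  rewrite unfold_in /loop_edges /=; case: ifPn => //.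
  rewrite negb_and => /orP[/asboolPn/fT ->//|]; first by rewrite mul0rz.
  by case: y y' => [i|//] [i'|//] _; rewrite hQ.
under eq_bigr do rewrite mulrzBr; rewrite sumrB.
rewrite (sumE (fun s t => `[< t = node v >])) => [|*]; last exact/asboolF/string_node.
rewrite (sumE (fun s t => `[< s = node v >])) => [|*]; last exact/asboolF/string_node.
have tag_node (u : movie_curve D) : u = node v -> tag u = tag v :> nat by move=> ->.
case: v tag_node => -[[|j] jN] l tag_node; first by case: (no_loop_first l).
have jN1 : (j < Nn)%N by [].
have jN2 : (j.+1 < Nn)%N.
  have := jN; rewrite ltnS leq_eqVlt => /orP[/eqP jE|//].
  by exfalso; apply: no_loop_last; rewrite -jE; exact: l.
rewrite (bigD1 (Ordinal jN1)) //= [X in _ + X - _]big1 ?addr0; last first.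
  move=> i ij; apply: big1 => y _; apply: big1 => y' _; rewrite asboolF //.
  by move=> /tag_node /= [h]; move/eqP: ij; apply; apply/val_inj.
rewrite [X in _ - X](bigD1 (Ordinal jN2)) //= [X in _ - (_ + X)]big1 ?addr0; last first.
  move=> i ij; apply: big1 => y _; apply: big1 => y' _; rewrite asboolF //.
  by move=> /tag_node /= h; move/eqP: ij; apply; apply/val_inj.
apply/eqP; rewrite subr_eq0; apply/eqP.
transitivity (\sum_x f j x (inr l)).
  apply: eq_bigr => y _; rewrite (bigD1 (inr l)) //= asboolT // mulr1z big1 ?addr0 //.
  move=> y' yl; rewrite asboolF ?mulr0z // => h; move: yl.
  by move/eqP: h; rewrite eq_Tagged => /eqP /= ->; rewrite eqxx.
rewrite cons // [RHS](bigD1 (inr l)) //= [X in _ = _ + X]big1 ?addr0.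
  by apply: eq_bigr => y _; rewrite asboolT // mulr1z.
move=> y yl; apply: big1 => y' _; rewrite asboolF ?mulr0z // => h; move: yl.
by move/eqP: h; rewrite eq_Tagged => /eqP /= ->; rewrite eqxx.
Qed.

(** On a tree every cochain is a coboundary. *)
Lemma movie_potential (d : forall k, curve (D k) -> curve (D k.+1) -> Z) :
  exists z : forall k, curve (D k) -> Z,
    (forall k i, z k (inl i) = 0) /\
    forall k x x', (k < Nn)%N -> T x x' -> is_loop x || is_loop x' ->
      z k.+1 x' - z k x = d k x x'.
Proof.
have [P hP] := paths.
have [z hz] := potential_exists card_edges hP (fun e : edge => d (tag e) (tagged e).1 (tagged e).2).
pose z' k (x : curve (D k)) : Z :=
  \sum_v z v *~ `[< Tagged (fun k => curve (D k)) x = node v >]%:R.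
exists z'; split=> [k i|k x x' kN Txx' xx'].
  by apply: big1 => v _; rewrite asboolF //; exact: string_node.
pose e0 : edge := Tagged (fun k : 'I_Nn => (curve (D k) * curve (D k.+1))%type)
    ((x, x') : curve (D (Ordinal kN)) * curve (D (Ordinal kN).+1)).
rewrite -[d _ _ _](hz e0); last first.
  by rewrite unfold_in /loop_edges /= xx' andbT; apply/asboolP.
rewrite /z' -sumrB; apply: eq_bigr => v _.
by rewrite -mulrzBr.
Qed.

End MovieGraph.

(** * Colouring a whole concordance *)

Section Steps.
Variables (R : realType) (m : nat).
Implicit Types D : diagram R m.

(** How the colours before and after a move are compared: the colour of [x] at
    [par x x'] is that of [x'] at [par' x x'] for connected curves [x] and [x'];
    moreover a band may impose equality of two colours on one curve. *)
Record step_data D D' := StepData {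
  par : curve D -> curve D' -> R;
  par' : curve D -> curve D' -> R;
  same : curve D -> R -> R -> Prop;
  same' : curve D' -> R -> R -> Prop }.

Definition closed_by (N : groupType) (E : N -> N -> Prop) D (c : point D -> N) :=
  forall l, E (c (inr l, 0)) (c (inr l, 1)).

Definition band_by (N : groupType) (E : N -> N -> Prop) D
    (sm : curve D -> R -> R -> Prop) (c : point D -> N) :=
  forall x s t, sm x s t -> E (c (x, s)) (c (x, t)).

Definition matched_by (N : groupType) (E : N -> N -> Prop) D D'
    (T : curve D -> curve D' -> Prop) (sd : step_data D D')
    (c : point D -> N) (c' : point D' -> N) :=
  forall x x', T x x' -> E (c (x, par sd x x')) (c' (x', par' sd x x')).

(** The situation in the induction on the nilpotency class, after lifting exact
    colourings of a step from a central quotient. *)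
Record central_pair (n : nat) (N : groupType) D D' (T : curve D -> curve D' -> Prop)
    (sd : step_data D D') (c : point D -> N) (c' : point D' -> N) : Prop :=
  CentralPair {
    cp_nil : nilpotent_of_class n N;
    cp_col : coloring c;
    cp_col' : coloring c';
    cp_closed : closed_by (@ceq N) c;
    cp_closed' : closed_by (@ceq N) c';
    cp_match : matched_by (@ceq N) T sd c c';
    cp_band : band_by (@ceq N) (same sd) c;
    cp_band' : band_by (@ceq N) (same' sd) c' }.

(** What the proof uses about a move.  The defects of closedness of the loops
    before and after the move are the divergences of a flow along the
    connections of the move. *)
Record step_spec D D' (e : event m) (T : curve D -> curve D' -> Prop)
    (sd : step_data D D') : Prop := StepSpec {
  st_par : forall x x', T x x' -> 0 <= par sd x x' <= 1 /\ 0 <= par' sd x x' <= 1;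
  st_same : forall x s t, same sd x s t -> 0 <= s <= 1 /\ 0 <= t <= 1;
  st_same' : forall x s t, same' sd x s t -> 0 <= s <= 1 /\ 0 <= t <= 1;
  st_string : forall i j, T (inl i) (inl j) ->
    [/\ i = j, par sd (inl i) (inl j) = 0 & par' sd (inl i) (inl j) = 0];
  st_count : #|loop_edges T|%:Z *+ 2 + euler_total e = #|loop D|%:Z + #|loop D'|%:Z;
  st_flow : forall n (N : groupType) (c : point D -> N) (c' : point D' -> N),
    central_pair n T sd c c' ->
    exists f : curve D -> curve D' -> center N,
    [/\ forall x x', ~ T x x' -> f x x' = 0,
        forall l, c (inr l, 1) = (c (inr l, 0) * val (\sum_x' f (inr l) x')%R)%g
      & forall l', c' (inr l', 1) = (c' (inr l', 0) * val (\sum_x f x (inr l'))%R)%g];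
  st_band : forall n (N : groupType) (c : point D -> N) (c' : point D' -> N),
    central_pair n T sd c c' -> closed_by eq c -> closed_by eq c' ->
    band_by eq (same sd) c /\ band_by eq (same' sd) c';
  st_ends : forall n (N : groupType) (c : point D -> N) (c' : point D' -> N),
    central_pair n T sd c c' -> closed_by eq c -> closed_by eq c' ->
    matched_by eq T sd c c' -> forall i, c (inl i, 1) = c' (inl i, 1) }.

Definition flip_data D D' (sd : step_data D D') : step_data D' D :=
  StepData (fun x' x => par' sd x x') (fun x' x => par sd x x') (same' sd) (same sd).

Lemma central_pair_flip n (N : groupType) D D' (T : curve D -> curve D' -> Prop)
    sd (c : point D -> N) (c' : point D' -> N) :
  central_pair n (fun x' x => T x x') (flip_data sd) c' c -> central_pair n T sd c c'.
Proof.
by case=> h1 h2 h3 h4 h5 h6 h7 h8; split => // x x' ?; apply: ceq_sym; exact: h6.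
Qed.

Lemma euler_reverse (e : event m) : euler_total (reverse_event e) = euler_total e.
Proof. by case: e. Qed.

Lemma step_spec_flip D D' e (T : curve D -> curve D' -> Prop) sd :
  step_spec e T sd -> step_spec (reverse_event e) (fun x' x => T x x') (flip_data sd).
Proof.
case=> h1 h2 h3 h4 h5 h6 h7 h8; split=> //.
- by move=> x x' /h1[].
- by move=> i j /h4[].
- rewrite euler_reverse [RHS]addrC -h5; congr (_%:Z *+ 2 + _).
  pose sw (p : curve D * curve D') := (p.2, p.1).
  have swI : injective sw by move=> [? ?] [? ?] [-> ->].
  rewrite -(fintype.card_image swI); apply: eq_card => -[x' x].
  apply/idP/fintype.imageP => [h|[[y y'] h [-> ->]]].
    by exists (x, x') => //; move: h; rewrite !unfold_in /loop_edges /= orbC.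
  by move: h; rewrite !unfold_in /loop_edges /= orbC.
- move=> n N c c' /central_pair_flip/h6[f [f1 f2 f3]].
  by exists (fun x' x => f x x'); split => // x x'; exact: f1.
- by move=> n N c c' /central_pair_flip/h7 h k1 k2; have [] := h k2 k1.
- move=> n N c c' /central_pair_flip/h8 h k1 k2 h' i; apply/esym/h => //.
  by move=> x x' /h'.
Qed.

End Steps.

Section MovieColoring.
Variables (R : realType) (m Nn : nat) (D : nat -> diagram R m).
Variables (T : forall k, curve (D k) -> curve (D k.+1) -> Prop).
Variables (ev : nat -> event m) (sd : forall k, step_data (D k) (D k.+1)).
Hypothesis no_loop_first : string_link (D 0).
Hypothesis no_loop_last : string_link (D Nn).
Hypothesis connected : connected_trace Nn T.
Hypothesis euler0 : forall i : 'I_m, \sum_(k < Nn) euler i (ev k) = 0.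
Hypothesis steps : forall k, (k < Nn)%N -> step_spec (ev k) (T (k := k)) (sd k).

(** By induction on the class, the colours [a] of the strings extend to the whole
    movie modulo a central subgroup.  When the colours of all curves are lifted
    arbitrarily, the loops fail to close up by central elements which are the
    divergences of a flow; these agree from one move to the next, so that the flow
    vanishes and the loops close up after all.  The central discrepancies along
    the moves are then removed as a coboundary. *)
Lemma movie_coloring n (N : groupType) (a : 'I_m -> N) : nilpotent_of_class n N ->
  exists c : forall k, point (D k) -> N,
  [/\ forall k, coloring (c k), forall k i, c k (inl i, 0) = a i,
      forall k, (k <= Nn)%N -> closed_by eq (c k)
    & forall k, (k < Nn)%N -> [/\ matched_by eq (T (k := k)) (sd k) (c k) (c k.+1),
        band_by eq (same (sd k)) (c k) & band_by eq (same' (sd k)) (c k.+1)]].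
Proof.
have [h0 h1] : 0 <= (0 : R) <= 1 /\ 0 <= (1 : R) <= 1 by rewrite ler01 !lexx.
elim: n N a => [|n IH] N a hN.
  have N1 := nilpotent0 hN.
  exists (fun _ _ => 1%g); split => //.
  by move=> k x s t _ _ _ _; exact: N1.
have hNb := @nilquo_nilpotent n N.
pose pr := to_quo (lower_central N n.+1).
have prE x y : pr x = pr y -> ceq x y by exact: nilquo_ker_central.
have [cb [cb1 cb2 cb3 cb4]] := IH _ (fun i => pr (a i)) hNb.
pose base k (x : curve (D k)) : N :=
  match x with inl i => a i | inr l => repr (cb k (inr l, 0)) end.
pose c k := s2val (cid2 (coloring_exists (@base k) hN)).
have c1 k : coloring (c k) := s2valP (cid2 (coloring_exists (@base k) hN)).
have c0 k x : c k (x, 0) = base k x := s2valP' (cid2 (coloring_exists (@base k) hN)) x.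
have ccb k (p : point (D k)) : 0 <= p.2 <= 1 -> pr (c k p) = cb k p.
  apply: (coloring_unique hNb (coloring_hom (f := to_quo (lower_central N n.+1)) (c1 k)) (cb1 k)) => x /=.
  by rewrite c0; case: x => [i|l]; rewrite ?cb2 //= to_quoK.
have cp k : (k < Nn)%N -> central_pair n.+1 (T (k := k)) (sd k) (c k) (c k.+1).
  move=> kN; have [k1 k2 k3] := cb4 k kN; split => //.
  - move=> l; apply: prE; rewrite !ccb //.
    exact: cb3 (ltnW kN) _.
  - move=> l; apply: prE; rewrite !ccb //; exact: cb3.
  - move=> x x' Txx'; apply: prE; have [p1 p2] := st_par (steps kN) Txx'.
    by rewrite !ccb //; exact: k1.
  - move=> x s t hs; apply: prE; have [p1 p2] := st_same (steps kN) hs.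
    by rewrite !ccb //; exact: k2 hs.
  - move=> x s t hs; apply: prE; have [p1 p2] := st_same' (steps kN) hs.
    by rewrite !ccb //; exact: k3 hs.
have hf k : exists f : curve (D k) -> curve (D k.+1) -> center N, (k < Nn)%N ->
    [/\ forall x x', ~ T x x' -> f x x' = 0,
        forall l, c k (inr l, 1) = (c k (inr l, 0) * val (\sum_x' f (inr l) x')%R)%g
      & forall l', c k.+1 (inr l', 1) = (c k.+1 (inr l', 0) * val (\sum_x f x (inr l'))%R)%g].
  have [kN|_] := ltnP k Nn; last by exists (fun _ _ => 0).
  by have [f hf] := st_flow (steps kN) (cp k kN); exists f.
pose f k := sval (cid (hf k)).
have fP k kN := svalP (cid (hf k)) kN.
have f0 k (x : curve (D k)) (x' : curve (D k.+1)) :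
    (k < Nn)%N -> is_loop x || is_loop x' -> f k x x' = 0.
  apply: (movie_flow_eq0 no_loop_first no_loop_last connected euler0) => //.
  - by move=> j jN; exact: st_count (steps jN).
  - by move=> j y y' jN; have [h _ _] := fP j jN; exact: h.
  - move=> j l jN; have [_ _ h] := fP j (ltnW jN); have [_ h' _] := fP j.+1 jN.
    by apply: val_inj; apply: (mulgI (c j.+1 (inr l, 0))); rewrite -h -h'.
have cl k : (k <= Nn)%N -> closed_by eq (c k).
  rewrite leq_eqVlt => /orP[/eqP kE|kN] l.
    by exfalso; apply: no_loop_last; rewrite -kE; exact: l.
  have [_ -> _] := fP k kN; rewrite big1 ?mulg1 // => x _; exact: f0.
have bd k (kN : (k < Nn)%N) := st_band (steps kN) (cp k kN) (cl k (ltnW kN)) (cl k.+1 kN).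
have hd k (x : curve (D k)) (x' : curve (D k.+1)) : exists d : center N,
    (k < Nn)%N -> T x x' ->
    c k.+1 (x', par' (sd k) x x') = (c k (x, par (sd k) x x') * val d)%g.
  have [kN|_] := ltnP k Nn; last by exists 0.
  have [Txx'|//] := pselect (T x x'); last by exists 0.
  by have [d hd] := ceq_center (cp_match (cp k kN) Txx'); exists d.
pose d k x x' := sval (cid (@hd k x x')).
have [z [z0 hz]] : exists z : forall k, curve (D k) -> center N,
    (forall k i, z k (inl i) = 0) /\
    forall k x x', (k < Nn)%N -> T x x' -> is_loop x || is_loop x' ->
      z k.+1 x' - z k x = - d k x x'.
  apply: (movie_potential no_loop_first no_loop_last connected euler0) => //.
  by move=> j jN; exact: st_count (steps jN).
exists (fun k p => c k p * val (z k p.1))%g; split.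
- by move=> k; exact: (coloring_shift (fun x => centerP (z k x)) (c1 k)).
- by move=> k i; rewrite /= z0 mulg1 c0.
- by move=> k kN l /=; rewrite cl.
- move=> k kN; split; last first.
  + by move=> x s t hs /=; rewrite ((bd k kN).2 _ _ _ hs).
  + by move=> x s t hs /=; rewrite ((bd k kN).1 _ _ _ hs).
  move=> x x' Txx' /=; have [xx'|] := boolP (is_loop x || is_loop x'); last first.
    case: x x' Txx' => [i|//] [j|//] /(st_string (steps kN))[<- -> ->] _.
    by rewrite !z0 !c0.
  rewrite (_ : c k.+1 _ = c k (x, par (sd k) x x') * val (d k x x'))%g; last first.
    exact: svalP (cid (@hd k x x')) kN Txx'.
  rewrite -[RHS]mulgA -val_centerD; congr (_ * val _)%g.
  by move/eqP: (hz k x x' kN Txx' xx'); rewrite subr_eq => /eqP ->; rewrite addNKr.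
Qed.

Lemma movie_string_ends n (N : groupType) (a : 'I_m -> N) : nilpotent_of_class n N ->
  exists (c : point (D 0) -> N) (c' : point (D Nn) -> N),
  [/\ coloring c /\ coloring c', forall i, c (inl i, 0) = a i,
      forall i, c' (inl i, 0) = a i & forall i, c (inl i, 1) = c' (inl i, 1)].
Proof.
move=> hN; have [c [c1 c2 c3 c4]] := movie_coloring a hN.
exists (c 0%N), (c Nn); split => // i.
suff h k : (k <= Nn)%N -> c 0%N (inl i, 1) = c k (inl i, 1) by exact: h.
elim: k => [//|k IH] kN; rewrite IH ?(ltnW kN) //.
have [k1 k2 k3] := c4 k kN.
have ecq x y : x = y -> @ceq N x y by move=> ->; exact: ceq_refl.
suff cp : central_pair n (T (k := k)) (sd k) (c k) (c k.+1).
  exact: (st_ends (steps kN) cp (c3 k (ltnW kN)) (c3 k.+1 kN) k1 i).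
split => //.
- by move=> l; apply/ecq/(c3 k (ltnW kN)).
- by move=> l; apply/ecq/(c3 k.+1 kN).
- by move=> x x' h; apply/ecq/k1.
- by move=> x s t h; apply/ecq; exact: k2 h.
- by move=> x s t h; apply/ecq; exact: k3 h.
Qed.

End MovieColoring.

(** * Colourings and the Artin representation *)

Section LinkGroup.
Variables (R : realType) (m : nat) (D : diagram R m).
Implicit Types (i k : 'I_m).

Lemma mem_unders i t : t \in unders D i <-> under ((inl i, t) : point D).
Proof.
have [S hS] := under_seq D.
rewrite mem_sort in_fset_set; last first.
  by apply: (sub_finite_set _ (finite_seq S)) => u; exact: hS.
by split=> [/set_mem|h]; last exact: mem_set.
Qed.

Lemma unders_sorted i : sorted <%R (unders D i).
Proof. by rewrite /unders sort_lt_sorted fset_uniq. Qed.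

Lemma unders_inside i t : t \in unders D i -> 0 < t < 1.
Proof.
move=> /mem_unders[p /[dup] /over_crossing/crossing_sym h].
move=> /over_dom[_] /dom01 /= /andP[t0 t1].
rewrite !lt_neqAle t0 t1 !andbT; apply/andP; split.
  by apply/eqP => t0'; apply: string_end_no_crossing h; left.
by apply/eqP => t1'; apply: string_end_no_crossing h; right.
Qed.

(** The default value is the right end of the last arc. *)
Definition arc_end i (j : nat) : R := nth 1 (unders D i) j.

Lemma arc_end_in01 i j : 0 <= arc_end i j <= 1.
Proof.
rewrite /arc_end; have [sj|js] := leqP (size (unders D i)) j.
  by rewrite nth_default // ler01 lexx.
by have /unders_inside/andP[/ltW -> /ltW ->] := mem_nth 1 js.
Qed.

Lemma arc_end_le i t u : u \in unders D i -> t <= u ->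
  arc_end i (count (fun v => v < t) (unders D i)) <= u.
Proof.
move=> uU tu; have kz := uU; rewrite -index_mem in kz; set k := index u _ in kz.
have uE : u = arc_end i k by rewrite /arc_end nth_index.
have jk : (count (fun v => (v < t)%R) (unders D i) <= k)%N.
  rewrite -[leqRHS](count_lt_nth 1 (unders_sorted i) kz) -[nth _ _ _]uE.
  by apply: sub_count => v /= vt; exact: lt_le_trans tu.
rewrite uE /arc_end (lt_sorted_leq_nth 1 (unders_sorted i)) ?inE //.
exact: leq_ltn_trans kz.
Qed.

Lemma arc_end_ge i t : t <= 1 -> t <= arc_end i (count (fun v => v < t) (unders D i)).
Proof.
move=> t1; rewrite /arc_end; set j := count _ _.
have [sj|js] := leqP (size (unders D i)) j; first by rewrite nth_default.
rewrite leNgt; apply/negP => h.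
have := count_le_nth 1 (unders_sorted i) js.
have : (count (fun v => (v <= nth 1 (unders D i) j)%R) (unders D i) <= j)%N.
  by apply: sub_count => v /= vn; exact: le_lt_trans h.
by move=> + e; rewrite e ltnn.
Qed.

Section Colors.
Variables (N : groupType) (c : point D -> N).
Hypothesis hc : coloring c.

(** No undercrossing separates [t] from the right end of its arc. *)
Lemma coloring_arc i t : 0 <= t <= 1 ->
  c (inl i, t) = c (inl i, arc_end i (count (fun v => v < t) (unders D i))).
Proof.
move=> /andP[t0 t1]; have := arc_end_ge i t1; rewrite le_eqVlt.
move=> /orP[/eqP <- //|te]; set e := arc_end i _ in te *.
have no u : t <= u -> u < e -> jump c (inl i, u) = 1%g.
  move=> tu ue; apply: jump1 => /mem_unders uU.
  by have := le_lt_trans (arc_end_le uU tu) ue; rewrite ltxx.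
have /andP[_ e1] := arc_end_in01 i (count (fun v => v < t) (unders D i)).
rewrite [RHS](hc (x := inl i) t0 te e1) ?no ?conjg1 // => u /andP[/ltW tu ue].
exact: no.
Qed.

Definition arc_color (a : link_arc D) : N := c (inl (tag a), arc_end (tag a) (tagged a)).

Lemma arc_color_at i t : 0 <= t <= 1 -> arc_color (arc_at D i t) = c (inl i, t).
Proof.
move=> ht; rewrite (coloring_arc i ht) /arc_color /= inordK // ltnS.
exact: count_size.
Qed.

Lemma arc_color_nth i j : (j <= size (unders D i))%N ->
  arc_color (arc_nth D i j) = c (inl i, arc_end i j).
Proof. by move=> h; rewrite /arc_color /= inordK. Qed.

Lemma count_before0 i : count (fun u => u < 0) (unders D i) = 0%N.
Proof.
apply/eqP; rewrite -leqn0 leqNgt -has_count; apply/hasPn => u /unders_inside.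
by rewrite -leNgt => /andP[/ltW].
Qed.

Lemma count_before1 i : count (fun u => u < 1) (unders D i) = size (unders D i).
Proof. by apply/eqP; rewrite -all_count; apply/allP => u /unders_inside/andP[]. Qed.

Lemma arc_color_first i : arc_color (first_arc D i) = c (inl i, 0).
Proof.
by rewrite arc_color_nth // [RHS]coloring_arc ?ler01 ?lexx // count_before0.
Qed.

Lemma arc_color_relation w : arc_relations w -> free_lift arc_color w = 1%g.
Proof.
move=> [i [j [k [t [jz pq ->]]]]]; set u := nth 0 _ j in pq *.
have uU : u \in unders D i by exact: mem_nth.
have /andP[u0 u1] := unders_inside uU.
have uE : u = arc_end i j by rewrite /u /arc_end; exact: set_nth_default.
rewrite gmulfM homV homJ /= !free_lift_gen.
rewrite !arc_color_nth // 1?ltnW // -uE.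
have uv : u < arc_end i j.+1.
  have [sj|js] := leqP (size (unders D i)) j.+1.
    by rewrite /arc_end nth_default.
  by rewrite uE /arc_end (lt_sorted_ltn_nth 1 (unders_sorted i)) ?inE //.
have /andP[_ v1] := arc_end_in01 i j.+1.
rewrite (hc (x := inl i) (ltW u0) uv v1) => [|v /andP[uv' vv]]; last first.
  apply: jump1 => /mem_unders vU.
  have kz := vU; rewrite -index_mem in kz; set l := index v _ in kz.
  have vE : v = nth 1 (unders D i) l by rewrite nth_index.
  move: uv'; rewrite uE vE /arc_end (lt_sorted_ltn_nth 1 (unders_sorted i)) ?inE // => jl.
  have := vv; rewrite vE /arc_end ltNge.
  by rewrite (lt_sorted_leq_nth 1 (unders_sorted i)) ?inE // ?jl // (leq_ltn_trans jl).
rewrite (jump_over c pq).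
have /dom01 tin := (over_dom pq).1.
by case: positive; rewrite ?homV /= free_lift_gen arc_color_at // mulVg.
Qed.

End Colors.

Section Wirtinger.
Variables (q : nat) (loopless : string_link D).
Let G := link_group D.
Let Q := nilquo q G.

Lemma meridian_relation i j k t : (j < size (unders D i))%N ->
  over ((inl k, t) : point D) (inl i, nth 0 (unders D i) j) ->
  meridian (arc_nth D i j.+1) = (meridian (arc_nth D i j) ^
    (if positive ((inl k, t) : point D) (inl i, nth 0%R (unders D i) j) then meridian (arc_at D k t)
     else (meridian (arc_at D k t))^-1))%g.
Proof.
move=> jz pq; set p := (inl k, t) in pq *; set r := (inl i, _) in pq *.
set a := free_gen (arc_nth D i j); set b := free_gen (arc_nth D i j.+1).
set o := free_gen (arc_at D k t).
have : to_quo (normal_closure (arc_relations (D := D)))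
    (b^-1 * (a ^ (if positive p r then o else o^-1)))%g = 1%g.
  apply/to_quoP; rewrite mulg1; apply: gen_inv; apply: gen_incl.
  exists (b^-1 * (a ^ (if positive p r then o else o^-1)))%g, 1%g.
  by rewrite conjg1; split => //; exists i, j, k, t.
rewrite gmulfM homV homJ => h; apply/esym/(mulgI (to_quo _ b)^-1%g).
rewrite mulVg -[RHS]h; congr (_ * (_ ^ _))%g.
by case: positive; rewrite ?homV.
Qed.

Definition wirtinger (p : point D) : Q :=
  match p.1 with inl i => to_quo _ (meridian (arc_at D i p.2)) | inr _ => 1%g end.

Lemma wirtinger_coloring : coloring wirtinger.
Proof.
have [S hS] := jump_supported D Q; have [S' hS'] := under_seq D.
case=> [i|l]; last by case: (loopless l).
apply: (@transport_steps _ _ _ _ (S ++ S')) => [u /hS|s t s0 st t1 noS].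
  by rewrite mem_cat => ->.
have no u : u \in unders D i -> s < u < t -> False.
  by move=> /mem_unders/hS' uS; apply: noS; rewrite mem_cat uS orbT.
rewrite /wirtinger /=; have [sU|sU] := boolP (s \in unders D i); last first.
  rewrite jump1; last by move=> /mem_unders; apply/negP.
  rewrite conjg1 /arc_at; congr (to_quo _ (meridian (Tagged _ (inord _)))).
  apply: eq_in_count => u uU /=; apply/idP/idP => [ut|/lt_trans -> //].
  rewrite lt_neqAle; apply/andP; split; first by apply: contraNneq sU => <-.
  by rewrite leNgt; apply/negP => su; apply: (no u) => //; rewrite su.
have [[[k|l] v] pq] := iffLR (mem_unders i s) sU; last by case: (loopless l).
have jz := sU; rewrite -index_mem in jz; set j := index s _ in jz.
have sE : s = nth 0 (unders D i) j by rewrite nth_index.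
have js : count (fun u => u < s) (unders D i) = j.
  by rewrite {1}sE (count_lt_nth 0 (unders_sorted i)).
have jt : count (fun u => u < t) (unders D i) = j.+1.
  rewrite -(count_le_nth 0 (unders_sorted i) jz) -sE.
  apply: eq_in_count => u uU /=; apply/idP/idP => [ut|/le_lt_trans -> //].
  by rewrite leNgt; apply/negP => su; apply: (no u) => //; rewrite su.
rewrite /arc_at js jt -![Tagged _ _]/(arc_nth D i _) (jump_over _ pq).
rewrite sE in pq; rewrite (meridian_relation jz pq) homJ; congr (_ ^ _)%g.
by rewrite sE; case: positive; rewrite ?homV.
Qed.

Lemma wirtinger_left i : wirtinger (inl i, 0) = to_quo _ (meridian (first_arc D i)).
Proof. by rewrite /wirtinger /= /arc_at count_before0. Qed.

Lemma wirtinger_right i : wirtinger (inl i, 1) = to_quo _ (meridian (last_arc D i)).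
Proof. by rewrite /wirtinger /= /arc_at count_before1. Qed.

End Wirtinger.

(** The colouring is a homomorphism from the link group, left inverse to psi_0.
    Its image under psi_0 is the Wirtinger colouring, since both have the same
    colours at the left ends; so the colours at the right ends describe the
    inverse of the Artin representation. *)
Lemma psi_eqP q (c : point D -> nilquo q.+1 (free_group 'I_m)) :
  string_link D -> coloring c -> (forall i, c (inl i, 0) = to_quo _ (free_gen i)) ->
  forall v w, psi1 D (to_quo _ v) = psi0 D w <-> free_lift (fun i => c (inl i, 1)) v = w
    :> nilquo q.+1 (free_group 'I_m).
Proof.
move=> loopless hc c0.
set F := free_group 'I_m; have hF := @nilquo_nilpotent q F.
have hG := @nilquo_nilpotent q (link_group D).
have [phi phiE] : exists phi : {multiplicative link_group D -> nilquo q.+1 F},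
    forall x, phi (to_quo _ x) = free_lift (arc_color c) x.
  apply: quo_hom; apply: hom_normal_closure => w; exact: arc_color_relation.
have phi_inv w : phi (free_lift (fun i => meridian (first_arc D i)) w) = to_quo _ w.
  move: w; apply: free_hom_ext => [x y|x y|i]; rewrite ?gmulfM //=.
  by rewrite free_lift_gen [LHS]phiE free_lift_gen (arc_color_first hc) c0.
have psi0_inj : injective (@psi0 _ _ D q.+1).
  move=> w w'; rewrite -(to_quoK w) -(to_quoK w') /psi0 !nilquo_mapE => /to_quoP h.
  have := hF _ (lower_central_map phi h); rewrite gmulfM homV !phi_inv.
  by move=> e; apply: (mulgI (to_quo _ (repr w))^-1%g); rewrite e mulVg.
have psi01 v : psi1 D (to_quo _ v) = psi0 D (free_lift (fun i => c (inl i, 1)) v).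
  rewrite /psi1 nilquo_mapE; move: v.
  apply: free_hom_ext => [x y|x y|i]; first by rewrite !gmulfM.
    by rewrite gmulfM /psi0 [LHS]nilquo_mapM.
  transitivity (wirtinger q.+1 (inl i, 1)).
    by rewrite wirtinger_right; congr to_quo; exact: free_lift_gen.
  transitivity (psi0 D (c (inl i, 1))); last by congr psi0; rewrite free_lift_gen.
  have hc' : coloring (fun p => psi0 D (c p)).
    exact: (coloring_hom (f := nilquo_map (free_lift (fun i => meridian (first_arc D i)))) hc).
  apply: (coloring_unique hG (wirtinger_coloring (q := q.+1) loopless) hc' _ (p := (inl i, 1))); last first.
    by rewrite ler01 lexx.
  case=> [j|l]; last by case: (loopless l).
  rewrite wirtinger_left c0 /psi0 nilquo_mapE; congr to_quo.
  by rewrite [RHS]free_lift_gen.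
by move=> v w; rewrite psi01; split=> [/psi0_inj|->].
Qed.

End LinkGroup.

(** By [psi_eqP], the preimages under psi_1 which define the Artin representation
    depend only on the colours at the right ends. *)
Lemma artin_of_colorings (R : realType) (m q : nat) (L L' : diagram R m)
    (c : point L -> nilquo q.+1 (free_group 'I_m))
    (c' : point L' -> nilquo q.+1 (free_group 'I_m)) :
  string_link L -> string_link L' -> coloring c -> coloring c' ->
  (forall i, c (inl i, 0) = to_quo _ (free_gen i)) ->
  (forall i, c' (inl i, 0) = to_quo _ (free_gen i)) ->
  (forall i, c (inl i, 1) = c' (inl i, 1)) -> artin L q = artin L' q.
Proof.
move=> hL hL' hc hc' c0 c0' cc'; apply/funext => x.
suff e : [set y | @psi1 _ _ L q.+1 y = @psi0 _ _ L q.+1 x] =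
    [set y | @psi1 _ _ L' q.+1 y = @psi0 _ _ L' q.+1 x].
  exact: (congr1 (fun S => xget 1%g S) e).
have cE : (fun i => c (inl i, 1)) = (fun i => c' (inl i, 1)) by apply/funext.
apply/seteqP; split=> y /=; rewrite -(to_quoK y).
  by move=> /(psi_eqP hL hc c0) h; apply/(psi_eqP hL' hc' c0'); rewrite -cE.
by move=> /(psi_eqP hL' hc' c0') h; apply/(psi_eqP hL hc c0); rewrite cE.
Qed.

(** * Signs of derivatives and zeros *)

Section RealCurves.
Variable R : realType.
Implicit Types f g : R -> R.

Lemma derive_pos_signs f t : derivable f t 1 -> f t = 0 -> 0 < derive1 f t ->
  exists2 d, 0 < d & forall h, 0 < h < d -> f (t - h) < 0 /\ 0 < f (t + h).
Proof.
move=> df ft; rewrite derive1E => fpos.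
have /cvgr_gt/(_ _ fpos) : h^-1 *: ((f \o shift t) (h *: (1 : R)) - f t) @[h --> 0^'] --> 'D_1 f t by [].
rewrite near_withinE => /nbhs_ballP[d /= d0 hd].
exists d => // h /andP[h0 hlt].
have ball_h (k : R) : `|k| < d -> ball (0 : R) d k by rewrite -ball_normE /= sub0r normrN.
split.
  have := hd (- h); rewrite ft /= subr0 /GRing.scale /= mulr1 addrC => /(_ (ball_h _ _)).
  rewrite normrN gtr0_norm // => /(_ hlt); rewrite oppr_eq0 gt_eqF // => /(_ isT).
  by rewrite invrN mulNr oppr_gt0 pmulr_rlt0 // invr_gt0.
have := hd h; rewrite ft /= subr0 /GRing.scale /= mulr1 addrC => /(_ (ball_h _ _)).
by rewrite gtr0_norm // => /(_ hlt); rewrite gt_eqF // => /(_ isT); rewrite pmulr_rgt0 // invr_gt0.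
Qed.

Lemma small_step (d l : R) : 0 < d -> 0 < l -> exists h, [/\ 0 < h, h < d & h < l].
Proof.
move=> d0 l0; exists (Num.min (d / 2) (l / 2)).
have [k1 k2] : 0 < l / 2 /\ l / 2 < l by split; lra.
have [k3 k4] : 0 < d / 2 /\ d / 2 < d by split; lra.
by rewrite lt_min k1 k3 !gt_min k2 k4 orbT.
Qed.

Lemma derive1_shift f (z : R) t : derivable f t 1 ->
  (derivable (fun u => f u - z) t 1 /\ derive1 (fun u => f u - z) t = derive1 f t) /\
  (derivable (fun u => z - f u) t 1 /\ derive1 (fun u => z - f u) t = - derive1 f t).
Proof.
move=> df; rewrite !derive1E; have dz : derivable (cst z : R -> R) t 1 by exact: derivable_cst.
split; split; first exact: (derivableB df dz).
- by rewrite (deriveB df dz) derive_cst subr0.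
- exact: (derivableB dz df).
- by rewrite (deriveB dz df) derive_cst sub0r.
Qed.

Lemma derive1_eq0 f lo hi t : lo < hi -> lo <= t <= hi -> derivable f t 1 ->
  (forall u, lo <= u <= hi -> f u = 0) -> derive1 f t = 0.
Proof.
move=> lohi /andP[lot thi] df f0.
have key g : derivable g t 1 -> (forall u, lo <= u <= hi -> g u = 0) -> ~ 0 < derive1 g t.
  move=> dg g0 /(derive_pos_signs dg) []; first by rewrite g0 // lot.
  move=> d d0 hd; have [th|ht] := ltP t hi.
    pose h := Num.min (d / 2) (hi - t).
    have h0 : 0 < h by rewrite lt_min divr_gt0 // subr_gt0.
    have hd' : h < d by rewrite gt_min; apply/orP; left; lra.
    have hh : h <= hi - t by rewrite ge_min lexx orbT.
    have [|_] := hd h; first by rewrite h0.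
    by rewrite g0 ?ltxx //; apply/andP; split; lra.
  pose h := Num.min (d / 2) (t - lo).
  have tlo : lo < t by lra.
  have h0 : 0 < h by rewrite lt_min divr_gt0 // subr_gt0.
  have hd' : h < d by rewrite gt_min; apply/orP; left; lra.
  have hh : h <= t - lo by rewrite ge_min lexx orbT.
  have [|+ _] := hd h; first by rewrite h0.
  by rewrite g0 ?ltxx //; apply/andP; split; lra.
apply/eqP; rewrite eq_le !leNgt; apply/andP; split; apply/negP; first exact: key.
have dNf : derivable (- f) t 1 by exact: derivableN.
move=> fneg; apply: (key (- f)) => //.
  by move=> u /f0 h; apply/eqP; rewrite oppr_eq0 h.
by rewrite derive1E deriveN // -derive1E oppr_gt0.
Qed.

(** [t] may be an end of the interval: both functions are differentiable around
    [t], but they may be known to agree on one side only. *)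
Lemma derive1_local f g lo hi t : lo < hi -> lo <= t <= hi ->
  derivable f t 1 -> derivable g t 1 ->
  (forall u, lo <= u <= hi -> f u = g u) -> derive1 f t = derive1 g t.
Proof.
move=> lohi ht df dg fg; apply/eqP; rewrite -subr_eq0; apply/eqP.
rewrite !derive1E -deriveB // -derive1E; apply: (derive1_eq0 lohi ht).
  exact: derivableB.
by move=> u hu; apply/eqP; rewrite subr_eq0 fg.
Qed.

Lemma sgr_no_zero f a b : a <= b -> {within `[a, b], continuous f} ->
  (forall u, a <= u <= b -> f u != 0) -> Num.sg (f a) = Num.sg (f b).
Proof.
move=> ab fc f0.
have fa : f a != 0 by rewrite f0 // lexx.
have fb : f b != 0 by rewrite f0 // lexx ab.
apply/eqP; rewrite -[_ == _]negbK; apply/negP => ne.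
have [c cab c0] : exists2 c, c \in `[a, b]%R & f c = 0.
  apply: IVT => //; rewrite ge_min le_max.
  move: ne; have [fa0|fa0|/eqP] := ltgtP (f a) 0; last by rewrite (negbTE fa).
    by have [fb0|fb0|/eqP] := ltgtP (f b) 0; rewrite ?(negbTE fb) ?(ltr0_sg fa0) ?(ltr0_sg fb0) ?eqxx ?orbT.
  by have [fb0|fb0|/eqP] := ltgtP (f b) 0; rewrite ?(negbTE fb) ?(gtr0_sg fa0) ?(gtr0_sg fb0) ?eqxx ?orbT.
by move: (f0 c); rewrite c0 eqxx; move: cab; rewrite in_itv /= => -> /(_ isT).
Qed.

Lemma sgr_after_zero f a b : (forall u, a <= u <= b -> derivable f u 1) -> a < b ->
  f a = 0 -> derive1 f a != 0 -> (forall u, a < u <= b -> f u != 0) ->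
  Num.sg (f b) = Num.sg (derive1 f a).
Proof.
move=> df ab.
suff key g : (forall u, a <= u <= b -> derivable g u 1) -> g a = 0 ->
    0 < derive1 g a -> (forall u, a < u <= b -> g u != 0) -> 0 < g b.
  move=> fa; rewrite neq_lt => /orP[f'|f'] f0; last first.
    by rewrite (gtr0_sg f') gtr0_sg //; exact: key.
  have := key (- f); rewrite derive1E deriveN; last by apply: df; rewrite lexx ltW.
  rewrite -derive1E oppr_gt0 f' => h; rewrite (ltr0_sg f') ltr0_sg //.
  rewrite -oppr_gt0; apply: h => //.
  - by move=> u /df; exact: derivableN.
  - by apply/eqP; rewrite oppr_eq0 fa.
  - by move=> u /f0; rewrite oppr_eq0.
move=> dg ga g' g0.
have [|d d0 hd] := derive_pos_signs _ ga g'; first by apply: dg; rewrite lexx ltW.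
pose h := Num.min (d / 2) (b - a).
have h0 : 0 < h by rewrite lt_min divr_gt0 // subr_gt0.
have hd' : h < d by rewrite gt_min; apply/orP; left; lra.
have hh : h <= b - a by rewrite ge_min lexx orbT.
have [|_ gh] := hd h; first by rewrite h0.
have : Num.sg (g (a + h)) = Num.sg (g b).
  apply: sgr_no_zero; [lra| |by move=> u /andP[u1 u2]; apply: g0; apply/andP; split; lra].
  apply: derivable_within_continuous => u; rewrite in_itv /= => /andP[u1 u2].
  by apply: dg; apply/andP; split; lra.
rewrite (gtr0_sg gh) => /esym e; rewrite lt_neqAle eq_sym g0 ?ab ?lexx //=.
by rewrite leNgt; apply/negP => /ltr0_sg; rewrite e => ?; lra.
Qed.

Lemma sgr_before_zero f a b : (forall u, a <= u <= b -> derivable f u 1) -> a < b ->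
  f b = 0 -> derive1 f b != 0 -> (forall u, a <= u < b -> f u != 0) ->
  Num.sg (f a) = - Num.sg (derive1 f b).
Proof.
move=> df ab.
suff key g : (forall u, a <= u <= b -> derivable g u 1) -> g b = 0 ->
    0 < derive1 g b -> (forall u, a <= u < b -> g u != 0) -> g a < 0.
  move=> fb; rewrite neq_lt => /orP[f'|f'] f0; last first.
    by rewrite (gtr0_sg f') ltr0_sg //; exact: key.
  have := key (- f); rewrite derive1E deriveN; last by apply: df; rewrite lexx ltW.
  rewrite -derive1E oppr_gt0 f' => h; rewrite (ltr0_sg f') gtr0_sg ?opprK //.
  rewrite -oppr_lt0; apply: h => //.
  - by move=> u /df; exact: derivableN.
  - by apply/eqP; rewrite oppr_eq0 fb.
  - by move=> u /f0; rewrite oppr_eq0.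
move=> dg gb g' g0.
have [|d d0 hd] := derive_pos_signs _ gb g'; first by apply: dg; rewrite lexx ltW.
pose h := Num.min (d / 2) (b - a).
have h0 : 0 < h by rewrite lt_min divr_gt0 // subr_gt0.
have hd' : h < d by rewrite gt_min; apply/orP; left; lra.
have hh : h <= b - a by rewrite ge_min lexx orbT.
have [|gh _] := hd h; first by rewrite h0.
have : Num.sg (g a) = Num.sg (g (b - h)).
  apply: sgr_no_zero; [lra| |by move=> u /andP[u1 u2]; apply: g0; apply/andP; split; lra].
  apply: derivable_within_continuous => u; rewrite in_itv /= => /andP[u1 u2].
  by apply: dg; apply/andP; split; lra.
rewrite (ltr0_sg gh) => e; rewrite lt_neqAle g0 ?ab ?lexx //=.
by rewrite leNgt; apply/negP => /gtr0_sg; rewrite e => ?; lra.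
Qed.

(** The sign of [f] between its two zeros determines both derivatives. *)
Lemma consecutive_zeros f t1 t2 : (forall u, derivable f u 1) -> t1 < t2 ->
  f t1 = 0 -> f t2 = 0 -> derive1 f t1 != 0 -> derive1 f t2 != 0 ->
  (forall u, t1 < u < t2 -> f u != 0) -> (0 < derive1 f t1) = ~~ (0 < derive1 f t2).
Proof.
move=> df t12 z1 z2 d1 d2 nz; pose mid := (t1 + t2) / 2.
have [m1 m2] : t1 < mid /\ mid < t2 by rewrite /mid; split; lra.
have e1 : Num.sg (f mid) = Num.sg (derive1 f t1).
  apply: sgr_after_zero => // u /andP[h1 h2]; apply: nz.
  by rewrite h1 (le_lt_trans h2).
have e2 : Num.sg (f mid) = - Num.sg (derive1 f t2).
  apply: sgr_before_zero => // u /andP[h1 h2]; apply: nz.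
  by rewrite h2 andbT (lt_le_trans m1).
rewrite -(sgr_gt0 (derive1 f t1)) -e1 e2.
have [h|h|h] := ltgtP (derive1 f t2) 0.
- by rewrite (ltr0_sg h) opprK ltr01.
- by rewrite (gtr0_sg h) oppr_gt0 ltr10.
- by rewrite h eqxx in d2.
Qed.

End RealCurves.

(** * Curves in the plane *)

Section PlaneLemmas.
Variable R : realType.
Implicit Types (v w p c : plane R) (f : R^o -> plane R).

Lemma plane_ext v w : v 0 0 = w 0 0 -> v 0 1 = w 0 1 -> v = w.
Proof.
move=> h0 h1; apply/rowP => j; case: j => -[|[|//]] hj.
  by have -> : Ordinal hj = 0 by apply/val_inj.
by have -> : Ordinal hj = 1 by apply/val_inj.
Qed.

Lemma det2_eq0P v w : v <> 0 -> det2 v w = 0 -> exists l : R, w = l *: v.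
Proof.
move=> v0; rewrite /det2 => /eqP; rewrite subr_eq0 => /eqP d.
have [e0|n0] := eqVneq (v 0 0) 0.
  have n1 : v 0 1 != 0.
    apply/eqP => e1; apply: v0; apply: plane_ext; rewrite mxE //.
  exists (w 0 1 / v 0 1); apply: plane_ext; rewrite !mxE ?e0 ?mulr0; last by rewrite divfK.
  by apply: (mulfI n1); rewrite mulr0 -d e0 mul0r.
exists (w 0 0 / v 0 0); apply: plane_ext; rewrite !mxE; first by rewrite divfK.
by apply: (mulfI n0); rewrite d; field.
Qed.

Lemma derive1_coord f t j : differentiable f t ->
  derivable (fun u => f u 0 j : R^o) t 1 /\
  derive1 (fun u => f u 0 j) t = derive1 f t 0 j.
Proof.
move=> fd; have df : derivable f t 1 by exact: diff_derivable.
have /derivable_mxP dj := df.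
by split; rewrite ?derive1E; [exact: dj|rewrite derive_mx // mxE].
Qed.

End PlaneLemmas.

Section CurveLemmas.
Variables (R : realType) (m : nat) (D : diagram R m).
Implicit Types (x y : curve D) (v c : plane R) (t : R).

Lemma curve_coord x t j : derivable (fun u => curve_path x u 0 j : R^o) t 1 /\
  derive1 (fun u => curve_path x u 0 j) t = velocity ((x, t) : point D) 0 j.
Proof.
apply: derive1_coord; have := diag_smooth (diagP D) x 1%N => /= -[h _]; exact: h.
Qed.

Lemma velocity_neq0 x t : 0 <= t <= 1 -> velocity ((x, t) : point D) <> 0.
Proof.
case: x => [i|l] h; first exact: (diag_immersed_string (diagP D)).
exact: (diag_immersed_loop (diagP D)).
Qed.

(** Up to a positive factor, the signed height of the curve above the line through
    [c] directed by [v]. *)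
Definition height v c x t : R := det2 v (curve_path x t - c).

Lemma height_derive v c x t : derivable (height v c x : R^o -> R^o) t 1 /\
  derive1 (height v c x) t = det2 v (velocity ((x, t) : point D)).
Proof.
have [d0 e0] := curve_coord x t 0; have [d1 e1] := curve_coord x t 1.
have hE : height v c x = (fun u => v 0 0 * (curve_path x u 0 1 - c 0 1)
    - v 0 1 * (curve_path x u 0 0 - c 0 0)).
  by apply/funext => u; rewrite /height /det2 !mxE.
rewrite hE /det2 -e0 -e1 !derive1E.
have i0 : is_derive t (1 : R^o) (fun u => curve_path x u 0 0 : R^o) ('D_1 (fun u => curve_path x u 0 0) t) := DeriveDef d0 erefl.
have i1 : is_derive t (1 : R^o) (fun u => curve_path x u 0 1 : R^o) ('D_1 (fun u => curve_path x u 0 1) t) := DeriveDef d1 erefl.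
split; first by apply: ex_derive.
rewrite derive_val; rewrite /GRing.scale /=; ring.
Qed.

End CurveLemmas.

Section Velocity.
Variables (R : realType) (m : nat) (D D' : diagram R m).

Lemma velocity_local (x : curve D) (x' : curve D') lo hi t : lo < hi -> lo <= t <= hi ->
  (forall u, lo <= u <= hi -> curve_path x u = curve_path x' u) ->
  velocity ((x, t) : point D) = velocity ((x', t) : point D').
Proof.
move=> lohi ht e.
have key j : velocity ((x, t) : point D) 0 j = velocity ((x', t) : point D') 0 j.
  have [d1 <-] := curve_coord x t j; have [d2 <-] := curve_coord x' t j.
  by apply: (derive1_local lohi ht d1 d2) => u /e ->.
exact: plane_ext.
Qed.

Variable s : loop D -> loop D'.

Lemma replace_arc_velocity x a b p : replace_arc s x a b -> dom p ->
  ~ open_arc x a b p -> velocity (point_map s p) = velocity p.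
Proof.
case=> _ [/andP[a0 ab] b1] same_at _; case: p => y t dp off.
have [t0 t1] := andP (dom01 dp); rewrite /= in t0 t1.
suff [lo [hi [lohi tI hI]]] : exists lo hi, [/\ lo < hi, lo <= t <= hi &
    forall u, lo <= u <= hi -> dom ((y, u) : point D) /\ ~ open_arc x a b (y, u)].
  apply/esym/(velocity_local lohi tI) => u /hI[du offu].
  by apply/esym; exact: (same_at (y, u) du offu).
have domI u : 0 <= u < 1 -> dom ((y, u) : point D).
  by rewrite /dom; case: (y) => // ? /andP[-> /ltW ->].
have [ta|ta] := ltP t a.
  exists t, a; split=> [//||u /andP[tu ua]]; first by rewrite lexx ltW.
  split; first by apply: domI; apply/andP; split; lra.
  by move=> [_ /= /andP[au _]]; move: au; rewrite ltNge ua.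
have [ta'|ta'] := eqVneq t a.
  exists 0, a; split=> [//||u /andP[u0 ua]]; first by rewrite t0 ta' lexx.
  split; first by apply: domI; apply/andP; split; lra.
  by move=> [_ /= /andP[au _]]; move: au; rewrite ltNge ua.
have [tb|tb] := ltP t b.
  exists t, b; split=> [//||u /andP[tu ub]]; first by rewrite lexx ltW.
  split; first by apply: domI; apply/andP; split; lra.
  by move=> [/= yx _]; apply: off; split => //=; rewrite tb lt_neqAle eq_sym ta' ta.
have [t1'|t1'] := ltP t 1.
  exists t, ((t + 1) / 2); split=> [||u /andP[tu ut]]; [lra|by apply/andP; split; lra|].
  split; first by apply: domI; apply/andP; split; lra.
  by move=> [_ /= /andP[_ ub]]; move: ub; rewrite ltNge (le_trans tb tu).
have tE : t = 1 by apply/eqP; rewrite eq_le t1 t1'.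
exists b, t; split=> [||u /andP[bu ut]]; [lra|by rewrite tb lexx|].
split; last by move=> [_ /= /andP[_ ub]]; move: ub; rewrite ltNge bu.
move: dp; rewrite /dom; case: (y) => [i|l] /=; last by rewrite tE ltxx andbF.
by move=> _; apply/andP; split; lra.
Qed.

End Velocity.

(** * Moves inside a disc *)

Section Transports.
Variables (R : realType) (m : nat) (D : diagram R m) (N : groupType).
Implicit Types (g c F : point D -> N).

Definition transports g c : Prop :=
  forall y, transport (fun t => g (y, t)) 0 1 (fun t => c (y, t)).

Definition arcs (l : seq (curve D * R * R)) : set (point D) :=
  [set p | exists x a b, (x, a, b) \in l /\ open_arc x a b p].

(** The arcs are treated one after the other; this is possible because the ends of
    each of them lie on none of the others. *)
Lemma transports_patch l g c g' c' :
  transports g c ->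
  (forall p, ~ arcs l p -> g' p = g p) -> (forall p, ~ arcs l p -> c' p = c p) ->
  (forall x a b, (x, a, b) \in l -> [/\ 0 <= a, a <= b, b <= 1,
     ~ arcs l (x, a) /\ ~ arcs l (x, b)
     & transport (fun t => g' (x, t)) a b (fun t => c' (x, t))]) ->
  transports g' c'.
Proof.
move=> tr; elim: l g' c' => [|[[x a] b] l IH] g' c' gg cc hl.
  have noarc p : ~ arcs [::] p by move=> [? [? [? []]]].
  by move=> y; apply: transport_eq (tr y) => u _; rewrite ?gg ?cc //; exact: noarc.
have sub p : arcs l p -> arcs ((x, a, b) :: l) p.
  by move=> [y [a1 [b1 [h1 h2]]]]; exists y, a1, b1; rewrite inE h1 orbT.
pose g1 p := if `[< arcs l p >] then g' p else g p.
pose c1 p := if `[< arcs l p >] then c' p else c p.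
have g1off p : ~ open_arc x a b p -> g' p = g1 p.
  move=> off; rewrite /g1; case: asboolP => // offl; apply: gg.
  move=> [y [a1 [b1 [+ hp]]]]; rewrite inE => /orP[/eqP[yx aa bb]|h].
    by apply: off; rewrite -yx -aa -bb.
  by apply: offl; exists y, a1, b1.
have c1off p : ~ open_arc x a b p -> c' p = c1 p.
  move=> off; rewrite /c1; case: asboolP => // offl; apply: cc.
  move=> [y [a1 [b1 [+ hp]]]]; rewrite inE => /orP[/eqP[yx aa bb]|h].
    by apply: off; rewrite -yx -aa -bb.
  by apply: offl; exists y, a1, b1.
have tr1 : transports g1 c1.
  apply: IH => [p /asboolF h|p /asboolF h|y a1 b1 h]; rewrite /g1 /c1 ?h //.
  have [h0 h1 h2 [h3 h4] h5] := hl y a1 b1 (mem_behead (s := _ :: _) h).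
  split => //; first by split=> /sub.
  have inside u : a1 < u < b1 -> arcs l (y, u) by exists y, a1, b1.
  apply: transport_eq h5 => u /andP[].
    rewrite le_eqVlt => /orP[/eqP <- _|au ub].
      by rewrite asboolF ?gg // => /sub.
    by rewrite asboolT //; apply: inside; rewrite au.
  rewrite le_eqVlt => /orP[/eqP <- _|au].
    by rewrite asboolF ?cc // => /sub.
  rewrite le_eqVlt => /orP[/eqP ->|ub].
    by rewrite asboolF ?cc // => /sub.
  by rewrite asboolT //; apply: inside; rewrite au.
have [h0 h1 h2 _ h5] := hl x a b (mem_head _ _).
move=> y; have [yx|yx] := pselect (y = x); last first.
  by apply: transport_eq (tr1 y) => u _; rewrite ?g1off ?c1off // => -[].
rewrite yx; apply: (transport_patch h0 h1 h2 _ _ h5 (tr1 x)) => u hu.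
  by apply: g1off => -[].
by apply: c1off => -[].
Qed.

Lemma flat_arc g c x a b z :
  (forall u, a < u < b -> g (x, u) = 1%g) -> (forall u, a < u <= b -> c (x, u) = z) ->
  z = (c (x, a) ^ g (x, a))%g ->
  transport (fun t => g (x, t)) a b (fun t => c (x, t)).
Proof.
move=> g1 cz zE s t; rewrite le_eqVlt => /orP[/eqP <- at_ tb _|as_ st tb _].
  by rewrite cz ?zE // at_ tb.
have sb := lt_le_trans st tb.
by rewrite g1 ?as_ // conjg1 !cz ?as_ ?(lt_trans as_ st) ?tb ?ltW.
Qed.

Lemma coloring_step c x s t : coloring c -> 0 <= s -> s < t -> t <= 1 ->
  (forall u, s < u < t -> ~ under ((x, u) : point D)) ->
  c (x, t) = (c (x, s) ^ jump c (x, s))%g.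
Proof. by move=> hc h0 h1 h2 no; apply: hc => // u /no h; exact: jump1. Qed.

End Transports.

Section LocalReplacement.
Variables (R : realType) (m : nat) (D D' : diagram R m) (s : loop D -> loop D').
Hypothesis s_same : same_loops s.
Let mu := point_map s.

Lemma curve_map_bij : bijective (curve_map s).
Proof.
have [[s' sK s'K] _] := s_same.
by exists (fun x => match x with inl i => inl i | inr l => inr (s' l) end);
  case=> [i|l] //=; rewrite ?sK ?s'K.
Qed.

Lemma point_map_bij : bijective mu.
Proof.
have [f fK Kf] := curve_map_bij.
by exists (fun p => (f p.1, p.2)) => -[x t]; rewrite /mu /point_map /= ?fK ?Kf.
Qed.

Lemma dom_point_map p : dom (mu p) <-> dom p.
Proof. by case: p => -[i|l] t. Qed.

Lemma open_arc_map x a b p : open_arc (curve_map s x) a b (mu p) <-> open_arc x a b p.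
Proof.
have inj := bij_inj curve_map_bij.
by split=> -[/= h1 h2]; split => //=; [exact: inj|rewrite h1].
Qed.

Variable A : set (point D).
Hypothesis same_velocity : forall p, dom p -> ~ A p -> velocity (mu p) = velocity p.
Hypothesis same_over : forall p q, dom p -> dom q -> ~ A p -> ~ A q ->
  over (mu p) (mu q) <-> over p q.
Hypothesis over_off : forall p q, over q p -> ~ A p -> ~ A q.
Hypothesis over_off' : forall p q, over (mu q) (mu p) -> ~ A p -> ~ A q.

Lemma under_off_cases p : ~ A p -> ~ under p /\ ~ under (mu p) \/
  exists q, [/\ over q p, over (mu q) (mu p), positive (mu q) (mu p) = positive q p & ~ A q].
Proof.
move=> Ap.
have up q : over q p -> exists q, [/\ over q p, over (mu q) (mu p),
    positive (mu q) (mu p) = positive q p & ~ A q].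
  move=> qp; have [dq dp] := over_dom qp; have Aq := over_off qp Ap.
  exists q; split; [exact: qp|exact/(same_over dq dp Aq Ap)| |exact: Aq].
  by rewrite /positive !same_velocity.
have [[q /up]|np] := pselect (under p); first by right.
left; split => // -[q' qp]; have [mu' mu'K muK'] := point_map_bij.
rewrite -(muK' q') in qp; have [/dom_point_map dq /dom_point_map dp] := over_dom qp.
apply: np; exists (mu' q'); apply/same_over => //; exact: over_off' Ap.
Qed.

Variables (N : groupType) (c : point D -> N).
Hypothesis hc : coloring c.
Variables (F G : point D -> N) (l : seq (curve D * R * R)).
Hypothesis A_arcs : A = arcs l.
Hypothesis F_off : forall p, ~ A p -> F p = c p.
Hypothesis G_off : forall p, ~ A p -> G p = jump c p.
Hypothesis G_jump : forall (c' : point D' -> N) p, (forall q, c' (mu q) = F q) -> A p ->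
  jump c' (mu p) = G p.
Hypothesis F_arcs : forall x a b, (x, a, b) \in l -> [/\ 0 < a < b, b < 1,
     ~ A (x, a), ~ A (x, b)
     & transport (fun t => G (x, t)) a b (fun t => F (x, t))].

(** Off the arcs both diagrams have the same undercrossings, so it is enough that
    the new colours along the arcs fit at the ends of these. *)
Lemma local_coloring : exists2 c' : point D' -> N, coloring c' & forall x,
  c' (curve_map s x, 0) = c (x, 0) /\ c' (curve_map s x, 1) = c (x, 1).
Proof.
have [mu' mu'K muK'] := point_map_bij.
pose c' p := F (mu' p); have c'E q : c' (mu q) = F q by rewrite /c' mu'K.
have end_off x t : t = 0 \/ t = 1 -> ~ A (x, t).
  move=> t01; rewrite A_arcs => -[y [a [b [/F_arcs[/andP[a0 _] b1 _ _ _] [_ /= /andP[h1 h2]]]]]].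
  by case: t01 => tE; subst t; lra.
exists c'; last first.
  by move=> x; split; rewrite -[(curve_map s x, _)]/(mu (x, _)) c'E F_off //; apply: end_off; [left|right].
have trF : transports G F.
  apply: (transports_patch (l := l) hc); rewrite -?A_arcs // => x a b /F_arcs.
  move=> [/andP[a0 ab] b1 h1 h2 h3].
  by split => //; rewrite ?(ltW a0) ?(ltW ab) ?(ltW b1).
have [f fK Kf] := curve_map_bij.
move=> x'; rewrite -(Kf x'); apply: transport_eq (trF (f x')) => u _; last by rewrite -c'E.
have [Ap|Ap] := pselect (A (f x', u)); first by rewrite -(G_jump c'E Ap).
rewrite (G_off Ap) -[(curve_map s _, u)]/(mu (f x', u)).
have [[n1 n2]|[q [qp mqp pos Aq]]] := under_off_cases Ap; first by rewrite !jump1.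
by rewrite (jump_over _ qp) (jump_over _ mqp) pos c'E F_off.
Qed.

End LocalReplacement.

Section Chords.
Variables (R : realType) (m : nat) (D : diagram R m).
Implicit Types (x y : curve D) (c v : plane R).

Lemma open_arc_dom x a b p : 0 < a -> b < 1 -> open_arc x a b p -> dom p.
Proof.
case: p => y t a0 b1 [/= _ /andP[h1 h2]]; rewrite /dom /=.
by case: (y) => _; apply/andP; split; lra.
Qed.

Lemma arc_ends_off x a b y a' b' : a < b -> a' < b' ->
  open_arc x a b `&` open_arc y a' b' = set0 ->
  ~ open_arc y a' b' (x, a) /\ ~ open_arc y a' b' (x, b).
Proof.
move=> ab ab' disj.
have no u : a < u < b -> a' < u < b' -> x = y -> False.
  move=> h h' xy; suff : (open_arc x a b `&` open_arc y a' b') (x, u) by rewrite disj.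
  by split; split.
split=> -[/= xy /andP[h1 h2]].
  apply: (no ((a + Num.min b b') / 2)) => //.
    have : Num.min b b' <= b by rewrite ge_min lexx.
    have : a < Num.min b b' by rewrite lt_min ab.
    by move=> ? ?; apply/andP; split; lra.
  have : Num.min b b' <= b' by rewrite ge_min lexx orbT.
  have : a < Num.min b b' by rewrite lt_min ab.
  by move=> ? ?; apply/andP; split; lra.
apply: (no ((b + Num.max a a') / 2)) => //.
  have : a <= Num.max a a' by rewrite le_max lexx.
  have : Num.max a a' < b by rewrite gt_max ab.
  by move=> ? ?; apply/andP; split; lra.
have : a' <= Num.max a a' by rewrite le_max lexx orbT.
have : Num.max a a' < b by rewrite gt_max ab.
by move=> ? ?; apply/andP; split; lra.
Qed.

Lemma disc_crossing c r (A : set (point D)) p q :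
  disc_meets c r A -> crossing p q -> A p -> A q.
Proof. by move=> [_ hA] [dp dq _ e] /(hA p dp) h; apply/(hA q dq); rewrite -e. Qed.

Definition chord y a b c v : Prop := [/\ 0 < a < b, b < 1 &
  forall t, a <= t <= b -> at_ ((y, t) : point D) = c + (t - (a + b) / 2) *: v].

Variables (y : curve D) (a b : R) (c v : plane R).
Hypothesis hy : chord y a b c v.

Lemma chord_velocity t : a <= t <= b -> velocity ((y, t) : point D) = v.
Proof.
have [/andP[a0 ab] b1 e] := hy; move=> ht.
have key j : velocity ((y, t) : point D) 0 j = v 0 j.
  have [d1 <-] := curve_coord y t j.
  pose g u : R^o := c 0 j + (u - (a + b) / 2) * v 0 j.
  have ig (u : R) : is_derive u (1 : R^o) g (v 0 j).
    by apply: is_derive_eq; rewrite /GRing.scale /=; ring.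
  have [d2 <-] := ig t; rewrite -derive1E.
  apply: (derive1_local ab ht d1 d2) => u /e; rewrite /at_ /= => ->.
  by rewrite !mxE.
exact: plane_ext.
Qed.

Lemma chord_neq0 : v <> 0.
Proof.
have [/andP[a0 ab] b1 e] := hy.
rewrite -(@chord_velocity a); last by rewrite lexx ltW.
by apply: velocity_neq0; apply/andP; split; lra.
Qed.

Lemma chord_inj t u : a <= t <= b -> a <= u <= b ->
  at_ ((y, t) : point D) = at_ ((y, u) : point D) -> t = u.
Proof.
have [_ _ e] := hy => ht hu; rewrite !e // => /addrI /eqP.
rewrite -subr_eq0 -scalerBl scaler_eq0 => /orP[/eqP h|/eqP /chord_neq0 //].
by move: h; lra.
Qed.

Lemma chord_height t : a <= t <= b -> height v c y t = 0.
Proof.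
have [_ _ e] := hy => /e; rewrite /height /at_ /= => ->.
by rewrite addrC addKr /det2 !mxE; ring.
Qed.

(** As its end lies outside the disc, the chord is at least as long as a
    diameter. *)
Lemma chord_cover r p : ~ disc c r (at_ ((y, b) : point D)) -> disc c r p ->
  det2 v (p - c) = 0 -> exists2 u, a < u < b & p = at_ ((y, u) : point D).
Proof.
have [/andP[a0 ab] b1 e] := hy.
move=> out inn /(det2_eq0P chord_neq0)[l pl].
have pE : p = c + l *: v by rewrite -pl addrC subrK.
have lb : `|l| < (b - a) / 2.
  rewrite ltNge; apply/negP => hl; apply: out; rewrite e ?lexx ?andbT ?ltW //.
  move: inn; rewrite pE /disc /= !mxE.
  have -> : b - (a + b) / 2 = (b - a) / 2 by lra.
  move=> inn; apply: le_lt_trans inn.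
  have -> : c 0 0 + (b - a) / 2 * v 0 0 - c 0 0 = (b - a) / 2 * v 0 0 by ring.
  have -> : c 0 1 + (b - a) / 2 * v 0 1 - c 0 1 = (b - a) / 2 * v 0 1 by ring.
  have -> : c 0 0 + l * v 0 0 - c 0 0 = l * v 0 0 by ring.
  have -> : c 0 1 + l * v 0 1 - c 0 1 = l * v 0 1 by ring.
  move: hl; set k := (b - a) / 2 => hl; have k0 : 0 <= k by rewrite /k; lra.
  move: (k) k0 hl => {}k k0 hl.
  rewrite !exprMn -!mulrDr; apply: ler_wpM2r; first by rewrite addr_ge0 ?sqr_ge0.
  by rewrite -(real_normK (num_real l)) ler_sqr ?nnegrE //; lra.
exists ((a + b) / 2 + l).
  by move: lb; rewrite ltr_norml => /andP[h1 h2]; apply/andP; split; lra.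
rewrite e; last by move: lb; rewrite ltr_norml => /andP[h1 h2]; apply/andP; split; lra.
by rewrite pE; congr (_ + _ *: _); lra.
Qed.

End Chords.

(** * The first Reidemeister move and the detour move *)

Section DiscMoves.
Variables (R : realType) (m : nat) (D D' : diagram R m) (s : loop D -> loop D').
Let mu := point_map s.

(** The colours at both ends of each curve are kept, hence also the failure of the
    loops to close up. *)
Definition transfers : Prop := forall (N : groupType) (c : point D -> N), coloring c ->
  exists2 c' : point D' -> N, coloring c' & forall x,
    c' (curve_map s x, 0) = c (x, 0) /\ c' (curve_map s x, 1) = c (x, 1).

Lemma arcs1 x a b : arcs [:: (x, a, b)] = open_arc x a b :> set (point D).
Proof.
apply/seteqP; split=> p; first by move=> [y [a1 [b1 [+ h]]]]; rewrite inE => /eqP[<- <- <-].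
by exists x, a, b; rewrite mem_head.
Qed.

Lemma arcs_cons x a b l : arcs ((x, a, b) :: l) = open_arc x a b `|` arcs l :> set (point D).
Proof.
apply/seteqP; split=> p.
  move=> [y [a1 [b1 [+ h]]]]; rewrite inE => /orP[/eqP[<- <- <-]|hl]; first by left.
  by right; exists y, a1, b1.
move=> [h|[y [a1 [b1 [hl h]]]]]; first by exists x, a, b; rewrite mem_head.
by exists y, a1, b1; rewrite inE hl orbT.
Qed.

(** Since the arcs are all that the disc contains, no crossing has one of its
    points on the arcs and the other one off them. *)
Lemma disc_coloring x a b l c0 r (A' : set (point D')) (N : groupType)
    (c F G : point D -> N) :
  replace_arc s x a b -> (x, a, b) \in l ->
  disc_meets c0 r (arcs l) -> disc_meets c0 r A' ->
  (forall p, A' (mu p) <-> arcs l p) -> coloring c ->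
  (forall p, ~ arcs l p -> F p = c p) -> (forall p, ~ arcs l p -> G p = jump c p) ->
  (forall (c' : point D' -> N) p, (forall q, c' (mu q) = F q) -> arcs l p ->
     jump c' (mu p) = G p) ->
  (forall x a b, (x, a, b) \in l -> [/\ 0 < a < b, b < 1,
     ~ arcs l (x, a), ~ arcs l (x, b)
     & transport (fun t => G (x, t)) a b (fun t => F (x, t))]) ->
  exists2 c' : point D' -> N, coloring c' & forall x,
    c' (curve_map s x, 0) = c (x, 0) /\ c' (curve_map s x, 1) = c (x, 1).
Proof.
move=> ra xl dA dA' AA hc F1 G1 G2 F2.
have off p : ~ arcs l p -> ~ open_arc x a b p.
  by move=> h h'; apply: h; exists x, a, b.
have [ss _ _ so] := ra.
apply: (local_coloring ss (A := arcs l) _ _ _ _ hc _ F1 G1 G2 F2) => //.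
- by move=> p dp /off; exact: replace_arc_velocity ra dp.
- by move=> p q dp dq /off hp /off hq; exact: so.
- move=> p q /over_crossing qp Ap Aq; apply: Ap; exact: disc_crossing dA qp Aq.
- move=> p q /over_crossing qp Ap /AA Aq; apply: Ap; apply/AA.
  exact: disc_crossing dA' qp Aq.
Qed.

(** The kink only conjugates the colour of the arc by the same colour or its
    inverse. *)
Lemma reidemeister1_transfers : reidemeister1 s -> same_loops s /\ transfers.
Proof.
move=> [x [a [b [c0 [r [t1 [t2 [ra [dA dA'] [at1 at2] [cr ov] cf]]]]]]]].
have [ss [ab b1] _ _] := ra; split => // N c hc.
pose A := open_arc x a b.
pose F p := if `[< A p >] then c (x, b) else c p.
pose G p := if `[< A p >] then 1%g else jump c p.
have /andP[a0 ab'] := ab.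
have noA u : a < u < b -> u <> t2 -> ~ under ((x, u) : point D).
  move=> hu ut [q qu]; have /(cr u q hu) := crossing_sym (over_crossing qu).
  move=> [[ut1 q2]|[ut2 _]] //; apply: (diag_over_asym (diagP D) ov).
  by rewrite -q2 -ut1.
have [Aa Ab] : ~ A (x, a) /\ ~ A (x, b) by split=> -[_ /=]; rewrite ltxx ?andbF.
have bE : c (x, b) = (c (x, a) ^ jump c (x, a))%g.
  have /andP[at1' t1b] := at1; have /andP[at2' t2b] := at2.
  have st u v : a <= u -> u < v -> v <= b -> (forall w, u < w < v -> w <> t2) ->
      c (x, v) = (c (x, u) ^ jump c (x, u))%g.
    move=> au uv vb h; apply: coloring_step => //; [lra|lra|].
    move=> w /[dup] /h wt /andP[uw wv]; apply: noA => //; apply/andP; split; lra.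
  have e2 : c (x, t2) = (c (x, a) ^ jump c (x, a))%g.
    by apply: st => // [|w /andP[_ wt] wE]; [lra|rewrite wE ltxx in wt].
  have e3 v : t2 < v -> v <= b -> c (x, v) = (c (x, t2) ^ jump c (x, t2))%g.
    move=> tv vb; apply: st => // [|w /andP[wt _] wE]; [lra|rewrite wE ltxx in wt].
    by [].
  rewrite (e3 b) // -e2 (jump_over _ ov).
  have [t12|t21|t12] := ltgtP t1 t2.
  - have -> : c (x, t1) = c (x, t2).
      by rewrite e2; apply: st => // [|w /andP[_ wt] wE]; [lra|rewrite wE in wt; lra].
    by case: positive; rewrite ?conjgg ?conjgVg.
  - have e1 := e3 t1 t21 (ltW t1b); rewrite (jump_over _ ov) in e1.
    have {}e1 : c (x, t2) = c (x, t1).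
      case: positive e1 => e1.
        apply: (conjg_inj (c (x, t1))); rewrite -e1.
        by rewrite conjgg.
      by apply: (conjg_inj (c (x, t1))^-1%g); rewrite -e1 conjgVg.
    by rewrite -e1; case: positive; rewrite ?conjgg ?conjgVg.
  - by exfalso; apply: (diag_over_asym (diagP D) ov); rewrite t12 in ov *.
have AE : arcs [:: (x, a, b)] = A by exact: arcs1.
apply: (disc_coloring (l := [:: (x, a, b)]) ra (mem_head _ _) _ dA' _ hc (F := F) (G := G)); rewrite AE => //.
- by move=> p; exact: open_arc_map.
- by move=> p /asboolF; rewrite /F => ->.
- by move=> p /asboolF; rewrite /G => ->.
- move=> c' p c'F Ap; rewrite /G asboolT //; apply: jump1 => -[q qp].
  apply: (cf (mu p) q); last exact/crossing_sym/over_crossing.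
  exact/open_arc_map.
- move=> y a' b'; rewrite inE => /eqP[-> -> ->]; split => //.
  apply: (flat_arc (z := c (x, b))) => [u hu|u /andP[au ub]|].
  + by rewrite /G asboolT.
  + rewrite /F; case: asboolP => // nA; congr (c (x, _)); apply/eqP.
    rewrite eq_le ub leNgt; apply/negP => ub'; apply: nA; split => //=.
    by rewrite au.
  + by rewrite /F /G !asboolF.
Qed.

(** Virtual crossings impose no condition on the colours. *)
Lemma detour_transfers : detour s -> same_loops s /\ transfers.
Proof.
move=> [x [a [b [ra v v']]]].
have [ss [ab b1] _ so] := ra; split => // N c hc.
pose A := open_arc x a b.
have AE : arcs [:: (x, a, b)] = A by exact: arcs1.
have no p : A p -> ~ under p /\ forall q, ~ over p q.
  move=> Ap; split=> [[q qp]|q pq].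
    have [_ n] := v p q Ap (crossing_sym (over_crossing qp)); by apply: n; right.
  have [_ n] := v p q Ap (over_crossing pq); by apply: n; left.
have no' p : A p -> ~ under (mu p) /\ forall q, ~ over (mu p) q.
  move=> Ap; have Ap' : open_arc (curve_map s x) a b (mu p) by exact/open_arc_map.
  split=> [[q qp]|q pq].
    have [_ n] := v' _ q Ap' (crossing_sym (over_crossing qp)); by apply: n; right.
  have [_ n] := v' _ q Ap' (over_crossing pq); by apply: n; left.
apply: (local_coloring ss (A := A) _ _ _ _ hc (F := c) (G := jump c) (l := [:: (x, a, b)])) => //.
- by move=> p; exact: replace_arc_velocity ra.
- by move=> p q qp _ Aq; exact: ((no q Aq).2 p qp).
- by move=> p q qp _ Aq; exact: ((no' q Aq).2 (mu p) qp).
- by move=> c' p _ Ap; rewrite !jump1 //; [exact: (no p Ap).1|exact: (no' p Ap).1].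
- move=> y a' b'; rewrite inE => /eqP[-> -> ->].
  have /andP[a0 ab'] := ab.
  split => //; [by move=> [_ /=]; rewrite ltxx|by move=> [_ /=]; rewrite ltxx andbF|].
  exact: transport_sub (ltW a0) (ltW b1) (hc x).
Qed.

End DiscMoves.

(** * The second Reidemeister move *)

Section Reidemeister2.
Variables (R : realType) (m : nat) (D D' : diagram R m) (s : loop D -> loop D').
Let mu := point_map s.

Lemma diameter_chord (E : diagram R m) (y : curve E) a b c :
  diameter y a b c -> exists v, chord y a b c v.
Proof. by case=> ab [b1 [v hv]]; exists v. Qed.

(** The height above the chord vanishes at the two crossings, and not between
    them, because a point of the disc of height zero lies on the chord. *)
Lemma consecutive_crossings_opposite (x y : curve D) a1 b1 c v r t1 t2 u1 u2 :
  chord y a1 b1 c v -> ~ disc c r (at_ ((y, b1) : point D)) ->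
  0 <= t1 -> t1 < t2 -> t2 <= 1 -> a1 < u1 < b1 -> a1 < u2 < b1 ->
  crossing ((x, t1) : point D) (y, u1) -> crossing ((x, t2) : point D) (y, u2) ->
  (forall t, t1 < t < t2 -> disc c r (at_ ((x, t) : point D))) ->
  (forall t u, t1 < t < t2 -> a1 < u < b1 -> at_ ((x, t) : point D) <> at_ ((y, u) : point D)) ->
  (0 < det2 v (velocity ((x, t1) : point D))) = ~~ (0 < det2 v (velocity ((x, t2) : point D))).
Proof.
move=> hy out t10 t12 t21 hu1 hu2 cr1 cr2 inn no.
have vneq t u : 0 <= t <= 1 -> a1 < u < b1 -> crossing ((x, t) : point D) (y, u) ->
    height v c x t = 0 /\ det2 v (velocity ((x, t) : point D)) != 0.
  move=> ht /andP[/ltW h1 /ltW h2] cr; have [_ _ _ e] := cr; split.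
    have := chord_height hy (t := u); rewrite h1 h2 => /(_ isT).
    by rewrite /height; move: e; rewrite /at_ /= => ->.
  have := diag_transverse (diagP D) cr; rewrite (chord_velocity hy) ?h1 ?h2 //.
  by apply: contraNneq; rewrite /det2 => h; apply/eqP; lra.
have [z1 d1] := vneq t1 u1 ltac:(apply/andP; split; lra) hu1 cr1.
have [z2 d2] := vneq t2 u2 ltac:(apply/andP; split; lra) hu2 cr2.
have nz t : t1 < t < t2 -> height v c x t != 0.
  move=> ht; apply/eqP => h0.
  have [u hu e] := chord_cover hy out (inn t ht) h0; exact: no ht hu e.
have [der1 e1] := height_derive v c x t1; have [der2 e2] := height_derive v c x t2.
rewrite -e1 in d1 *; rewrite -e2 in d2 *.
have der u := (height_derive v c x u).1.
exact: (consecutive_zeros der t12 z1 z2 d1 d2 nz).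
Qed.

Lemma det2C (v w : plane R) : det2 w v = - det2 v w.
Proof. by rewrite /det2; ring. Qed.

Lemma det2_swap_pos (v w : plane R) : det2 v w != 0 -> (0 < det2 w v) = ~~ (0 < det2 v w).
Proof. by move=> h; rewrite det2C oppr_gt0 -leNgt le_eqVlt (negbTE h). Qed.

(** If the arc crossed itself, its two crossings would be the same pair of points
    in both orders, with opposite over and under information. *)
Lemma two_crossings_off_arc (E : diagram R m) (x : curve E) a b t1 t2 p1 p2 :
  two_crossings x a b t1 t2 p1 p2 ->
  over (x, t1) p1 /\ over (x, t2) p2 \/ over p1 (x, t1) /\ over p2 (x, t2) ->
  ~ open_arc x a b p1 /\ ~ open_arc x a b p2.
Proof.
case=> /andP[at1 t12] [t2b cr] ov.
have hab t : t = t1 \/ t = t2 -> a < t < b.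
  by case=> ->; rewrite ?at1 ?t2b ?(lt_trans t12) ?(lt_trans at1).
have c1 : crossing ((x, t1) : point E) p1 by apply/(cr _ _ (hab _ (or_introl erefl))); left.
have c2 : crossing ((x, t2) : point E) p2 by apply/(cr _ _ (hab _ (or_intror erefl))); right.
have no : p1 = (x, t2) -> p2 = (x, t1) -> False.
  by move=> e1 e2; subst p1 p2; case: ov => -[]; exact: (diag_over_asym (diagP E)).
have back t p : crossing ((x, t) : point E) p -> open_arc x a b p ->
    exists2 w, p = (x, w) & w = t1 /\ (x, t) = p1 \/ w = t2 /\ (x, t) = p2.
  case: p => y w xp [/= yx hw]; subst y; exists w => //.
  by apply/(cr _ _ hw); exact: crossing_sym.
split=> /back => [/(_ t1 c1)|/(_ t2 c2)] [w pE [[we te]|[we te]]].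
- by case: c1 => _ _ /(_ te).
- by apply: no; rewrite ?pE ?we // te.
- by apply: no; rewrite ?pE ?we // te.
- by case: c2 => _ _ /(_ te).
Qed.

Lemma conj_cancel (N : groupType) (e : bool) (z w : N) :
  ((w ^ (if e then z else z^-1)) ^ (if ~~ e then z else z^-1))%g = w.
Proof. by case: e; rewrite /= -conjgM ?mulgV ?mulVg conjg1. Qed.

Lemma conj_cancelN (N : groupType) (e : bool) (z w : N) :
  ((w ^ (if ~~ e then z else z^-1)) ^ (if e then z else z^-1))%g = w.
Proof. by case: e; rewrite /= -conjgM ?mulgV ?mulVg conjg1. Qed.

(** The two crossings have opposite signs and overcrossing strands of the same
    colour, so that their effects on the strand below cancel. *)
Lemma reidemeister2_transfers : reidemeister2 s -> same_loops s /\ transfers s.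
Proof.
move=> [x [a [b [y [a1 [b1 [c0 [r [t1 [t2 [u1 [u2]]]]]]]]]]]].
move=> [[ra /diameter_chord[v hy]] disj [dA dA'] [cr ov] cf].
have [ss [ab b1'] sat so] := ra; split => // N c hc.
have /andP[a0 ab'] := ab; have [/andP[a10 ab1] b11 _] := hy.
have ab1' : 0 < a1 < b1 by rewrite a10.
set A := _ `|` _ in dA; set A' := _ `|` _ in dA'.
have AE : arcs [:: (x, a, b); (y, a1, b1)] = A by rewrite arcs_cons arcs1.
have AA p : A' (mu p) <-> A p.
  by split=> -[] /(open_arc_map ss) h; [left|right|left|right].
have [Aa Ab] : ~ A (x, a) /\ ~ A (x, b).
  have [h1 h2] := arc_ends_off ab' ab1 disj.
  by split=> -[[_ /=]|//]; rewrite ltxx ?andbF.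
have [Aa1 Ab1] : ~ A (y, a1) /\ ~ A (y, b1).
  have [h1 h2] := arc_ends_off ab1 ab' (etrans (setIC _ _) disj).
  by split=> -[//|[_ /=]]; rewrite ltxx ?andbF.
have out : ~ disc c0 r (at_ ((y, b1) : point D)).
  move=> /(dA.2 (y, b1)) h; apply: Ab1; apply: h.
  by rewrite /dom /=; case: (y) => _; apply/andP; split; lra.
have [off1 off2] := two_crossings_off_arc cr ov.
have [/andP[at1 t12] [t2b crE]] := cr.
have h1 : a < t1 < b by rewrite at1 (lt_trans t12).
have h2 : a < t2 < b by rewrite t2b (lt_trans at1).
have c1 : crossing ((x, t1) : point D) (y, u1) by apply/(crE _ _ h1); left.
have c2 : crossing ((x, t2) : point D) (y, u2) by apply/(crE _ _ h2); right.
have hu1 : a1 < u1 < b1.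
  by have [//|[]//] := disc_crossing dA c1 (or_introl (conj erefl h1)).
have hu2 : a1 < u2 < b1.
  by have [//|[]//] := disc_crossing dA c2 (or_introl (conj erefl h2)).
have domx t : a < t < b -> dom ((x, t) : point D).
  by move=> ht; apply: (open_arc_dom (x := x) a0 b1').
have domy u : a1 < u < b1 -> dom ((y, u) : point D).
  by move=> hu; apply: (open_arc_dom (x := y) a10 b11).
have no t u : a < t < b -> a1 < u < b1 -> at_ ((x, t) : point D) = at_ ((y, u) : point D) ->
    t = t1 /\ u = u1 \/ t = t2 /\ u = u2.
  move=> ht hu e; have : crossing ((x, t) : point D) (y, u).
    split; [exact: domx|exact: domy| |exact: e].
    move=> xy; suff : (open_arc x a b `&` open_arc y a1 b1) (x, t) by rewrite disj.
    by split; [|rewrite xy].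
  by move=> /(crE _ _ ht)[[-> [->]]|[-> [->]]]; [left|right].
have opp : (0 < det2 v (velocity ((x, t1) : point D))) = ~~ (0 < det2 v (velocity ((x, t2) : point D))).
  apply: (consecutive_crossings_opposite hy out _ t12 _ hu1 hu2 c1 c2).
  - exact: ltW (lt_trans a0 at1).
  - exact: ltW (lt_trans t2b b1').
  - move=> t /andP[q1 q2]; have ht : a < t < b by rewrite (lt_trans at1) ?(lt_trans q2).
    by apply/(dA.2 (x, t)); [exact: domx|left].
  - move=> t u /andP[q1 q2] hu; have ht : a < t < b by rewrite (lt_trans at1) ?(lt_trans q2).
    by move=> /(no t u ht hu)[[tE]|[tE]]; move: q1 q2; rewrite tE ltxx.
have vu u : a1 < u < b1 -> velocity ((y, u) : point D) = v.
  by move=> /andP[q1 q2]; apply: (chord_velocity hy); rewrite !ltW.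
have tr t u : a1 < u < b1 -> crossing ((x, t) : point D) (y, u) ->
    det2 v (velocity ((x, t) : point D)) != 0.
  by move=> hu /(diag_transverse (diagP D)); rewrite vu // det2C oppr_eq0.
pose F p := if `[< open_arc x a b p >] then c (x, b)
  else if `[< open_arc y a1 b1 p >] then c (y, b1) else c p.
pose G p := if `[< A p >] then 1%g else jump c p.
have Foff p : ~ A p -> F p = c p.
  by move=> Ap; rewrite /F !asboolF // => h; apply: Ap; [right|left].
have Goff p : ~ A p -> G p = jump c p by move=> Ap; rewrite /G asboolF.
have xunder (t : R) (q : point D) : a < t < b -> over q (x, t) ->
    t = t1 /\ q = (y, u1) \/ t = t2 /\ q = (y, u2).
  by move=> ht /over_crossing/crossing_sym/(crE _ _ ht).
have yunder (u : R) (q : point D) : a1 < u < b1 -> over q (y, u) ->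
    u = u1 /\ q = (x, t1) \/ u = u2 /\ q = (x, t2).
  move=> hu /[dup] /over_crossing/crossing_sym yq _.
  have [[qx qt]|[qy qu]] := disc_crossing dA yq (or_intror (conj erefl hu)).
    case: q => z w in yq qx qt *; rewrite /= in qx qt; subst z.
    have [_ _ _ e] := yq.
    by have [[-> ->]|[-> ->]] := no w u qt hu (esym e); [left|right].
  case: q => z w in yq qy qu *; rewrite /= in qy qu; subst z.
  have [_ _ ne e] := yq; exfalso; apply: ne; congr (_, _).
  have /andP[/ltW k1 /ltW k2] := hu; have /andP[/ltW k3 /ltW k4] := qu.
  by apply: (chord_inj hy _ _ e); rewrite ?k1 ?k2 ?k3.
have stx u w : a <= u -> u < w -> w <= b -> (forall t, u < t < w -> ~ under ((x, t) : point D)) ->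
    c (x, w) = (c (x, u) ^ jump c (x, u))%g.
  move=> au uw wb h; apply: (coloring_step hc _ uw _ h); first exact: le_trans (ltW a0) au.
  exact: le_trans wb (ltW b1').
have sty u w : a1 <= u -> u < w -> w <= b1 -> (forall t, u < t < w -> ~ under ((y, t) : point D)) ->
    c (y, w) = (c (y, u) ^ jump c (y, u))%g.
  move=> au uw wb h; apply: (coloring_step hc _ uw _ h); first exact: le_trans (ltW a10) au.
  exact: le_trans wb (ltW b11).
suff [bE bE1] : c (x, b) = (c (x, a) ^ jump c (x, a))%g /\
    c (y, b1) = (c (y, a1) ^ jump c (y, a1))%g.
  apply: (disc_coloring (l := [:: (x, a, b); (y, a1, b1)]) ra (mem_head _ _) _ dA' _ hc (F := F) (G := G));
    rewrite AE //.
  - move=> c' p c'F Ap; rewrite /G asboolT //; apply: jump1 => -[q qp].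
    have pq := crossing_sym (over_crossing qp).
    case: (Ap) => hp.
      by apply: (cf (mu p) q) => //; exact/open_arc_map.
    have [hq|[qy qu]] := disc_crossing dA' pq (iffRL (AA p) Ap).
      by apply: (cf q (mu p)); last exact: crossing_sym.
    case: p => y' u in hp pq Ap qp *; case: hp => /= yy hu; subst y'.
    case: q => z w in pq qp qy qu *; rewrite /= in qy qu; subst z.
    have [_ _ ne e] := pq; apply: ne; congr (_, _).
    have offa k : a1 < k < b1 -> at_ ((curve_map s y, k) : point D') = at_ ((y, k) : point D).
      move=> hk; apply: (sat (y, k) (domy k hk)) => hx.
      by suff : (open_arc x a b `&` open_arc y a1 b1) (y, k) by rewrite disj.
    have /andP[/ltW k1 /ltW k2] := hu; have /andP[/ltW k3 /ltW k4] := qu.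
    apply: (chord_inj hy (t := u) (u := w)); rewrite ?k1 ?k2 ?k3 //.
    by rewrite -!offa.
  - move=> x' a' b'; rewrite !inE => /orP[/eqP[-> -> ->]|/eqP[-> -> ->]]; split => //.
      apply: (flat_arc (z := c (x, b))) => [u hu|u /andP[au ub]|].
      + by rewrite /G asboolT //; left.
      + have [->|ub'] := eqVneq u b; first by rewrite Foff.
        by rewrite /F asboolT //; split => //=; rewrite au lt_neqAle ub'.
      + by rewrite Foff // Goff.
    apply: (flat_arc (z := c (y, b1))) => [u hu|u /andP[au ub]|].
    + by rewrite /G asboolT //; right.
    + have [->|ub'] := eqVneq u b1; first by rewrite Foff.
      have hy' : open_arc y a1 b1 (y, u) by split => //=; rewrite au lt_neqAle ub'.
      rewrite /F asboolF ?asboolT // => hx.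
      by suff : (open_arc x a b `&` open_arc y a1 b1) (y, u) by rewrite disj.
    + by rewrite Foff // Goff.
have t12ne : t1 <> t2 by move=> e; rewrite e ltxx in t12.
case: ov => -[ov1 ov2].
  have nox t : a < t < b -> ~ under ((x, t) : point D).
    move=> ht [q /[dup] qt /(xunder _ _ ht)[[te qe]|[te qe]]]; subst t q.
      exact: (diag_over_asym (diagP D) ov1).
    exact: (diag_over_asym (diagP D) ov2).
  have cx t : a < t -> t <= b -> c (x, t) = (c (x, a) ^ jump c (x, a))%g.
    move=> at_ tb; apply: stx => // u /andP[q1 q2].
    by apply: nox; rewrite q1 (lt_le_trans q2).
  split; first exact: cx.
  have xt1 := cx t1 at1 (ltW (lt_trans t12 t2b)); have xt2 := cx t2 (lt_trans at1 t12) (ltW t2b).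
  set z := (_ ^ _)%g in xt1 xt2.
  have u12 : u1 <> u2.
    move=> e; subst u2; apply: t12ne.
    by have := diag_double (diagP D) (crossing_sym c1) (crossing_sym c2) => -[].
  have j1 := jump_over c ov1; have j2 := jump_over c ov2; rewrite xt1 in j1; rewrite xt2 in j2.
  have e12 : positive ((x, t2) : point D) (y, u2) = ~~ positive ((x, t1) : point D) (y, u1).
    have pE t u (hu : a1 < u < b1) (ct : crossing ((x, t) : point D) (y, u)) :
        positive ((x, t) : point D) (y, u) = ~~ (0 < det2 v (velocity ((x, t) : point D))).
      by rewrite -(det2_swap_pos (tr _ _ hu ct)) -(vu u hu).
    by rewrite (pE _ _ hu1 c1) (pE _ _ hu2 c2) opp negbK.
  have noy u : a1 < u < b1 -> u <> u1 -> u <> u2 -> ~ under ((y, u) : point D).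
    by move=> hu n1 n2 [q /(yunder _ _ hu)[[]|[]]].
  have /andP[k1 k2] := hu1; have /andP[k3 k4] := hu2.
  have [u12'|u21|//] := ltgtP u1 u2.
    have f1 : c (y, u1) = (c (y, a1) ^ jump c (y, a1))%g.
      apply: sty => //; first exact: ltW.
      move=> u /andP[q1 q2]; apply: noy; first by rewrite q1 (lt_trans q2).
        by move=> e; rewrite e ltxx in q2.
      by move=> e; move: q2; rewrite e ltNge ltW.
    have f2 : c (y, u2) = (c (y, u1) ^ jump c (y, u1))%g.
      apply: sty => //; [exact: ltW|exact: ltW|].
      move=> u /andP[q1 q2]; apply: noy; first by rewrite (lt_trans k1) ?(lt_trans q2).
        by move=> e; rewrite e ltxx in q1.
      by move=> e; rewrite e ltxx in q2.
    have f3 : c (y, b1) = (c (y, u2) ^ jump c (y, u2))%g.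
      apply: sty => //; first exact: ltW.
      move=> u /andP[q1 q2]; apply: noy; first by rewrite q2 (lt_trans k3).
        by move=> e; move: q1; rewrite e ltNge ltW.
      by move=> e; rewrite e ltxx in q1.
    by rewrite f3 f2 j1 j2 e12 conj_cancel.
  have f1 : c (y, u2) = (c (y, a1) ^ jump c (y, a1))%g.
    apply: sty => //; first exact: ltW.
    move=> u /andP[q1 q2]; apply: noy; first by rewrite q1 (lt_trans q2).
      by move=> e; move: q2; rewrite e ltNge ltW.
    by move=> e; rewrite e ltxx in q2.
  have f2 : c (y, u1) = (c (y, u2) ^ jump c (y, u2))%g.
    apply: sty => //; [exact: ltW|exact: ltW|].
    move=> u /andP[q1 q2]; apply: noy; first by rewrite (lt_trans k3) ?(lt_trans q2).
      by move=> e; rewrite e ltxx in q2.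
    by move=> e; rewrite e ltxx in q1.
  have f3 : c (y, b1) = (c (y, u1) ^ jump c (y, u1))%g.
    apply: sty => //; first exact: ltW.
    move=> u /andP[q1 q2]; apply: noy; first by rewrite q2 (lt_trans k1).
      by move=> e; rewrite e ltxx in q1.
    by move=> e; move: q1; rewrite e ltNge ltW.
  by rewrite f3 f2 j1 j2 e12 conj_cancelN.
have noy u : a1 < u < b1 -> ~ under ((y, u) : point D).
  move=> hu [q /[dup] qt /(yunder _ _ hu)[[ue qe]|[ue qe]]]; subst u q.
    exact: (diag_over_asym (diagP D) ov1).
  exact: (diag_over_asym (diagP D) ov2).
have cy u : a1 < u -> u <= b1 -> c (y, u) = (c (y, a1) ^ jump c (y, a1))%g.
  move=> au ub; apply: sty => // w /andP[q1 q2].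
  by apply: noy; rewrite q1 (lt_le_trans q2).
split; last exact: cy.
have /andP[k1 k2] := hu1; have /andP[k3 k4] := hu2.
have yu1 := cy u1 k1 (ltW k2); have yu2 := cy u2 k3 (ltW k4).
set z := (_ ^ _)%g in yu1 yu2.
have j1 := jump_over c ov1; have j2 := jump_over c ov2; rewrite yu1 in j1; rewrite yu2 in j2.
have e12 : positive ((y, u2) : point D) (x, t2) = ~~ positive ((y, u1) : point D) (x, t1).
  have pE t u (hu : a1 < u < b1) :
      positive ((y, u) : point D) (x, t) = (0 < det2 v (velocity ((x, t) : point D))).
    by rewrite -(vu u hu).
  by rewrite (pE _ _ hu1) (pE _ _ hu2) opp negbK.
have nox t : a < t < b -> t <> t1 -> t <> t2 -> ~ under ((x, t) : point D).
  by move=> ht n1 n2 [q /(xunder _ _ ht)[[]|[]]].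
have f1 : c (x, t1) = (c (x, a) ^ jump c (x, a))%g.
  apply: stx => //; first exact: ltW (lt_trans t12 t2b).
  move=> t /andP[q1 q2]; apply: nox; first by rewrite q1 (lt_trans q2) ?(lt_trans t12).
    by move=> e; rewrite e ltxx in q2.
  by move=> e; move: q2; rewrite e ltNge ltW.
have f2 : c (x, t2) = (c (x, t1) ^ jump c (x, t1))%g.
  apply: stx => //; [exact: ltW|exact: ltW|].
  move=> t /andP[q1 q2]; apply: nox; first by rewrite (lt_trans at1) ?(lt_trans q2).
    by move=> e; rewrite e ltxx in q1.
  by move=> e; rewrite e ltxx in q2.
have f3 : c (x, b) = (c (x, t2) ^ jump c (x, t2))%g.
  apply: stx => //; first exact: ltW (lt_trans at1 t12).
  move=> t /andP[q1 q2]; apply: nox; first by rewrite q2 (lt_trans _ q1) ?(lt_trans at1).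
    by move=> e; move: q1; rewrite e ltNge ltW.
  by move=> e; rewrite e ltxx in q1.
by rewrite f3 f2 j1 j2 e12 conj_cancel.
Qed.

End Reidemeister2.

(** * An arc crossing two lines *)

Section TwoCrossingStates.
Variable R : realType.

Lemma derivable_gt_near (f : R -> R) e z : derivable f e 1 -> z < f e ->
  exists2 d, 0 < d & forall u, `|u - e| < d -> z < f u.
Proof.
move=> /derivable1_diffP/differentiable_continuous fc zf.
have /nbhs_ballP[d /= d0 hd] : \forall u \near e, z < f u by exact: (cvgr_gt (f e) fc).
by exists d => // u hu; apply: hd; rewrite -ball_normE /= distrC.
Qed.

(** The sign of [f] just after [a], and just before [b], when the zeros of [f] at
    these points are simple. *)
Definition germ_right (f : R -> R) a : bool :=
  (0 < f a) || (f a == 0) && (0 < derive1 f a).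
Definition germ_left (f : R -> R) b : bool :=
  (0 < f b) || (f b == 0) && (derive1 f b < 0).

Lemma sg_pos (x y : R) : Num.sg x = Num.sg y -> (0 < x) = (0 < y).
Proof. by move=> h; rewrite -(sgr_gt0 x) h sgr_gt0. Qed.

Lemma sg_opp_pos (x y : R) : y != 0 -> Num.sg x = - Num.sg y -> (0 < x) = ~~ (0 < y).
Proof.
move=> y0 h; rewrite -(sgr_gt0 x) h -sgrN sgr_gt0 oppr_gt0.
by rewrite -leNgt le_eqVlt (negbTE y0).
Qed.

Lemma no_zero_pos (f : R -> R) s t : (forall u, derivable f u 1) -> s <= t ->
  (forall u, s <= u <= t -> f u != 0) -> (0 < f s) = (0 < f t).
Proof.
move=> df st nz; apply/sg_pos/(sgr_no_zero st _ nz).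
by apply: derivable_within_continuous => u _; exact: df.
Qed.

Lemma germ_rightP (f : R -> R) a s : (forall u, derivable f u 1) -> a < s ->
  (f a = 0 -> derive1 f a != 0) -> (forall u, a < u <= s -> f u != 0) ->
  (0 < f s) = germ_right f a.
Proof.
move=> df as_ nd nz; rewrite /germ_right.
have [fa|fa] := eqVneq (f a) 0.
  rewrite fa ltxx /=; apply: sg_pos.
  exact: (sgr_after_zero (fun u _ => df u) as_ fa (nd fa) nz).
rewrite orbF; apply/esym/(no_zero_pos df (ltW as_)) => u /andP[].
rewrite le_eqVlt => /orP[/eqP <- //|au us]; exact: nz (introT andP (conj au us)).
Qed.

Lemma germ_leftP (f : R -> R) s b : (forall u, derivable f u 1) -> s < b ->
  (f b = 0 -> derive1 f b != 0) -> (forall u, s <= u < b -> f u != 0) ->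
  (0 < f s) = germ_left f b.
Proof.
move=> df sb nd nz; rewrite /germ_left.
have [fb|fb] := eqVneq (f b) 0.
  rewrite fb ltxx /= -oppr_gt0; have d0 := nd fb.
  have := sgr_before_zero (fun u _ => df u) sb fb d0 nz.
  by rewrite -sgrN => /sg_pos.
rewrite orbF; apply: (no_zero_pos df (ltW sb)) => u /andP[su].
rewrite le_eqVlt => /orP[/eqP -> //|ub]; exact: nz (introT andP (conj su ub)).
Qed.

(** The sides of the lines, as given by [S], after the line [i] has been crossed. *)
Definition flip (i : bool) (S : bool -> bool) (j : bool) : bool := S j (+) (j == i).

(** [f i] is the height of the arc above the line [i].  The sides of the arc change
    only at its crossings; the germs are used because the arc may start or end on
    one of the lines. *)
Lemma two_crossing_states (f : bool -> R -> R) a b t1 t2 (i1 i2 : bool) :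
  (forall i u, derivable (f i) u 1) -> a < t1 -> t1 < t2 -> t2 < b ->
  (forall i, f i a = 0 -> derive1 (f i) a != 0) ->
  (forall i, f i b = 0 -> derive1 (f i) b != 0) ->
  (forall i t, a < t < b -> f i t = 0 -> t = t1 /\ i = i1 \/ t = t2 /\ i = i2) ->
  f i1 t1 = 0 -> f i2 t2 = 0 -> derive1 (f i1) t1 != 0 -> derive1 (f i2) t2 != 0 ->
  let S1 i := germ_right (f i) a in let S2 := flip i1 S1 in
  [/\ (0 < derive1 (f i1) t1) = ~~ S1 i1, (0 < derive1 (f i2) t2) = ~~ S2 i2,
      f (~~ i1) t1 != 0 /\ (0 < f (~~ i1) t1) = S1 (~~ i1),
      f (~~ i2) t2 != 0 /\ (0 < f (~~ i2) t2) = S2 (~~ i2)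
    & forall i, germ_left (f i) b = flip i2 S2 i].
Proof.
move=> df at1 t12 t2b nda ndb zeros z1 z2 d1 d2 S1 S2.
pose s0 := (a + t1) / 2; pose s1 := (t1 + t2) / 2; pose s2 := (t2 + b) / 2.
have [h0 h0'] : a < s0 /\ s0 < t1 by rewrite /s0; split; lra.
have [h1 h1'] : t1 < s1 /\ s1 < t2 by rewrite /s1; split; lra.
have [h2 h2'] : t2 < s2 /\ s2 < b by rewrite /s2; split; lra.
move: (s0) (s1) (s2) h0 h0' h1 h1' h2 h2' => {}s0 {}s1 {}s2 h0 h0' h1 h1' h2 h2'.
have nz i u : a < u < b -> ~ (u = t1 /\ i = i1) -> ~ (u = t2 /\ i = i2) -> f i u != 0.
  by move=> hu n1 n2; apply/eqP => /(zeros i u hu)[].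
have st i : (0 < f i s0) = S1 i.
  apply: germ_rightP => // [|u /andP[q1 q2]]; first exact: nda.
  apply: nz; [apply/andP; split; lra|case=> ? _; lra|case=> ? _; lra].
have en i : (0 < f i s2) = germ_left (f i) b.
  apply: germ_leftP => // [|u /andP[q1 q2]]; first exact: ndb.
  apply: nz; [apply/andP; split; lra|case=> ? _; lra|case=> ? _; lra].
have neg i : (~~ i) <> i by case: i.
have p1 : (0 < f i1 s0) = ~~ (0 < derive1 (f i1) t1).
  apply: sg_opp_pos => //; apply: sgr_before_zero => // u /andP[q1 q2].
  apply: nz; [apply/andP; split; lra|case=> ? _; lra|case=> ? _; lra].
have p1' : (0 < f i1 s1) = (0 < derive1 (f i1) t1).
  apply: sg_pos; apply: sgr_after_zero => // u /andP[q1 q2].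
  apply: nz; [apply/andP; split; lra|case=> ? _; lra|case=> ? _; lra].
have p2 : (0 < f i2 s1) = ~~ (0 < derive1 (f i2) t2).
  apply: sg_opp_pos => //; apply: sgr_before_zero => // u /andP[q1 q2].
  apply: nz; [apply/andP; split; lra|case=> ? _; lra|case=> ? _; lra].
have p2' : (0 < f i2 s2) = (0 < derive1 (f i2) t2).
  apply: sg_pos; apply: sgr_after_zero => // u /andP[q1 q2].
  apply: nz; [apply/andP; split; lra|case=> ? _; lra|case=> ? _; lra].
have q1 i s t : i <> i1 -> s0 <= s -> s <= t -> t <= s1 -> (0 < f i s) = (0 < f i t).
  move=> ii k1 k2 k3; apply: no_zero_pos => // u /andP[q1 q2].
  apply: nz; [apply/andP; split; lra|by case|case=> ? _; lra].
have q2 i s t : i <> i2 -> s1 <= s -> s <= t -> t <= s2 -> (0 < f i s) = (0 < f i t).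
  move=> ii k1 k2 k3; apply: no_zero_pos => // u /andP[q2 q2'].
  apply: nz; [apply/andP; split; lra|case=> ? _; lra|by case].
have m1 i : (0 < f i s1) = S2 i.
  rewrite /S2 /flip; have [->|ne] := eqVneq i i1.
    by rewrite p1' addbT -st p1 negbK.
  by rewrite addbF -st; apply/esym/q1; [exact/eqP| | |]; lra.
split.
- by rewrite -st p1 negbK.
- by rewrite -m1 p2 negbK.
- split; first by apply: nz; [apply/andP; split; lra|by case=> _ /neg|case=> ? _; lra].
  by rewrite -st; apply/esym/q1; [exact: neg| | |]; lra.
- split; first by apply: nz; [apply/andP; split; lra|case=> ? _; lra|by case=> _ /neg].
  by rewrite -m1; apply/esym/q2; [exact: neg| | |]; lra.
- move=> i; rewrite -en {1}/flip -m1; have [->|ne] := eqVneq i i2.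
    by rewrite p2' addbT p2 negbK.
  by rewrite addbF; apply/esym/q2; [exact/eqP| | |]; lra.
Qed.

End TwoCrossingStates.

Section BoundaryTransverse.
Variables (R : realType) (m : nat) (D : diagram R m).

Definition radius2 (c : plane R) (x : curve D) (t : R) : R :=
  (curve_path x t 0 0 - c 0 0) ^+ 2 + (curve_path x t 0 1 - c 0 1) ^+ 2.

Lemma radius2_derive c x t : derivable (radius2 c x : R^o -> R^o) t 1 /\
  derive1 (radius2 c x) t =
    2 * ((curve_path x t 0 0 - c 0 0) * velocity ((x, t) : point D) 0 0 +
         (curve_path x t 0 1 - c 0 1) * velocity ((x, t) : point D) 0 1).
Proof.
have [d0 e0] := curve_coord x t 0; have [d1 e1] := curve_coord x t 1.
rewrite -e0 -e1 !derive1E.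
have i0 : is_derive t (1 : R^o) (fun u => curve_path x u 0 0 : R^o) ('D_1 (fun u => curve_path x u 0 0) t) := DeriveDef d0 erefl.
have i1 : is_derive t (1 : R^o) (fun u => curve_path x u 0 1 : R^o) ('D_1 (fun u => curve_path x u 0 1) t) := DeriveDef d1 erefl.
split; first by apply: ex_derive.
rewrite derive_val; rewrite /GRing.scale /=; ring.
Qed.

Lemma discE c r x t : disc c r (at_ ((x, t) : point D)) <-> radius2 c x t < r ^+ 2.
Proof. by []. Qed.

Lemma radius2_le c r x a b e : a < b -> e = a \/ e = b ->
  (forall t, a < t < b -> radius2 c x t < r ^+ 2) -> radius2 c x e <= r ^+ 2.
Proof.
move=> ab he inn; rewrite leNgt; apply/negP => out.
have [d d0 hd] := derivable_gt_near (radius2_derive c x e).1 out.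
have [h [h0 h1 h2]] := small_step d0 (etrans (subr_gt0 a b) ab).
case: he => ?; subst e.
  have := hd (a + h); rewrite addrC addKr gtr0_norm // => /(_ h1).
  by rewrite ltNge ltW // inn //; apply/andP; split; lra.
have := hd (b - h); rewrite addrC addKr normrN gtr0_norm // => /(_ h1).
by rewrite ltNge ltW // inn //; apply/andP; split; lra.
Qed.

(** An arc ends transversally to a diameter of the disc: a point of the boundary
    circle on the diameter is one of its ends, so that it is a crossing, or else
    the arc continues the diameter, but the latter leaves the disc there. *)
Lemma boundary_transverse (x y : curve D) a b a1 b1 c v r (A : set (point D)) e :
  chord y a1 b1 c v -> 0 < a -> a < b -> b < 1 -> disc_meets c r A ->
  open_arc x a b `<=` A -> open_arc y a1 b1 `<=` A ->
  ~ A (x, e) -> ~ A (y, b1) ->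
  open_arc x a b `&` open_arc y a1 b1 = set0 -> e = a \/ e = b ->
  height v c x e = 0 -> det2 v (velocity ((x, e) : point D)) != 0.
Proof.
move=> hy a0 ab b1' [_ dA] xA yA Ae Ab1 disj he h0.
have [/andP[a10 ab1] b11 hat] := hy; have v0 := chord_neq0 hy.
have domI z t : 0 < t < 1 -> dom ((z, t) : point D).
  by rewrite /dom; case: z => _ /= /andP[h1 h2]; rewrite ?(ltW h1) ?h2 ?(ltW h2).
have inx t : a < t < b -> radius2 c x t < r ^+ 2.
  move=> /[dup] ht /andP[h1 h2]; apply/discE/(dA (x, t)); last by apply: xA; split.
  by apply: domI; rewrite (lt_trans a0) ?(lt_trans h2).
have iny t : a1 < t < b1 -> radius2 c y t < r ^+ 2.
  move=> /[dup] ht /andP[h1 h2]; apply/discE/(dA (y, t)); last by apply: yA; split.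
  by apply: domI; rewrite (lt_trans a10) ?(lt_trans h2).
have e01 : 0 < e < 1.
  by case: he => ->; apply/andP; split; rewrite // ?(lt_trans a0 ab) ?(lt_trans ab b1').
have rx : radius2 c x e = r ^+ 2.
  apply/eqP; rewrite eq_le (radius2_le ab he inx) /= leNgt; apply/negP.
  by move=> /discE/(dA (x, e) (domI _ _ e01)).
have ry : radius2 c y b1 = r ^+ 2.
  apply/eqP; rewrite eq_le (radius2_le ab1 (or_intror erefl) iny) /= leNgt; apply/negP.
  by move=> /discE/(dA (y, b1)) h; apply: Ab1; apply: h; apply: domI; rewrite b11 (lt_trans a10).
pose k := (b1 - a1) / 2; have k0 : 0 < k by rewrite /k; lra.
pose V := v 0 0 ^+ 2 + v 0 1 ^+ 2.
have V0 : 0 < V.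
  rewrite lt_neqAle addr_ge0 ?sqr_ge0 // andbT eq_sym paddr_eq0 ?sqr_ge0 // !sqrf_eq0.
  by apply/negP => /andP[/eqP z0 /eqP z1]; apply: v0; apply: plane_ext; rewrite mxE.
have atb : curve_path y b1 = c + k *: v.
  rewrite -[LHS]/(at_ ((y, b1) : point D)) hat ?lexx ?andbT ?ltW //.
  by congr (_ + _ *: _); rewrite /k; lra.
have ata : curve_path y a1 = c + (- k) *: v.
  rewrite -[LHS]/(at_ ((y, a1) : point D)) hat ?lexx ?ltW //.
  by congr (_ + _ *: _); rewrite /k; lra.
have [l hl] := det2_eq0P v0 h0.
have pE : curve_path x e = c + l *: v by rewrite -hl addrC subrK.
have lk : l = k \/ l = - k.
  have : l ^+ 2 * V = k ^+ 2 * V.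
    move: rx ry; rewrite /radius2 pE atb !mxE => e1 e2.
    transitivity (r ^+ 2); first by rewrite -e1 /V; ring.
    by rewrite -e2 /V; ring.
  move=> /(mulIf (lt0r_neq0 V0)) /eqP; rewrite eqf_sqr => /orP[/eqP|/eqP]; by [left|right].
have [w [hw vw wE wat]] : exists w, [/\ w = a1 \/ w = b1, velocity ((y, w) : point D) = v,
    0 < w < 1 & curve_path y w = curve_path x e].
  case: lk => lE; rewrite pE lE; [exists b1|exists a1].
    split; [by right|by apply: (chord_velocity hy); rewrite lexx ltW| |exact: atb].
    by rewrite b11 (lt_trans a10).
  split; [by left|by apply: (chord_velocity hy); rewrite lexx ltW| |exact: ata].
  by rewrite a10 (lt_trans ab1).
have [pq|pq] := pselect (((x, e) : point D) = (y, w)); last first.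
  have cr : crossing ((x, e) : point D) (y, w) by split => //; [exact: domI|exact: domI].
  have := diag_transverse (diagP D) cr; rewrite vw.
  by apply: contraNneq; rewrite /det2 => h; apply/eqP; lra.
have [xy ew] : x = y /\ e = w by case: pq.
exfalso; subst y w.
have common u : a < u < b -> a1 < u < b1 -> False.
  by move=> q1 q2; suff : (open_arc x a b `&` open_arc x a1 b1) (x, u) by rewrite disj.
have [der dE] := radius2_derive c x e; rewrite pE vw !mxE in dE.
have {}dE : derive1 (radius2 c x) e = 2 * l * V by rewrite dE /V; ring.
pose g t := radius2 c x t - r ^+ 2.
have [[gder gE] [gder' gE']] := derive1_shift (r ^+ 2) der.
have g1 : derive1 g e = 2 * l * V by rewrite -dE -gE.
have g0 : g e = 0 by rewrite /g rx subrr.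
have inside h : 0 < h -> h < b - a -> (e = a -> g (e + h) < 0) /\ (e = b -> g (e - h) < 0).
  move=> q1 q2; split=> eE; rewrite /g subr_lt0 inx // eE; apply/andP; split; lra.
have lpos z : 0 < z -> derive1 g e = z -> e = a -> False.
  move=> z0 gz ea; have [|d d0 hd] := derive_pos_signs gder g0; first by rewrite gz.
  have [h [q0 q1 q2]] := small_step d0 (etrans (subr_gt0 a b) ab).
  have [_ /lt_geF] := hd h (introT andP (conj q0 q1)).
  by rewrite ltW //; exact: (inside h q0 q2).1.
have lneg z : z < 0 -> derive1 g e = z -> e = b -> False.
  move=> z0 gz eb; pose g' t := r ^+ 2 - radius2 c x t.
  have g1' : derive1 g' e = - z by rewrite -gz g1 -dE -gE'.
  have [||d d0 hd] := derive_pos_signs gder'.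
  - by rewrite /g' rx subrr.
  - by rewrite g1' oppr_gt0.
  have [h [q0 q1 q2]] := small_step d0 (etrans (subr_gt0 a b) ab).
  have [+ _] := hd h (introT andP (conj q0 q1)).
  rewrite /g' subr_lt0 => /lt_geF; rewrite ltW // -subr_lt0; exact: (inside h q0 q2).2.
have lV z : 0 < z -> 0 < 2 * z * V by move=> z0; rewrite !mulr_gt0.
have end_same : (e = a /\ e = a1) \/ (e = b /\ e = b1) -> False.
  case=> -[e1 e2].
    pose M := Num.min b b1; have [q1 q2 q3] : [/\ e < M, M <= b & M <= b1].
      by rewrite lt_min !ge_min !lexx orbT e1 ab /= -e1 e2 ab1.
    by apply: (common ((e + M) / 2)); apply/andP; split; lra.
  pose M := Num.max a a1; have [q1 q2 q3] : [/\ M < e, a <= M & a1 <= M].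
    by rewrite gt_max !le_max !lexx orbT e1 ab /= -e1 e2 ab1.
  by apply: (common ((e + M) / 2)); apply/andP; split; lra.
have lw : (e = b1 /\ l = k) \/ (e = a1 /\ l = - k).
  have vk : (l = k -> curve_path x e = curve_path x b1) /\ (l = - k -> curve_path x e = curve_path x a1).
    by rewrite pE atb ata; split=> ->.
  have inj := chord_inj hy (t := e).
  have [eI bI aI] : [/\ a1 <= e <= b1, a1 <= b1 <= b1 & a1 <= a1 <= b1].
    by rewrite !lexx (ltW ab1); case: hw => ->; rewrite ?lexx ?(ltW ab1).
  case: lk => lE; [left|right]; split => //.
    exact: inj eI bI (vk.1 lE).
  exact: inj eI aI (vk.2 lE).
case: lw => -[ew lE].
  case: he => ee; last by apply: end_same; right.
  exact: (lpos _ (lV k k0) (etrans g1 (congr1 (fun l => 2 * l * V) lE)) ee).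
case: he => ee; first by apply: end_same; left.
apply: (lneg (2 * (- k) * V)) ee; first by have := lV k k0; lra.
by rewrite g1 lE.
Qed.

End BoundaryTransverse.

(** * An arc over two diameters *)

Section IntegerPowers.
Local Open Scope group_scope.
Variable N : groupType.

Definition gpow (g : N) (k : int) : N :=
  match k with Posz n => g ^+ n | Negz n => (g ^+ n.+1)^-1 end.

Lemma gpowS g k : gpow g (k + 1)%R = gpow g k * g.
Proof.
case: k => [n|[|n]]; first by rewrite -PoszD addn1 /= expgSr.
  by rewrite /= expg1 mulVg.
have -> : (Negz n.+1 + 1)%R = Negz n by rewrite !NegzE; lia.
by rewrite /= [in RHS]expgS invgM mulgVK.
Qed.

Lemma gpowD g j k : gpow g (j + k)%R = gpow g j * gpow g k.
Proof.
elim: k => [|k IH|k IH]; first by rewrite addr0 mulg1.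
  by rewrite -addn1 PoszD addrA !gpowS IH mulgA.
apply: (mulIg g); rewrite -mulgA -!gpowS.
have -> : (- k.+1%:Z + 1)%R = (- k%:Z)%R by lia.
by rewrite -IH; congr gpow; lia.
Qed.

Definition esgn (e : bool) : int := if e then 1%R else (-1)%R.

Lemma gpow_esgn g e : gpow g (esgn e) = if e then g else g^-1.
Proof. by case: e; rewrite /= expg1. Qed.

End IntegerPowers.

(** For an arc crossing first the line [i1] and then the line [i2], starting from
    the sides [S]: the algebraic number of its crossings with the line [i], and
    with the half of this line before the common point of the lines. *)
Definition crossings_on (S : bool -> bool) (i1 i2 i : bool) : int :=
  esgn (S i1) * (i1 == i)%:R + esgn (flip i1 S i2) * (i2 == i)%:R.
Definition crossings_before (S : bool -> bool) (d i1 i2 i : bool) : int :=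
  esgn (S i1) * ((i1 == i) && (S (~~ i1) != d (+) i1))%:R +
  esgn (flip i1 S i2) * ((i2 == i) && (flip i1 S (~~ i2) != d (+) i2))%:R.

(** Two arcs leading from the same sides of the lines to the same sides cross each
    line equally often, counted with signs.  Together they form a closed path,
    whose winding number around the common point of the lines can be counted on a
    half of either line.  The proof enumerates all cases. *)
Lemma crossing_balance S d i1 i2 j1 j2 :
  (forall i, flip i2 (flip i1 S) i = flip j2 (flip j1 S) i) ->
  (forall i, crossings_on S i1 i2 i = crossings_on S j1 j2 i) /\
  crossings_before S d j1 j2 false - crossings_before S d i1 i2 false =
  crossings_before S d j1 j2 true - crossings_before S d i1 i2 true.
Proof.
rewrite /crossings_before /crossings_on /flip => e.
move: (e false) (e true); case Ef: (S false); case Et: (S true); case: i1 {e}; case: i2;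
  case: j1; case: j2; case: d; rewrite /= ?Ef ?Et //= => _ _; split=> [[]|] //=; rewrite ?Ef ?Et //=.
Qed.

Lemma first_crossing (f1 f2 : int) : f1 * true%:R + f2 * false%:R = f1.
Proof. by rewrite mulr1 mulr0 addr0. Qed.

Lemma second_crossing (f1 f2 : int) : f1 * false%:R + f2 * true%:R = f2.
Proof. by rewrite mulr1 mulr0 add0r. Qed.

Lemma no_crossings (f1 f2 : int) : f1 * false%:R + f2 * false%:R = 0.
Proof. by rewrite !mulr0 addr0. Qed.

Section ArcOverChords.
Variables (R : realType) (m : nat) (D : diagram R m).
Variables (x : curve D) (a b : R) (ys : bool -> curve D) (as_ bs : bool -> R).
Variables (c0 : plane R) (vs : bool -> plane R) (r : R) (t1 t2 : R) (p1 p2 : point D).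
Hypotheses (a0 : 0 < a) (ab : a < b) (b1 : b < 1).
Hypothesis hch : forall i, chord (ys i) (as_ i) (bs i) c0 (vs i).
Let ch i := open_arc (ys i) (as_ i) (bs i).
Let A := open_arc x a b `|` ch false `|` ch true.
Let mid i := (as_ i + bs i) / 2.
Hypothesis dA : disc_meets c0 r A.
Hypothesis disj : forall i, open_arc x a b `&` ch i = set0.
Hypothesis disj2 : ch false `&` ch true = set0.
Hypothesis cr : two_crossings x a b t1 t2 p1 p2.
Hypotheses (ov1 : over (x, t1) p1) (ov2 : over (x, t2) p2).
Hypothesis trc : det2 (vs true) (vs false) != 0.

Lemma inA i p : ch i p -> A p.
Proof. by case: i => h; [right|left; right]. Qed.

Lemma ch_unique i j p : ch i p -> ch j p -> i = j.
Proof.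
have no : ch false p -> ch true p -> False.
  by move=> h1 h2; suff : (ch false `&` ch true) p by rewrite disj2.
by case: i; case: j => // h1 h2; exfalso; apply: no.
Qed.

Lemma ch_off_arc i p : ch i p -> ~ open_arc x a b p.
Proof. by move=> h1 h2; suff : (open_arc x a b `&` ch i) p by rewrite disj. Qed.

Lemma mid_in i : as_ i < mid i < bs i.
Proof. by have [/andP[_ h] _ _] := hch i; rewrite /mid; apply/andP; split; lra. Qed.

Lemma ends_off : [/\ ~ A (x, a), ~ A (x, b), forall i, ~ A (ys i, as_ i) & forall i, ~ A (ys i, bs i)].
Proof.
have asb i : as_ i < bs i by have [/andP[]] := hch i.
have offx i := arc_ends_off ab (asb i) (disj i).
have offy i := arc_ends_off (asb i) ab (etrans (setIC _ _) (disj i)).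
have offc i : ~ ch (~~ i) (ys i, as_ i) /\ ~ ch (~~ i) (ys i, bs i).
  apply: arc_ends_off => //; case: i; last exact: disj2.
  by rewrite setIC; exact: disj2.
have self z u v w : u = v \/ u = w -> ~ open_arc (z : curve D) v w (z, u).
  by move=> uu [_ /= /andP[h1 h2]]; case: uu => uu; move: h1 h2; rewrite uu ltxx.
have split_A p : ~ open_arc x a b p -> (forall i, ~ ch i p) -> ~ A p.
  by move=> h1 h2 [[/h1|/h2]|/h2].
split.
- by apply: split_A => [|i]; [apply: self; left|exact: (offx i).1].
- by apply: split_A => [|i]; [apply: self; right|exact: (offx i).2].
- move=> i; apply: split_A => [|j]; first exact: (offy i).1.
  have [->|ne] := eqVneq j i; first by apply: self; left.
  have -> : j = ~~ i by case: (i) (j) ne => -[].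
  exact: (offc i).1.
- move=> i; apply: split_A => [|j]; first exact: (offy i).2.
  have [->|ne] := eqVneq j i; first by apply: self; right.
  have -> : j = ~~ i by case: (i) (j) ne => -[].
  exact: (offc i).2.
Qed.

Lemma dom_chord i u : as_ i < u < bs i -> dom ((ys i, u) : point D).
Proof.
have [/andP[h1 _] h2 _] := hch i.
by move=> hu; exact: (open_arc_dom (x := ys i) (p := (ys i, u)) h1 h2 (conj erefl hu)).
Qed.

Lemma dom_arc t : a < t < b -> dom ((x, t) : point D).
Proof. by move=> ht; exact: (open_arc_dom (x := x) (p := (x, t)) a0 b1 (conj erefl ht)). Qed.

Lemma time_in k : k = t1 \/ k = t2 -> a < k < b.
Proof.
have [/andP[h1 h2] [h3 _]] := cr.
by case=> ->; rewrite ?h1 ?h3 ?(lt_trans h1 h2) ?(lt_trans h2 h3).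
Qed.

Lemma on_chord k p : crossing ((x, k) : point D) p -> a < k < b ->
  exists i w, p = (ys i, w) /\ as_ i < w < bs i.
Proof.
move=> xp hk; have [off1 off2] := two_crossings_off_arc cr (or_introl (conj ov1 ov2)).
have : ~ open_arc x a b p.
  by have [_ [_ crE]] := cr; have [[_ ->]|[_ ->]] := iffLR (crE k p hk) xp.
have xA : A (x, k) by left; left; split.
have := disc_crossing dA xp xA; case: p xp => z w xp [[h|[/= -> h]]|[/= -> h]] // _.
  by exists false, w.
by exists true, w.
Qed.

(** Distinct diameters meet only in the centre, as their directions are
    independent. *)
Lemma chord_chord i u j w : as_ i < u < bs i -> as_ j < w < bs j ->
  at_ ((ys i, u) : point D) = at_ ((ys j, w) : point D) ->
  i = j /\ u = w \/ j = ~~ i /\ u = mid i /\ w = mid j.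
Proof.
move=> hu hw; have /andP[/ltW u1 /ltW u2] := hu; have /andP[/ltW w1 /ltW w2] := hw.
have [ij|ij] := eqVneq j i.
  subst j => e; left; split => //.
  by apply: (chord_inj (hch i) _ _ e); rewrite ?u1 ?w1.
have jE : j = ~~ i by case: (i) (j) ij => -[].
have [_ _ hi] := hch i; have [_ _ hj] := hch j.
rewrite hi ?u1 // hj ?w1 // -/(mid i) -/(mid j) => /addrI e; right; split => //.
have tr : det2 (vs i) (vs j) != 0.
  rewrite jE; case: (i) => //=; by rewrite det2C oppr_eq0.
have e0 := congr1 (fun v : plane R => v 0 0) e; have e1 := congr1 (fun v : plane R => v 0 1) e.
rewrite !mxE in e0 e1.
have z1 : (u - mid i) * det2 (vs i) (vs j) = 0.
  rewrite /det2 mulrBr !mulrA e0 e1; ring.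
have z2 : (w - mid j) * det2 (vs i) (vs j) = 0.
  have -> : (w - mid j) * det2 (vs i) (vs j) =
    vs i 0 0 * ((w - mid j) * vs j 0 1) - vs i 0 1 * ((w - mid j) * vs j 0 0) by rewrite /det2; ring.
  by rewrite -e0 -e1; ring.
move/eqP: z1 z2; rewrite mulf_eq0 (negbTE tr) orbF subr_eq0 => /eqP -> /eqP.
by rewrite mulf_eq0 (negbTE tr) orbF subr_eq0 => /eqP ->.
Qed.

Let h i := height (vs i) c0 x.
Let S i := germ_right (h i) a.
Let d := 0 < det2 (vs true) (vs false).

Lemma chord_crossing i t u : a < t < b -> as_ i < u < bs i ->
  at_ ((x, t) : point D) = at_ ((ys i, u) : point D) ->
  crossing ((x, t) : point D) (ys i, u).
Proof.
move=> ht hu e; split; [exact: dom_arc|exact: dom_chord| |exact: e].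
by move=> xy; apply: (@ch_off_arc i (ys i, u)) => //; rewrite -xy; split.
Qed.

(** At a crossing with one line, the derivative of the height above it gives the
    sign of the crossing, and the height above the other line tells on which half
    of the first line the crossing lies. *)
Lemma side_at i t w : a < t < b -> as_ i < w < bs i ->
  crossing ((x, t) : point D) (ys i, w) ->
  [/\ h i t = 0, derive1 (h i) t != 0,
      (0 < det2 (velocity ((x, t) : point D)) (velocity ((ys i, w) : point D))) =
        ~~ (0 < derive1 (h i) t)
    & h (~~ i) t != 0 -> w != mid i /\
        (w < mid i) = ((0 < h (~~ i) t) != d (+) i)].
Proof.
move=> ht hw xw; have /andP[/ltW w1 /ltW w2] := hw.
have [_ _ hat] := hch i; have [_ _ _ xy] := xw.
have vE := chord_velocity (hch i) (t := w); rewrite w1 w2 in vE; have {}vE := vE isT.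
have dE := (height_derive (vs i) c0 x t).2.
have nz : det2 (vs i) (velocity ((x, t) : point D)) != 0.
  by have := diag_transverse (diagP D) xw; rewrite vE det2C oppr_eq0.
have atE : curve_path x t = c0 + (w - mid i) *: vs i.
  by rewrite -[LHS]/(at_ ((x, t) : point D)) xy hat ?w1.
split.
- by rewrite /h /height atE addrC addKr /det2 !mxE; ring.
- by rewrite dE.
- by rewrite vE det2_swap_pos // dE.
have hE : h (~~ i) t = (w - mid i) * det2 (vs (~~ i)) (vs i).
  by rewrite /h /height atE addrC addKr /det2 !mxE; ring.
have dd : (0 < det2 (vs (~~ i)) (vs i)) = d (+) i.
  case: (i) => /=; last by rewrite addbF.
  by rewrite addbT det2_swap_pos.
have trn : det2 (vs (~~ i)) (vs i) != 0.
  case: (i) => //=; by rewrite det2C oppr_eq0.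
rewrite hE => pn; have wn : w - mid i != 0 by apply: contraNneq pn => ->; rewrite mul0r.
split; first by rewrite -subr_eq0.
rewrite -dd -subr_lt0; have [q|q|q] := ltgtP (w - mid i) 0; last by rewrite q eqxx in wn.
  rewrite nmulr_rgt0 //; case: ltgtP trn => //= _ ; by rewrite ?eqxx.
by rewrite pmulr_rgt0 //; case: (0 < _).
Qed.

(** Signs and positions of the two crossings are determined by the sides on which
    the arc starts and the lines which it crosses. *)
Lemma arc_states : exists i1 i2 w1 w2,
  [/\ p1 = (ys i1, w1) /\ as_ i1 < w1 < bs i1, p2 = (ys i2, w2) /\ as_ i2 < w2 < bs i2,
      positive (x, t1) p1 = S i1 /\ positive (x, t2) p2 = flip i1 S i2,
      (w1 != mid i1 /\ (w1 < mid i1) = (S (~~ i1) != d (+) i1)) /\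
      (w2 != mid i2 /\ (w2 < mid i2) = (flip i1 S (~~ i2) != d (+) i2))
    & forall i, germ_left (h i) b = flip i2 (flip i1 S) i].
Proof.
have [/andP[at1 t12] [t2b crE]] := cr.
have ht1 := time_in (or_introl erefl); have ht2 := time_in (or_intror erefl).
have c1 : crossing ((x, t1) : point D) p1 by apply/(crE _ _ ht1); left.
have c2 : crossing ((x, t2) : point D) p2 by apply/(crE _ _ ht2); right.
have [i1 [w1 [e1 hw1]]] := on_chord c1 ht1; have [i2 [w2 [e2 hw2]]] := on_chord c2 ht2.
have [Aa Ab Ac Ad] := ends_off.
rewrite e1 in c1; rewrite e2 in c2.
have [z1 d1 s1 k1] := side_at ht1 hw1 c1; have [z2 d2 s2 k2] := side_at ht2 hw2 c2.
have out i : ~ disc c0 r (at_ ((ys i, bs i) : point D)).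
  have [/andP[q1 q2] q3 _] := hch i.
  move=> /(dA.2 (ys i, bs i)) k; apply: (Ad i); apply: k.
  by rewrite /dom /=; case: (ys i) => _; rewrite ?(ltW q3) ?q3 ltW ?(lt_trans q1).
have zeros i t : a < t < b -> h i t = 0 -> t = t1 /\ i = i1 \/ t = t2 /\ i = i2.
  move=> ht h0.
  have inn : disc c0 r (at_ ((x, t) : point D)).
    by apply/(dA.2 (x, t)); [exact: dom_arc|left; left; split].
  have [u hu e] := chord_cover (hch i) (out i) inn h0.
  have := chord_crossing ht hu e => /(crE _ _ ht)[[-> pE]|[-> pE]]; [left|right]; split => //.
    by apply: (@ch_unique _ _ (ys i, u)); [split|rewrite pE e1; split].
  by apply: (@ch_unique _ _ (ys i, u)); [split|rewrite pE e2; split].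
have nd e : e = a \/ e = b -> ~ A (x, e) -> forall i, h i e = 0 -> derive1 (h i) e != 0.
  move=> he Ae i h0; rewrite (height_derive (vs i) c0 x e).2.
  have Ax : open_arc x a b `<=` A by move=> p hp; left; left.
  have Ay : open_arc (ys i) (as_ i) (bs i) `<=` A by move=> p hp; exact: (@inA i).
  exact: (boundary_transverse (hch i) a0 ab b1 dA Ax Ay Ae (Ad i) (disj i) he h0).
have der i u : derivable (h i : R^o -> R^o) u 1 := (height_derive (vs i) c0 x u).1.
have [r1 r2 [n1 q1] [n2 q2] r5] := two_crossing_states der at1 t12 t2b
  (nd a (or_introl erefl) Aa) (nd b (or_intror erefl) Ab) zeros z1 z2 d1 d2.
have [k1a k1b] := k1 n1; have [k2a k2b] := k2 n2.
exists i1, i2, w1, w2; split => //.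
- by split; rewrite ?e1 ?e2 /positive ?s1 ?s2 ?r1 ?r2 negbK.
- by split; split => //; rewrite ?k1b ?k2b ?q1 ?q2.
Qed.

Variables (i1 i2 : bool) (w1 w2 : R).
Hypotheses (e1 : p1 = (ys i1, w1)) (e2 : p2 = (ys i2, w2)).
Hypotheses (hw1 : as_ i1 < w1 < bs i1) (hw2 : as_ i2 < w2 < bs i2).
Hypotheses (nw1 : w1 != mid i1) (nw2 : w2 != mid i2).

Lemma arc_not_under t : a < t < b -> ~ under ((x, t) : point D).
Proof.
have [_ [_ crE]] := cr; move=> ht [q qt].
have [[te qe]|[te qe]] := iffLR (crE _ _ ht) (crossing_sym (over_crossing qt)); subst t q.
  exact: (diag_over_asym (diagP D) ov1).
exact: (diag_over_asym (diagP D) ov2).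
Qed.

Lemma over_chord i u q : as_ i < u < bs i -> over q (ys i, u) ->
  [\/ [/\ q = (x, t1), i1 = i & w1 = u], [/\ q = (x, t2), i2 = i & w2 = u]
     | u = mid i /\ q = (ys (~~ i), mid (~~ i))].
Proof.
move=> hu qu; have uq := crossing_sym (over_crossing qu).
have hA : A (ys i, u) by exact: (@inA i).
have chq j w : q = (ys j, w) -> as_ j < w < bs j -> u = mid i /\ q = (ys (~~ i), mid (~~ i)).
  move=> qE hw; have [_ _ ne e] := uq; rewrite qE in ne e.
  have [[ij uw]|[jE [uE wE]]] := chord_chord hu hw e; first by case: ne; rewrite ij uw.
  by rewrite qE jE wE jE.
have := disc_crossing dA uq hA; case: q qu uq chq => z w qu uq chq [[[/= zx hw]|[/= zE hw]]|[/= zE hw]].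
- subst z; have [_ [_ crE]] := cr.
  have [[we ye]|[we ye]] := iffLR (crE _ _ hw) (crossing_sym uq).
    have ii : i1 = i by apply: (@ch_unique _ _ (ys i, u)); [rewrite ye e1; split|split].
    by apply: Or31; rewrite we; split => //; move: ye; rewrite e1 => -[].
  have ii : i2 = i by apply: (@ch_unique _ _ (ys i, u)); [rewrite ye e2; split|split].
  by apply: Or32; rewrite we; split => //; move: ye; rewrite e2 => -[].
- by subst z; apply: Or33; exact: (chq false w).
- by subst z; apply: Or33; exact: (chq true w).
Qed.

Lemma crossings_distinct : ~ (i1 = i2 /\ w1 = w2).
Proof.
have [/andP[_ t12] [_ crE]] := cr; case=> ii ww.
have ht1 := time_in (or_introl erefl); have ht2 := time_in (or_intror erefl).
have c1 : crossing ((x, t1) : point D) p1 by apply/(crE _ _ ht1); left.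
have c2 : crossing ((x, t2) : point D) p2 by apply/(crE _ _ ht2); right.
rewrite e1 ii ww -e2 in c1.
have [te] := diag_double (diagP D) (crossing_sym c1) (crossing_sym c2).
by rewrite te ltxx in t12.
Qed.

Variables (N : groupType) (c : point D -> N) (z : N).
Hypothesis cz : forall t, a < t < b -> c (x, t) = z.

Definition crossings_at (f1 f2 : int) (i : bool) (u : R) : int :=
  f1 * ((i1 == i) && (w1 == u))%:R + f2 * ((i2 == i) && (w2 == u))%:R.

Lemma chord_jump i u : as_ i < u < bs i -> u != mid i ->
  jump c (ys i, u) = gpow z (crossings_at (esgn (positive (x, t1) p1))
    (esgn (positive (x, t2) p2)) i u).
Proof.
move=> hu um; rewrite /crossings_at.
have z1 := cz (time_in (or_introl erefl)); have z2 := cz (time_in (or_intror erefl)).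
have [/andP[/eqP ii /eqP ww]|n1] := boolP ((i1 == i) && (w1 == u)).
  rewrite -ii -ww in hu um *; rewrite -e1 (jump_over c ov1) z1.
  have /negPf -> : ~~ ((i2 == i1) && (w2 == w1)).
    by apply/negP => /andP[/eqP k1 /eqP k2]; apply: crossings_distinct.
  by rewrite first_crossing gpow_esgn.
have [/andP[/eqP ii /eqP ww]|n2] := boolP ((i2 == i) && (w2 == u)).
  rewrite -ii -ww in hu um *; rewrite -e2 (jump_over c ov2) z2.
  by rewrite second_crossing gpow_esgn.
rewrite no_crossings jump1 // => -[q /(over_chord hu)[[_ k1 k2]|[_ k1 k2]|[k _]]].
- by rewrite k1 k2 !eqxx in n1.
- by rewrite k1 k2 !eqxx in n2.
- by rewrite k eqxx in um.
Qed.

Lemma mid_over i q : over q (ys i, mid i) -> q = (ys (~~ i), mid (~~ i)).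
Proof.
move=> /(over_chord (mid_in i))[[_ k1 k2]|[_ k1 k2]|[//]].
  by move: nw1; rewrite k2 k1 eqxx.
by move: nw2; rewrite k2 k1 eqxx.
Qed.

End ArcOverChords.

Lemma sum_increments (f1 f2 g1 g2 x1 x2 y1 y2 u1 u2 v1 v2 : int) :
  f1 * (x1 + y1) + f2 * (x2 + y2) - (g1 * (u1 + v1) + g2 * (u2 + v2)) =
  f1 * x1 + f2 * x2 - (g1 * u1 + g2 * u2) + (f1 * y1 + f2 * y2 - (g1 * v1 + g2 * v2)).
Proof. by ring. Qed.

Lemma add_zero_diff (k : int) : k + (0 - 0) = k.
Proof. by rewrite subrr addr0. Qed.

Lemma cancel_increment (k l n : int) : l + (n + (k - l)) = n + k.
Proof. by ring. Qed.

Section OverpassTransfers.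
Variables (R : realType) (m : nat) (D D' : diagram R m) (s : loop D -> loop D').
Let mu := point_map s.

(** The arc is pushed across the common point of two diameters.  The colour of a
    point of a diameter is conjugated by the colour of the arc to the power given
    by the number of times the point is passed over, counted with signs, when the
    old arc is replaced by the new one.  This number is zero at the ends of the
    diameters, and it is the same for both diameters at their common point. *)
Lemma over_arc_transfers x a b (ys : bool -> curve D) (as_ bs : bool -> R) c0
    (vs : bool -> plane R) r t1 t2 p1 p2 t1' t2' p1' p2' :
  replace_arc s x a b ->
  (forall i, chord (ys i) (as_ i) (bs i) c0 (vs i)) ->
  disc_meets c0 r (open_arc x a b `|` open_arc (ys false) (as_ false) (bs false)
    `|` open_arc (ys true) (as_ true) (bs true)) ->
  disc_meets c0 r (open_arc (curve_map s x) a b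
    `|` open_arc (curve_map s (ys false)) (as_ false) (bs false)
    `|` open_arc (curve_map s (ys true)) (as_ true) (bs true)) ->
  (forall i, open_arc x a b `&` open_arc (ys i) (as_ i) (bs i) = set0) ->
  open_arc (ys false) (as_ false) (bs false) `&` open_arc (ys true) (as_ true) (bs true) = set0 ->
  det2 (vs true) (vs false) != 0 ->
  two_crossings x a b t1 t2 p1 p2 -> over (x, t1) p1 -> over (x, t2) p2 ->
  two_crossings (curve_map s x) a b t1' t2' p1' p2' ->
  over (curve_map s x, t1') p1' -> over (curve_map s x, t2') p2' ->
  transfers s.
Proof.
move=> ra hch dA dA' disj disj2 trc cr ov1 ov2 cr' ov1' ov2' N c hc.
have [ss [/andP[a0 ab] b1] sat so] := ra.
set A := _ `|` _ in dA; set A' := _ `|` _ in dA'.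
pose mid i := (as_ i + bs i) / 2.
have cmI := bij_inj (curve_map_bij ss).
pose x' := curve_map s x; pose ys' i := curve_map s (ys i).
have AA p : A' (mu p) <-> A p.
  split=> [[[|]|]|[[|]|]] /(open_arc_map ss) h;
    by [left; left|left; right|right].
have much i p : open_arc (ys' i) (as_ i) (bs i) (mu p) <-> open_arc (ys i) (as_ i) (bs i) p.
  exact: open_arc_map.
have set0P (T : Type) (P Q : set T) : (forall u, P u -> Q u -> False) -> P `&` Q = set0.
  by move=> h; apply/seteqP; split=> u //= [/h].
have mu_surj : forall q, exists p, q = mu p.
  by have [g gK Kg] := point_map_bij ss; move=> q; exists (g q); rewrite /mu Kg.
have disj' i : open_arc x' a b `&` open_arc (ys' i) (as_ i) (bs i) = set0.
  apply: set0P => q; have [p ->] := mu_surj q => /(open_arc_map ss) h1 /much h2.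
  by suff : (open_arc x a b `&` open_arc (ys i) (as_ i) (bs i)) p by rewrite disj.
have disj2' : open_arc (ys' false) (as_ false) (bs false) `&`
    open_arc (ys' true) (as_ true) (bs true) = set0.
  apply: set0P => q; have [p ->] := mu_surj q => /much h1 /much h2.
  by suff : (open_arc (ys false) (as_ false) (bs false) `&`
    open_arc (ys true) (as_ true) (bs true)) p by rewrite disj2.
have [Aa Ab Ac Ad] := ends_off ab hch disj disj2.
have offA p : ~ A p -> ~ open_arc x a b p by move=> h h'; apply: h; left; left.
have domI i u : as_ i <= u <= bs i -> dom ((ys i, u) : point D).
  have [/andP[q1 q2] q3 _] := hch i => /andP[k1 k2].
  rewrite /dom /=; have k3 := lt_le_trans q1 k1; have k4 := le_lt_trans k2 q3.
  by case: (ys i) => _; rewrite ?(ltW k3) ?k4 ?(ltW k4).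
have off_chord i u : as_ i <= u <= bs i -> ~ open_arc x a b (ys i, u).
  rewrite !le_eqVlt => /andP[/orP[/eqP <- _|q1]]; first exact: offA (Ac i).
  move=> /orP[/eqP -> |q2]; first exact: offA (Ad i).
  by apply: (ch_off_arc disj (i := i)); split => //=; rewrite q1.
have hch' i : chord (ys' i) (as_ i) (bs i) c0 (vs i).
  have [h1 h2 h3] := hch i; split => // u hu.
  by rewrite -h3 //; apply: (sat (ys i, u) (domI i u hu)); exact: off_chord.
have [i1 [i2 [w1 [w2 [[e1 hw1] [e2 hw2] [s1 s2] [[nw1 k1] [nw2 k2]] endS]]]]] :=
  arc_states a0 ab b1 hch dA disj disj2 cr ov1 ov2 trc.
have [j1 [j2 [w1' [w2' [[e1' hw1'] [e2' hw2'] [s1' s2'] [[nw1' k1'] [nw2' k2']] endS']]]]] :=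
  arc_states a0 ab b1 hch' dA' disj' disj2' cr' ov1' ov2' trc.
pose S i := germ_right (height (vs i) c0 x) a.
pose d := 0 < det2 (vs true) (vs false).
have dom_x t : 0 < t < 1 -> dom ((x, t) : point D).
  by move=> /andP[q1 q2]; rewrite /dom /=; case: (x) => _; rewrite ?(ltW q1) ?q2 ?(ltW q2).
have germE t i : 0 < t < 1 -> ~ A (x, t) -> height (vs i) c0 x' t = height (vs i) c0 x t /\
    derive1 (height (vs i) c0 x') t = derive1 (height (vs i) c0 x) t.
  move=> ht At; rewrite !(height_derive _ _ _ _).2; split.
    by congr (det2 _ (_ - _)); exact: (sat (x, t) (dom_x _ ht) (offA _ At)).
  by congr det2; exact: (replace_arc_velocity ra (dom_x _ ht) (offA _ At)).
have SE : (fun i => germ_right (height (vs i) c0 x') a) = S.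
  apply/funext => i; have [|h1 h2] := germE a i _ Aa; first by rewrite a0 (lt_trans ab).
  by rewrite /S /germ_right h1 h2.
have EE i : germ_left (height (vs i) c0 x') b = germ_left (height (vs i) c0 x) b.
  have [|h1 h2] := germE b i _ Ab; first by rewrite b1 (lt_trans a0).
  by rewrite /germ_left h1 h2.
have SE1 i : germ_right (height (vs i) c0 x') a = S i by rewrite -SE.
have {}k1 : (w1 < mid i1) = (S (~~ i1) != d (+) i1) by exact: k1.
have {}k2 : (w2 < mid i2) = (flip i1 S (~~ i2) != d (+) i2) by exact: k2.
rewrite SE in k2' s2' endS'.
have {}s1' : positive ((x', t1') : point D') p1' = S j1 by rewrite -SE1.
have {}k1' : (w1' < mid j1) = (S (~~ j1) != d (+) j1) by rewrite -SE1; exact: k1'.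
have {}k2' : (w2' < mid j2) = (flip j1 S (~~ j2) != d (+) j2) by exact: k2'.
have {}endS' i : flip i2 (flip i1 S) i = flip j2 (flip j1 S) i.
  by rewrite -[LHS]endS -[RHS]endS' EE.
have [tot bef] := crossing_balance d endS'.
pose z := c (x, b).
have arc_no := arc_not_under cr ov1 ov2.
have cx t : a < t -> t <= b -> c (x, t) = (c (x, a) ^ jump c (x, a))%g.
  move=> at_ tb; apply: (coloring_step hc (ltW a0) at_ (le_trans tb (ltW b1))) => u /andP[q1 q2].
  by apply: arc_no; rewrite q1 (lt_le_trans q2).
have zE : z = (c (x, a) ^ jump c (x, a))%g by exact: cx.
have cz t : a < t < b -> c (x, t) = z by move=> /andP[q1 q2]; rewrite zE cx // ltW.
pose f1 := esgn (positive ((x, t1) : point D) p1).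
pose f2 := esgn (positive ((x, t2) : point D) p2).
pose f1' := esgn (positive ((x', t1') : point D') p1').
pose f2' := esgn (positive ((x', t2') : point D') p2').
pose before (f1 f2 : int) (i1 i2 : bool) (w1 w2 : R) i (u : R) : int :=
  f1 * ((i1 == i) && (w1 < u))%:R + f2 * ((i2 == i) && (w2 < u))%:R.
pose nu i u := before f1' f2' j1 j2 w1' w2' i u - before f1 f2 i1 i2 w1 w2 i u.
have nu_as i : nu i (as_ i) = 0.
  have lt0 k w : as_ k < w < bs k -> ((k == i) && (w < as_ i)) = false.
    by case: eqP => [<-|//] /andP[/ltW]; rewrite leNgt => /negbTE ->.
  rewrite /nu /before (lt0 _ _ hw1) (lt0 _ _ hw2) (lt0 _ _ hw1') (lt0 _ _ hw2').
  by rewrite !no_crossings; exact: (add_zero_diff 0).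
have nu_bs i : nu i (bs i) = 0.
  have lt0 k w : as_ k < w < bs k -> ((k == i) && (w < bs i)) = (k == i).
    by case: eqP => [<-|//] /andP[_ ->].
  apply/eqP; rewrite /nu /before !lt0 // subr_eq0 /f1 /f2 /f1' /f2' s1 s2 s1' s2'.
  by apply/eqP/esym; exact: tot.
have nu_mid : nu false (mid false) = nu true (mid true).
  have lt0 k w i : ((k == i) && (w < mid i)) = ((k == i) && (w < mid k)) by case: eqP => [->|].
  move: bef; rewrite /crossings_before /nu /before /f1 /f2 /f1' /f2' s1 s2 s1' s2'.
  by rewrite -k1 -k2 -k1' -k2' -!lt0.
pose K := gpow z (nu false (mid false)).
have KE i : gpow z (nu i (mid i)) = K by case: i; rewrite /K ?nu_mid.
pose F p := if `[< open_arc x a b p >] then z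
  else if `[< open_arc (ys false) (as_ false) (bs false) p >]
       then (c p ^ gpow z (nu false p.2))%g
  else if `[< open_arc (ys true) (as_ true) (bs true) p >]
       then (c p ^ gpow z (nu true p.2))%g else c p.
pose gi i u := if u == mid i then (jump c (ys i, mid i) ^ K)%g
  else gpow z (crossings_at j1 j2 w1' w2' f1' f2' i u).
pose G p := if `[< open_arc x a b p >] then 1%g
  else if `[< open_arc (ys false) (as_ false) (bs false) p >] then gi false p.2
  else if `[< open_arc (ys true) (as_ true) (bs true) p >] then gi true p.2 else jump c p.
have Foff p : ~ A p -> F p = c p.
  by move=> Ap; rewrite /F !asboolF // => h; apply: Ap; [right|left; right|left; left].
have Goff p : ~ A p -> G p = jump c p.
  by move=> Ap; rewrite /G !asboolF // => h; apply: Ap; [right|left; right|left; left].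
have Farc t : a < t < b -> F (x, t) = z by move=> ht; rewrite /F asboolT.
have Garc t : a < t < b -> G (x, t) = 1%g by move=> ht; rewrite /G asboolT.
have Fch i u : as_ i < u < bs i -> F (ys i, u) = (c (ys i, u) ^ gpow z (nu i u))%g.
  move=> hu; have hi : open_arc (ys i) (as_ i) (bs i) (ys i, u) by split.
  rewrite /F asboolF; last by move=> h; exact: (ch_off_arc disj hi h).
  case: i hu hi => hu hi; last by rewrite asboolT.
  rewrite asboolF ?asboolT // => h.
  by have := @ch_unique _ _ _ _ _ _ disj2 false true _ h hi.
have Gch i u : as_ i < u < bs i -> G (ys i, u) = gi i u.
  move=> hu; have hi : open_arc (ys i) (as_ i) (bs i) (ys i, u) by split.
  rewrite /G asboolF; last by move=> h; exact: (ch_off_arc disj hi h).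
  case: i hu hi => hu hi; last by rewrite asboolT.
  rewrite asboolF ?asboolT // => h.
  by have := @ch_unique _ _ _ _ _ _ disj2 false true _ h hi.
pose l := [:: (x, a, b); (ys false, as_ false, bs false); (ys true, as_ true, bs true)].
have AE : arcs l = A by rewrite /l arcs_cons arcs_cons arcs1 setUA.
have gpow0 : gpow z 0 = 1%g by [].
have jumpG (c' : point D' -> N) p : (forall q, c' (mu q) = F q) -> A p ->
    jump c' (mu p) = G p.
  move=> c'F; have c'x t : a < t < b -> c' (x', t) = z.
    by move=> ht; rewrite -[(x', t)]/(mu (x, t)) c'F Farc.
  have chordG i u : as_ i < u < bs i -> jump c' (mu (ys i, u)) = G (ys i, u).
    move=> hu; rewrite (Gch i u hu) /gi.
    have [uE|um] := eqVneq u (mid i); last first.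
      exact: (chord_jump hch' dA' disj2' cr' ov1' ov2' trc e1' e2' hw1' hw2' c'x hu um).
    subst u; have midI j : as_ j <= mid j <= bs j.
      by have /andP[/ltW -> /ltW ->] := mid_in hch j.
    have overE j : over (mu (ys j, mid j)) (mu (ys (~~ j), mid (~~ j))) <->
        over (ys j, mid j) (ys (~~ j), mid (~~ j)).
      by apply: so; [exact: domI|exact: domI|exact: off_chord|exact: off_chord].
    have [[q qp]|n] := pselect (under ((ys i, mid i) : point D)).
      have qE := mid_over hch dA disj2 cr trc e1 e2 hw1 hw2 nw1 nw2 qp.
      rewrite -/(mid _) in qE; have qp' := qp; rewrite qE in qp'.
      have := (overE (~~ i)).2; rewrite negbK => /(_ qp') mqp.
      rewrite (jump_over _ mqp) (jump_over _ qp') c'F (Fch (~~ i) (mid (~~ i)) (mid_in hch _)) KE.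
      have -> : positive (mu (ys (~~ i), mid (~~ i))) (mu (ys i, mid i)) =
          positive ((ys (~~ i), mid (~~ i)) : point D) (ys i, mid i).
        have vel j : velocity (mu (ys j, mid j)) = velocity ((ys j, mid j) : point D).
          by apply: (replace_arc_velocity ra); [exact: domI|exact: off_chord].
        by rewrite /positive !vel.
      by case: positive; rewrite ?conjVg.
    rewrite (jump1 _ n) conj1g; apply: jump1 => -[q qp]; apply: n.
    have qE := mid_over hch' dA' disj2' cr' trc e1' e2' hw1' hw2' nw1' nw2' qp.
    rewrite qE in qp; exists (ys (~~ i), mid (~~ i)).
    by have := (overE (~~ i)).1; rewrite negbK; apply.
  case: p => y u [[[/= -> hu]|[/= -> hu]]|[/= -> hu]]; [|exact: chordG|exact: chordG].
  by rewrite Garc //; apply: jump1; exact: (arc_not_under cr' ov1' ov2').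
have chord_tr i : transport (fun u => G (ys i, u)) (as_ i) (bs i) (fun u => F (ys i, u)).
  have [/andP[q1 q2] q3 _] := hch i.
  pose f0 u := (c (ys i, u) ^ gpow z (nu i u))%g.
  pose g0 u := if as_ i < u < bs i then gi i u else
    if u == as_ i then jump c (ys i, as_ i) else 1%g.
  pose T := [:: as_ i; mid i; w1; w2; w1'; w2'].
  have g0E u : as_ i <= u < bs i -> g0 u = G (ys i, u).
    rewrite /g0 le_eqVlt => /andP[/orP[/eqP <- _|k3 k4]].
      by rewrite ltxx eqxx Goff //; exact: Ac.
    by rewrite k3 k4 Gch // k3.
  have f0E u : as_ i <= u <= bs i -> f0 u = F (ys i, u).
    rewrite /f0 le_eqVlt => /andP[/orP[/eqP <- _|k3]].
      by rewrite nu_as gpow0 conjg1 Foff //; exact: Ac.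
    rewrite le_eqVlt => /orP[/eqP ->|k4]; last by rewrite Fch // k3.
    by rewrite nu_bs gpow0 conjg1 Foff //; exact: Ad.
  apply: (transport_eq g0E f0E); apply: (@transport_steps _ _ _ _ T) => [u|u t k3 k4 k5 noT].
    rewrite /g0 /T !inE; case: ifP => _; last by case: eqP.
    rewrite /gi; have [_ //|um] := eqVneq u (mid i); first by rewrite orbT.
    move=> gu; apply: contrapT => /negP; rewrite !negb_or => /and5P[_ _ _ _ /andP[n1 n2]].
    apply: gu; rewrite /crossings_at [w1' == u]eq_sym (negbTE n1) [w2' == u]eq_sym (negbTE n2).
    by rewrite !andbF no_crossings.
  have inT k : k \in T -> u < k < t -> False by exact: noT.
  have ct : c (ys i, t) = (c (ys i, u) ^ jump c (ys i, u))%g.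
    apply: (coloring_step hc _ k4).
    - exact: ltW (lt_le_trans q1 k3).
    - exact: ltW (le_lt_trans k5 q3).
    - move=> k /andP[h1 h2] [q qk]; have hk : as_ i < k < bs i.
        by rewrite (le_lt_trans k3 h1) (lt_le_trans h2 k5).
      have := over_chord hch dA disj2 cr trc e1 e2 hw1 hw2 hk qk.
      have kT : k \in T -> False by move=> /inT; apply; rewrite h1.
      case=> [[_ _ kE]|[_ _ kE]|[kE _]]; apply: kT.
      + by rewrite -kE !inE eqxx ?orbT.
      + by rewrite -kE !inE eqxx ?orbT.
      + by rewrite kE !inE eqxx ?orbT.
  have step k w : w \in T -> ((k == i) && (w < t))%:R =
      ((k == i) && (w < u))%:R + ((k == i) && (w == u))%:R :> int.
    move=> /inT h; case: (k == i) => //=.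
    have [wu|uw|->] := ltgtP w u; first by rewrite (lt_trans wu k4).
      by case: ltP => // wt; case: h; rewrite uw.
    by rewrite k4.
  have nut : nu i t = nu i u + (crossings_at j1 j2 w1' w2' f1' f2' i u -
      crossings_at i1 i2 w1 w2 f1 f2 i u).
    have [T1 T2 T3 T4] : [/\ w1 \in T, w2 \in T, w1' \in T & w2' \in T].
      by rewrite /T !inE !eqxx !orbT.
    rewrite /nu /before /crossings_at (step _ _ T1) (step _ _ T2) (step _ _ T3) (step _ _ T4).
    exact: sum_increments.
  rewrite /f0 /g0; move: k3; rewrite le_eqVlt => /orP[/eqP uE|k3].
    rewrite -uE ltxx eqxx /= nu_as gpow0 conjg1.
    have z0 k w : as_ k < w < bs k -> ((k == i) && (w == as_ i)) = false.
      by case: eqP => [<-|//] /andP[/gt_eqF ->].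
    have -> : nu i t = 0.
      rewrite nut -uE nu_as /crossings_at (z0 _ _ hw1) (z0 _ _ hw2) (z0 _ _ hw1') (z0 _ _ hw2').
      by rewrite !no_crossings; exact: add_zero_diff.
    by rewrite gpow0 conjg1 ct -uE.
  have hu : as_ i < u < bs i by rewrite k3 (lt_le_trans k4 k5).
  rewrite hu /gi ct; have [uE|um] := eqVneq u (mid i).
    have nm k w : w != mid k -> ((k == i) && (w == u)) = false.
      by move=> h; have [ki|//] := eqVneq k i; rewrite uE -ki (negbTE h).
    have no_crossing g1 g2 l1 l2 v1 v2 : v1 != mid l1 -> v2 != mid l2 ->
        crossings_at l1 l2 v1 v2 g1 g2 i u = 0.
      by move=> n1 n2; rewrite /crossings_at (nm _ _ n1) (nm _ _ n2) no_crossings.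
    have -> : nu i t = nu i (mid i).
      rewrite nut (no_crossing f1' f2' _ _ _ _ nw1' nw2') (no_crossing f1 f2 _ _ _ _ nw1 nw2) uE.
      exact: add_zero_diff.
    by rewrite uE KE conjJg.
  rewrite (chord_jump hch dA disj2 cr ov1 ov2 trc e1 e2 hw1 hw2 cz hu um).
  rewrite -!conjgM -!gpowD nut; congr (_ ^ gpow _ _)%g.
  exact: cancel_increment.
apply: (disc_coloring (l := l) ra (mem_head _ _) _ dA' _ hc (F := F) (G := G)); rewrite AE //.
move=> y a' b'; rewrite !inE => /or3P[]/eqP[-> -> ->].
- split => //; first by rewrite a0.
  apply: (flat_arc (z := z)) => [u hu|u /andP[au ub]|]; first exact: Garc.
    have [->|ub'] := eqVneq u b; first by rewrite Foff.
    by rewrite Farc // au lt_neqAle ub'.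
  by rewrite Foff // Goff.
- have [q1 q2 _] := hch false; split => //; exact: chord_tr.
- have [q1 q2 _] := hch true; split => //; exact: chord_tr.
Qed.

End OverpassTransfers.

Section Overpass.
Variables (R : realType) (m : nat) (D D' : diagram R m) (s : loop D -> loop D').

Lemma overpass_transfers kind : (forall p q : point D, kind p q -> crossing p q) ->
  overpass s kind -> same_loops s /\ transfers s.
Proof.
move=> kc [x [a [b [y1 [a1 [b1 [y2 [a2 [b2 [c0 [r [t1 [t2 [t1' [t2' [u1 [u2 [u1' [u2']]]]]]]]]]]]]]]]]]].
move=> [[ra /diameter_chord[v1 ch1] /diameter_chord[v2 ch2]]].
move=> [[d1 d2 d12] [dA dA']] /kc k [cr [ov1 ov2]] [cr' [ov2' ov1']].
split; first by case: ra.
pose pick (T : Type) (u v : T) (i : bool) := if i then v else u.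
apply: (@over_arc_transfers _ _ _ _ s x a b (pick _ y1 y2) (pick _ a1 a2) (pick _ b1 b2) c0
  (pick _ v1 v2) r t1 t2 (y1, u1) (y2, u2) t2' t1' (curve_map s y2, u2') (curve_map s y1, u1')) => //.
- by case.
- by case.
- have mid y a' b' v : chord y a' b' c0 v -> velocity ((y, (a' + b') / 2) : point D) = v.
    move=> h; apply: (chord_velocity h); have [/andP[_ h2] _ _] := h.
    by apply/andP; split; lra.
  have := diag_transverse (diagP D) k; rewrite (mid _ _ _ _ ch1) (mid _ _ _ _ ch2) /=.
  by rewrite det2C oppr_eq0.
Qed.

Lemma reidemeister3_transfers : reidemeister3 s -> same_loops s /\ transfers s.
Proof.
apply: overpass_transfers => p q [/over_crossing //|/over_crossing].
exact: crossing_sym.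
Qed.

Lemma forbidden_overpass_transfers : forbidden_overpass s -> same_loops s /\ transfers s.
Proof. by apply: overpass_transfers => p q []. Qed.

End Overpass.

(** * The moves as steps *)

Section MapFlow.
Variables (R : realType) (m : nat) (D D' : diagram R m) (s : loop D -> loop D').
Lemma card_loop_edges_map :
  #|loop_edges (fun (x : curve D) (x' : curve D') => x' = curve_map s x)| = #|loop D|.
Proof.
have inj : injective (fun l : loop D => ((inr l : curve D), (inr (s l) : curve D'))).
  by move=> l l' [].
rewrite -(card_codom inj); apply: eq_card => -[x x'].
apply/idP/codomP => [|[l [-> ->]]]; last first.
  by rewrite unfold_in /loop_edges /= andbT; apply/asboolP.
rewrite unfold_in /loop_edges /= => /andP[/asboolP ->].
by case: x => [i|l] //= _; exists l.
Qed.

Hypothesis s_inj : injective s.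
Variables (Z : zmodType) (h : loop D -> Z).

Definition map_flow (x : curve D) (x' : curve D') : Z :=
  if x is inr l then if x' == inr (s l) then h l else 0 else 0.

Lemma map_flow_off x x' : x' <> curve_map s x -> map_flow x x' = 0.
Proof. by case: x => [i|l] //= ne; case: eqP. Qed.

Lemma map_flow_out l : \sum_x' map_flow (inr l) x' = h l.
Proof.
rewrite (bigD1 (inr (s l))) //= eqxx big1 ?addr0 //.
by move=> x' /negbTE ->.
Qed.

Lemma map_flow_in l : \sum_x map_flow x (inr (s l)) = h l.
Proof.
rewrite (bigD1 (inr l)) //= eqxx big1 ?addr0 //.
move=> [i|k] //= ne; case: eqP => // -[] /s_inj e.
by rewrite e eqxx in ne.
Qed.

End MapFlow.

Section NeutralSteps.
Variables (R : realType) (m : nat) (D D' : diagram R m) (s : loop D -> loop D').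
Hypothesis s_same : same_loops s.

Definition no_band (E : diagram R m) (x : curve E) (t u : R) : Prop := False.

(** A move may change the base points of the loops: that of the image of [x] comes
    from the parameter [t x]. *)
Lemma neutral_step (t : curve D -> R) :
  (forall x, 0 <= t x <= 1) -> (forall i, t (inl i) = 0) ->
  (forall (N : groupType) (c : point D -> N) (h : loop D -> N), coloring c ->
     (forall l, central (h l)) -> (forall l, c (inr l, 1) = (c (inr l, 0) * h l)%g) ->
     exists2 c' : point D' -> N, coloring c' &
       [/\ forall x, c' (curve_map s x, 0) = c (x, t x),
           forall i, c' (inl i, 1) = c (inl i, 1)
         & forall l, c' (inr (s l), 1) = (c' (inr (s l), 0) * h l)%g]) ->
  step_spec (Neutral m) (fun x x' => x' = curve_map s x)
    (StepData (fun x _ => t x) (fun _ _ => 0) (@no_band D) (@no_band D')).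
Proof.
move=> t01 t0 tr; have cm_bij := curve_map_bij s_same; have cm_inj := bij_inj cm_bij.
have [[s' sK s'K] labE] := s_same.
have transfer n (N : groupType) (c : point D -> N) (c' : point D' -> N) :
    central_pair n (fun x x' => x' = curve_map s x)
      (StepData (fun x _ => t x) (fun _ _ => 0) (@no_band D) (@no_band D')) c c' ->
    exists (h : loop D -> center N) (zeta : curve D -> center N),
    [/\ forall l, c (inr l, 1) = (c (inr l, 0) * val (h l))%g,
        forall l, c' (inr (s l), 1) = (c' (inr (s l), 0) * val (h l))%g,
        forall x, c' (curve_map s x, 0) = (c (x, t x) * val (zeta x))%g
      & forall i, c' (inl i, 1) = (c (inl i, 1%R) * val (zeta (inl i)))%g].
  case=> hN hc hc' cl _ mt _ _.
  have /choice[h hh] l := ceq_center (cl l).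
  have /choice[zeta hz] x := ceq_center (mt x _ erefl).
  have [c1 hc1 [h1 h2 h3]] := tr N c (fun l => val (h l)) hc (fun l => centerP (h l)) hh.
  have [g gK Kg] := cm_bij.
  have hc2 := coloring_shift (fun x' => centerP (zeta (g x'))) hc1.
  have c2E p : 0 <= p.2 <= 1 -> (c1 p * val (zeta (g p.1)))%g = c' p.
    apply: (coloring_unique hN hc2 hc') => x' /=.
    by rewrite -(Kg x') gK h1 /= hz.
  exists h, zeta; split=> // [l|i].
    rewrite -!c2E ?lexx ?ler01 //= h3 -!mulgA; congr (_ * _)%g.
    exact: centerP.
  rewrite -c2E ?lexx ?ler01 //= h2; congr (_ * val (zeta _))%g.
  by rewrite -[inl i]/(curve_map s (inl i)) gK.
split=> //.
- by move=> x x' _; rewrite t01 lexx ler01.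
- by move=> i j [->]; rewrite /= t0.
- have cD : #|loop D'| = #|loop D| := esym (bij_eq_card (Bijective sK s'K)).
  rewrite card_loop_edges_map cD /euler_total big1 ?addr0 // => i _.
- move=> n N c c' /transfer[h [zeta [h1 h2 _ _]]].
  exists (map_flow s h); split; first exact: map_flow_off.
    by move=> l; rewrite h1 map_flow_out.
  by move=> l'; rewrite -(s'K l') h2 (@map_flow_in _ _ _ _ s (can_inj sK)).
- by move=> n N c c' _ _ _; split=> x t1 t2 [].
- move=> n N c c' /transfer[h [zeta [_ _ h3 h4]]] _ _ mt i.
  rewrite h4; have := mt (inl i) _ erefl => /=; rewrite (h3 (inl i)) => e.
  have -> : val (zeta (inl i)) = 1%g by apply: (mulgI (c (inl i, t (inl i)))); rewrite -e mulg1.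
  by rewrite mulg1.
Qed.

Lemma transfers_step : transfers s ->
  step_spec (Neutral m) (fun x x' => x' = curve_map s x)
    (StepData (fun _ _ => 0) (fun _ _ => 0) (@no_band D) (@no_band D')).
Proof.
move=> tr; apply: (neutral_step (t := fun=> 0)) => //; first by rewrite lexx ler01.
move=> N c h hc hz hl; have [c' hc' e] := tr N c hc; exists c' => //; split.
- by move=> x; exact: (e x).1.
- by move=> i; exact: (e (inl i)).2.
- by move=> l; have [e0 e1] := e (inr l); rewrite [LHS]e1 hl -e0.
Qed.

End NeutralSteps.

(** * Births and saddles *)

Section OneMoreLoop.
Variables (R : realType) (m : nat) (D D' : diagram R m) (s : loop D -> loop D').
Variable z : loop D'.
Hypothesis more : one_more_loop s z.

Lemma curve_map_inj : injective (curve_map s).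
Proof. by have [inj _ _] := more => -[i|l] [j|k] //= [] => [->|/inj ->]. Qed.

Lemma curve_map_not_new x : curve_map s x <> inr z.
Proof.
have [_ img _] := more; case: x => [//|l] [e].
by have := (img z).1 (ex_intro _ l e).
Qed.

Lemma curve_cases x' : (exists x, x' = curve_map s x) \/ x' = inr z.
Proof.
have [_ img _] := more; case: x' => [i|l']; first by left; exists (inl i).
have [->|ne] := eqVneq l' z; first by right.
by have [l <-] := (img l').2 (elimN eqP ne); left; exists (inr l).
Qed.

Lemma extend_to_loop (N : Type) (V : curve D -> R -> N) (Vz : R -> N) :
  exists c : point D' -> N,
    (forall x t, c (curve_map s x, t) = V x t) /\ (forall t, c (inr z, t) = Vz t).
Proof.
have /choice[f hf] : forall x', exists g : R -> N,
    (forall x, x' = curve_map s x -> g = V x) /\ (x' = inr z -> g = Vz).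
  move=> x'; have [[x ->]|->] := curve_cases x'.
    exists (V x); split=> [y /curve_map_inj -> //|e].
    by case: (curve_map_not_new e).
  by exists Vz; split=> // x /esym /curve_map_not_new.
exists (fun p => f p.1 p.2); split=> [x|] t /=.
  by rewrite ((hf (curve_map s x)).1 x erefl).
by rewrite ((hf (inr z)).2 erefl).
Qed.

Lemma card_one_more : #|loop D'| = #|loop D|.+1.
Proof.
have [inj img _] := more.
rewrite (cardD1 z) inE add1n; congr _.+1.
rewrite -(card_codom inj); apply: eq_card => l'; rewrite !inE andbT.
apply/idP/codomP => [/eqP/(img l').2[l <-]|[l ->]]; first by exists l.
by apply/eqP/(img _).1; exists l.
Qed.

Lemma dom_interval x t : dom ((x, t) : point D) ->
  exists lo hi, [/\ lo < hi, lo <= t <= hi & forall u, lo <= u <= hi -> dom ((x, u) : point D)].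
Proof.
move=> /[dup] dp /dom01 /= /andP[t0 t1].
have [t1'|t1'] := ltP t 1.
  exists t, ((t + 1) / 2); split=> [||u /andP[h1 h2]]; [lra|apply/andP; split; lra|].
  by rewrite /dom; case: (x) => _ /=; apply/andP; split; lra.
have tE : t = 1 by apply/eqP; rewrite eq_le t1 t1'.
exists 0, 1; rewrite ltr01 t0 t1; split=> // u hu.
move: dp; rewrite /dom /=; case: (x) => // l.
by rewrite tE ltxx andbF.
Qed.

(** The new circle meets nothing, so that any constant colour will do. *)
Lemma birth_coloring (N : groupType) (c : point D -> N) (w : N) : birth s z -> coloring c ->
  exists2 c' : point D' -> N, coloring c' &
    (forall x t, c' (curve_map s x, t) = c (x, t)) /\ (forall t, c' (inr z, t) = w).
Proof.
case=> _ sat so free hc.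
have [c' [c1 c2]] := extend_to_loop (fun x t => c (x, t)) (fun=> w).
exists c'; last by [].
have vel p : dom p -> velocity (point_map s p) = velocity p.
  case: p => x t dp; have [lo [hi [h1 h2 h3]]] := dom_interval dp.
  by apply/esym/(velocity_local h1 h2) => u /h3 du; apply/esym; exact: (sat (x, u) du).
have domE p : dom (point_map s p) <-> dom p by case: p => -[].
move=> x'; have [[x ->]|->] := curve_cases x'; last first.
  move=> t u _ _ _ _; rewrite !c2 jump1 ?conjg1 // => -[q qp].
  by apply: (free t q); exact/crossing_sym/over_crossing.
apply: transport_eq (hc x) => u _; last by rewrite c1.
rewrite -[(curve_map s x, u)]/(point_map s (x, u)).
have [[q qp]|n] := pselect (under ((x, u) : point D)).
  have [dq dp] := over_dom qp; have mqp := (so q (x, u) dq dp).2 qp.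
  rewrite (jump_over _ qp) (jump_over _ mqp) /positive !vel //.
  by case: (q) => y v; rewrite -[point_map s (y, v)]/(curve_map s y, v) c1.
rewrite !jump1 // => -[q' qp]; apply: n.
case: q' qp => y' v qp; have [[y yE]|yE] := curve_cases y'; subst y'.
  have [/(domE (y, v)) dq /(domE (x, u)) dp] := over_dom qp.
  by exists (y, v); apply/(so (y, v) (x, u) dq dp).
by case: (free v (point_map s (x, u))); exact: over_crossing.
Qed.

End OneMoreLoop.

Section BirthStep.
Variables (R : realType) (m : nat) (D D' : diagram R m) (s : loop D -> loop D').
Variable z : loop D'.

Lemma euler_total_loop (j : 'I_m) : euler_total (Birth j) = 1 /\ euler_total (Saddle j) = -1.
Proof.
have e : \sum_(i < m) ((i == j)%:R : int) = 1.
  by rewrite (bigD1 j) //= eqxx big1 ?addr0 // => i /negbTE ->.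
by split; rewrite /euler_total /euler // sumrN e.
Qed.

Lemma birth_step : birth s z ->
  step_spec (Birth (lab z)) (fun x x' => x' = curve_map s x)
    (StepData (fun _ _ => 0) (fun _ _ => 0) (@no_band R m D) (@no_band R m D')).
Proof.
move=> hb; have [more _ _ free] := hb; have inj := curve_map_inj more.
have [s_inj _ _] := more.
have transfer n (N : groupType) (c : point D -> N) (c' : point D' -> N) :
    central_pair n (fun x x' => x' = curve_map s x)
      (StepData (fun _ _ => 0) (fun _ _ => 0) (@no_band R m D) (@no_band R m D')) c c' ->
    exists (h : loop D -> center N) (zeta : curve D -> center N),
    [/\ forall l, c (inr l, 1) = (c (inr l, 0) * val (h l))%g,
        c' (inr z, 1) = c' (inr z, 0),
        forall x, c' (curve_map s x, 0) = (c (x, 0) * val (zeta x))%g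
      & forall x, c' (curve_map s x, 1) = (c (x, 1%R) * val (zeta x))%g].
  case=> hN hc hc' cl _ mt _ _.
  have /choice[h hh] l := ceq_center (cl l).
  have /choice[zeta hz] x := ceq_center (mt x _ erefl).
  have [c1 hc1 [h1 h2]] := birth_coloring more (c' (inr z, 0)) hb hc.
  have [zz [zz1 zz2]] := extend_to_loop more (fun x _ => zeta x) (fun=> (0 : center N)).
  have hc2 := coloring_shift (fun x' => centerP (zz (x', 0))) hc1.
  have c2E p : 0 <= p.2 <= 1 -> (c1 p * val (zz (p.1, 0%R)))%g = c' p.
    apply: (coloring_unique hN hc2 hc') => x' /=.
    have [[x ->]|->] := curve_cases more x'; first by rewrite zz1 h1 hz.
    by rewrite zz2 h2 mulg1.
  exists h, zeta; split=> // [|x].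
    by rewrite -!c2E ?lexx ?ler01 //= !h2.
  by rewrite -c2E ?lexx ?ler01 //= h1 zz1.
split=> //.
- by move=> x x' _; rewrite lexx ler01.
- by move=> i j [->].
- rewrite card_loop_edges_map (card_one_more more) (euler_total_loop _).1; lia.
- move=> n N c c' /transfer[h [zeta [h1 h2 h3 h4]]].
  exists (map_flow s h); split; first exact: map_flow_off.
    by move=> l; rewrite h1 map_flow_out.
  move=> l'; have [[[//|l] [->]]|[->]] := curve_cases more (inr l').
    rewrite (h3 (inr l)) (h4 (inr l)) h1 (@map_flow_in _ _ _ _ s s_inj) -!mulgA; congr (_ * _)%g.
    exact: centerP.
  rewrite h2 big1 ?mulg1 // => x _; apply: map_flow_off => e.
  exact: (curve_map_not_new more (esym e)).
- by move=> n N c c' _ _ _; split=> x t1 t2 [].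
- move=> n N c c' /transfer[h [zeta [_ _ h3 h4]]] _ _ mt i.
  rewrite (h4 (inl i)); have := mt (inl i) _ erefl => /=; rewrite (h3 (inl i)) => e.
  have -> : val (zeta (inl i)) = 1%g by apply: (mulgI (c (inl i, 0))); rewrite -e mulg1.
  by rewrite mulg1.
Qed.

End BirthStep.

Section SplitStep.
Variables (R : realType) (m : nat) (D D' : diagram R m) (s : loop D -> loop D').
Variables (x0 : curve D) (z : loop D').

Lemma transport_ceq (N : groupType) (g g' f f' : R -> N) (S : seq R) (w : N) lo hi :
  supported g S -> supported g' S -> central w ->
  (forall u, lo <= u < hi -> ceq (g u) (g' u)) ->
  (forall u, lo <= u <= hi -> f' u = (f u * w)%g) ->
  transport g lo hi f -> transport g' lo hi f'.
Proof.
move=> gS g'S hw gg ff tr.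
have : transport g' lo hi ((fun y => y * w)%g \o f).
  apply: (transport_map gS g'S _ tr) => u hu.
  by rewrite conj_centralM //; congr (_ * _)%g; apply/esym/ceqJ/gg.
by apply: transport_eq => // u hu; rewrite /= -ff.
Qed.

(** The band reconnects two points of [x0] whose colours differ by [w].  Since [w]
    is central, correcting the colours of the curve after the band by the inverse
    of [w] does not disturb any crossing; the loop split off has the defect [w]. *)
Lemma split_coloring (a1 b1 a2 b2 : R) c0 r :
  one_more_loop s z /\ lab z = link_comp x0 ->
  [/\ 0 < a1 < b1, b1 < a2 < b2 & b2 < 1] ->
  disc_meets c0 r (split_arcs x0 a1 b1 a2 b2) /\ crossing_free (split_arcs x0 a1 b1 a2 b2) ->
  disc_meets c0 r (split_arcs' s x0 z a1 b1 a2 b2) /\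
    crossing_free (split_arcs' s x0 z a1 b1 a2 b2) ->
  (forall p, dom p -> ~ split_arcs x0 a1 b1 a2 b2 p ->
     at_ (split_map s x0 z b1 a2 p) = at_ p) /\
  (forall p q, dom p -> dom q -> ~ split_arcs x0 a1 b1 a2 b2 p ->
     ~ split_arcs x0 a1 b1 a2 b2 q ->
     (over (split_map s x0 z b1 a2 p) (split_map s x0 z b1 a2 q) <-> over p q)) ->
  forall (N : groupType) (c : point D -> N) (w : N), coloring c -> central w ->
  c (x0, b2) = (c (x0, b1) * w)%g ->
  exists2 c' : point D' -> N, coloring c' &
    [/\ forall x, c' (curve_map s x, 0) = c (x, 0), c' (inr z, 0) = c (x0, b1),
        c' (inr z, 1) = (c (x0, b1) * w)%g,
        forall x, x <> x0 -> c' (curve_map s x, 1) = c (x, 1)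
      & c' (curve_map s x0, 1) = (c (x0, 1%R) * w^-1)%g].
Proof.
set A := split_arcs _ _ _ _ _; set A' := split_arcs' _ _ _ _ _ _ _; set mv := split_map _ _ _ _ _.
move=> [more _] [/andP[a10 ab1] /andP[ba ab2] b21] [_ cfA] [_ cfA'] [sat so] N c w hc hw cw.
have hwV := centralV hw.
pose V (x : curve D) (t : R) := if pselect (x = x0) is left _ then
    (if t <= a1 then c (x0, t) else if t < b2 then c (x0, b1) else c (x0, t) * w^-1)%g
  else c (x, t).
pose Vz (t : R) := if t <= b1 then c (x0, b1) else if t <= a2 then c (x0, t) else c (x0, b2).
have [c' [c1 c2]] := extend_to_loop more V Vz.
have Vne x (t : R) : x <> x0 -> V x t = c (x, t) by rewrite /V; case: pselect.
have Vx0 t : V x0 t = (if t <= a1 then c (x0, t) else if t < b2 then c (x0, b1) else c (x0, t) * w^-1)%g.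
  by rewrite /V; case: pselect.
have lo_a1 : a1 < b2 by lra.
have mvz (t : R) : b1 <= t <= a2 -> mv (x0, t) = (inr z, t).
  by move=> ht; rewrite /mv /split_map asboolT.
have mvx (p : point D) : ~ (p.1 = x0 /\ b1 <= p.2 <= a2) -> mv p = point_map s p.
  by move=> h; rewrite /mv /split_map asboolF.
have nA x (t : R) : x <> x0 -> ~ A (x, t) by move=> ne [[]|[]].
have nA0 (t : R) : t <= a1 \/ b1 <= t <= a2 \/ b2 <= t -> ~ A (x0, t).
  by move=> ht [[_ /= /andP[h1 h2]]|[_ /= /andP[h1 h2]]]; lra.
have dom0 y (t : R) : 0 < t < 1 -> dom ((y, t) : point D).
  by move=> /andP[h1 h2]; rewrite /dom /=; case: (y) => _; apply/andP; split; lra.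
have c'mv p : dom p -> ~ A p -> ceq (c p) (c' (mv p)).
  case: p => x t dp nAp; have [xx|xx] := pselect (x = x0); last first.
    rewrite mvx; last by case.
    by rewrite -[point_map _ _]/(curve_map s x, t) c1 Vne //; exact: ceq_refl.
  subst x; have [h1|h1] := leP t a1.
    rewrite mvx; last by move=> [_ /= /andP[k1 _]]; lra.
    by rewrite -[point_map _ _]/(curve_map s x0, t) c1 Vx0 h1; exact: ceq_refl.
  have [h2|h2] := ltP t b1; first by case: nAp; left; split => //=; rewrite h1.
  have [h3|h3] := leP t a2.
    rewrite mvz ?h2 // c2 /Vz; case: leP => k; last by rewrite h3; exact: ceq_refl.
    have -> : t = b1 by apply/eqP; rewrite eq_le k h2.
    exact: ceq_refl.
  have [h4|h4] := ltP t b2; first by case: nAp; right; split => //=; rewrite h3.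
  rewrite mvx; last by move=> [_ /= /andP[_ k1]]; lra.
  rewrite -[point_map _ _]/(curve_map s x0, t) c1 Vx0 leNgt h1 ltNge h4 /=.
  exact: ceqM.
have vel p : dom p -> ~ A p -> velocity (mv p) = velocity p.
  case: p => x t dp nAp.
  suff [lo [hi [y [h1 h2 h3 h4]]]] : exists lo hi (y : curve D'), [/\ lo < hi, lo <= t <= hi,
      mv (x, t) = (y, t) & forall u, lo <= u <= hi ->
      [/\ dom ((x, u) : point D), ~ A (x, u) & mv (x, u) = (y, u)]].
    rewrite h3; apply/esym/(velocity_local h1 h2) => u /h4[k1 k2 k3].
    by rewrite -[RHS]/(at_ ((y, u) : point D')) -k3; apply/esym; exact: sat.
  have [lo [hi [h1 h2 h3]]] := dom_interval dp.
  have [xx|xx] := pselect (x = x0); last first.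
    exists lo, hi, (curve_map s x); split=> // [|u /h3 du].
      by rewrite mvx // => -[].
    by split=> //; [exact: nA|rewrite mvx // => -[]].
  subst x; have /andP[t0 t1] := dom01 dp; rewrite /= in t0 t1.
  have [k1|k1] := leP t a1.
    exists 0, a1, (curve_map s x0); split=> // [|| u /andP[u1 u2]].
    - by rewrite t0.
    - by rewrite mvx // => -[_ /= /andP[k2 _]]; lra.
    split.
    - by rewrite /dom /=; case: (x0) => _; apply/andP; split; lra.
    - by apply: nA0; left.
    - by rewrite mvx // => -[_ /= /andP[k2 _]]; lra.
  have [k2|k2] := ltP t b1; first by case: nAp; left; split => //=; rewrite k1.
  have [k3|k3] := leP t a2.
    exists b1, a2, (inr z); split=> // [|| u uI].
    - by rewrite k2.
    - by rewrite mvz // k2.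
    split; [apply: dom0|by apply: nA0; right; left|exact: mvz].
    by have /andP[u1 u2] := uI; apply/andP; split; lra.
  have [k4|k4] := ltP t b2; first by case: nAp; right; split => //=; rewrite k3.
  have big u : b2 <= u -> ~ A (x0, u) /\ mv (x0, u) = (curve_map s x0, u).
    move=> u1; split; first by apply: nA0; right; right.
    by rewrite mvx // => -[_ /= /andP[_ k5]]; lra.
  have [t1'|t1'] := ltP t 1.
    exists t, ((t + 1) / 2), (curve_map s x0).
    split=> [|||u /andP[u1 u2]]; [lra|by apply/andP; split; lra|exact: (big t k4).2|].
    have [q1 q2] := big u (le_trans k4 u1); split => //.
    by apply: dom0; apply/andP; split; lra.
  have tE : t = 1 by apply/eqP; rewrite eq_le t1 t1'.
  exists b2, 1, (curve_map s x0).
  split=> [|||u /andP[u1 u2]]; [lra|by rewrite tE lexx ltW|exact: (big t k4).2|].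
  have [q1 q2] := big u u1; split => //.
  move: dp; rewrite tE /dom /=; case: (x0) => [i|l] /=; last by rewrite ltxx andbF.
  by move=> _; apply/andP; split; lra.
have surj q' : dom q' -> ~ A' q' -> exists q, [/\ q' = mv q, dom q & ~ A q].
  case: q' => y' t dq nAq; have /andP[t0 t1] := dom01 dq; rewrite /= in t0 t1.
  have [[y yE]|yE] := curve_cases more y'; subst y'.
    have dyt : dom ((y, t) : point D) by case: (y) dq.
    have [yx|yx] := pselect (y = x0); last first.
      by exists (y, t); split => //; [rewrite mvx // => -[]|exact: nA].
    subst y; exists (x0, t).
    have [k1|k1] := leP t a1.
      split => //; last by apply: nA0; left.
      by rewrite mvx // => -[_ /= /andP[k2 _]]; lra.
    have [k2|k2] := ltP t b2; first by case: nAq; left; split => //=; rewrite k1.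
    split => //; last by apply: nA0; right; right.
    by rewrite mvx // => -[_ /= /andP[_ k3]]; lra.
  have [k1|k1] := ltP t b1; first by case: nAq; right; split => //=; left; rewrite t0.
  have [k2|k2] := ltP a2 t.
    case: nAq; right; split => //=; right; rewrite k2.
    by move: dq; rewrite /dom /= => /andP[].
  exists (x0, t); split; first by rewrite mvz ?k1.
    by apply: dom0; apply/andP; split; lra.
  by apply: nA0; right; left; rewrite k1.
have jumpE p : dom p -> ~ A p -> ceq (jump c p) (jump c' (mv p)).
  move=> dp nAp; have [[q qp]|n] := pselect (under p).
    have [dq _] := over_dom qp; have nAq : ~ A q.
      by move=> hq; apply: (cfA q p hq); exact: over_crossing.
    have mqp := (so q p dq dp nAq nAp).2 qp.
    rewrite (jump_over _ qp) (jump_over _ mqp) /positive !vel //.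
    by case: ifP => _; [|apply: ceqV]; exact: c'mv.
  rewrite !jump1 //; first exact: ceq_refl.
  move=> [q' qp]; have nAq : ~ A' q'.
    by move=> hq; apply: (cfA' q' _ hq); exact: over_crossing qp.
  have [q [qE dq nAq']] := surj q' (over_dom qp).1 nAq; rewrite qE in qp.
  by apply: n; exists q; apply/(so q p dq dp nAq' nAp).
have jump_flat q : A' q -> jump c' q = 1%g.
  by move=> Aq; apply: jump1 => -[p /over_crossing/crossing_sym]; exact: cfA'.
have cflat (a b : R) : 0 <= a -> b <= 1 -> (forall u, a < u < b -> A (x0, u)) ->
    forall t, a < t -> t <= b -> c (x0, t) = (c (x0, a) ^ jump c (x0, a))%g.
  move=> a0 b0 inn t at_ tb; apply: (coloring_step hc a0 at_ (le_trans tb b0)).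
  move=> u /andP[u1 u2] [q qu]; apply: (cfA (x0, u) q).
    by apply: inn; rewrite u1 (lt_le_trans u2).
  exact/crossing_sym/over_crossing.
have e1 : c (x0, b1) = (c (x0, a1) ^ jump c (x0, a1))%g.
  by apply: (cflat a1 b1); rewrite ?(ltW a10) //; [lra|move=> u hu; left].
have e2 : c (x0, b2) = (c (x0, a2) ^ jump c (x0, a2))%g.
  by apply: (cflat a2 b2); rewrite ?(ltW b21) //; [lra|move=> u hu; right].
have [S1 hS1] := jump_supported D N; have [S2 hS2] := jump_supported D' N.
pose S := S1 ++ S2.
have sup1 x : supported (fun u => jump c (x, u)) S.
  by move=> u /hS1; rewrite mem_cat => ->.
have sup2 y : supported (fun u => jump c' (y, u)) S.
  by move=> u /hS2; rewrite mem_cat orbC => ->.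
have sub (lo hi : R) x : 0 <= lo -> hi <= 1 -> transport (fun u => jump c (x, u)) lo hi (fun u => c (x, u)).
  by move=> h1 h2; exact: transport_sub h1 h2 (hc x).
exists c'; last first.
  split.
  - move=> x; rewrite c1; have [xx|xx] := pselect (x = x0); last exact: Vne.
    by rewrite xx Vx0 (ltW a10).
  - by rewrite c2 /Vz; case: (leP 0 b1) => // k; exfalso; lra.
  - rewrite c2 /Vz -cw; case: (leP 1 b1) => [k|_]; first by exfalso; lra.
    by case: (leP 1 a2) => // k; exfalso; lra.
  - by move=> x xx; rewrite c1 Vne.
  - rewrite c1 Vx0; case: (leP 1 a1) => [k|_]; first by exfalso; lra.
    by case: (ltP 1 b2) => // k; exfalso; lra.
move=> y'; have [[y yE]|yE] := curve_cases more y'; subst y'.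
  have [yx|yx] := pselect (y = x0); last first.
    apply: (transport_ceq (sup1 y) (sup2 _) (@central1 N) _ _ (hc y)) => u /andP[u0 u1].
      have dyu : dom ((y, u) : point D) by rewrite /dom /=; case: (y) => _; apply/andP; split; lra.
      by have := jumpE (y, u) dyu (nA _ _ yx); rewrite mvx // => -[].
    by rewrite c1 Vne // mulg1.
  subst y; apply: (transport_glue (mid := a1)).
    apply: (transport_ceq (sup1 x0) (sup2 _) (@central1 N) _ _ (sub 0 a1 x0 (lexx 0) _)).
    - move=> u /andP[u0 u1].
      have dyu : dom ((x0, u) : point D) by rewrite /dom /=; case: (x0) => _; apply/andP; split; lra.
      have := jumpE (x0, u) dyu (nA0 u (or_introl (ltW u1))); rewrite mvx // => -[_ /= /andP[k _]]; lra.
    - by move=> u /andP[_ u1]; rewrite c1 Vx0 u1 mulg1.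
    - lra.
  apply: (transport_glue (mid := b2)).
    apply: (flat_arc (g := jump c') (z := c (x0, b1))) => [u hu|u /andP[u1 u2]|].
    - by apply: jump_flat; left; split.
    - rewrite c1 Vx0 leNgt u1 /=; case: ltP => // u3.
      have -> : u = b2 by apply/eqP; rewrite eq_le u2 u3.
      by rewrite cw mulgK.
    - rewrite c1 Vx0 lexx e1; apply/esym/ceqJ.
      have := jumpE (x0, a1) (dom0 _ _ _) (nA0 a1 (or_introl (lexx _))).
      rewrite mvx; last by move=> [_ /= /andP[k _]]; lra.
      by apply; apply/andP; split; lra.
  apply: (transport_ceq (sup1 x0) (sup2 _) hwV _ _ (sub b2 1 x0 _ (lexx 1))).
  - move=> u /andP[u0 u1].
    have := jumpE (x0, u) (dom0 _ _ _) (nA0 u (or_intror (or_intror u0))).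
    rewrite mvx; last by move=> [_ /= /andP[_ k]]; lra.
    by apply; apply/andP; split; lra.
  - move=> u /andP[u0 u1]; rewrite c1 Vx0.
    by case: (leP u a1) => [k|_]; [exfalso; lra|rewrite ltNge u0].
  - lra.
have b1a2 : b1 <= a2 by exact: ltW.
apply: (transport_glue (mid := b1)).
  move=> u t u0 ut tb free; rewrite !c2 /Vz tb (le_trans (ltW ut) tb) jump_flat ?conjg1 //.
  by right; split => //=; left; rewrite u0 (lt_le_trans ut).
apply: (transport_glue (mid := a2)).
  apply: (transport_ceq (sup1 x0) (sup2 _) (@central1 N) _ _ (sub b1 a2 x0 _ _)).
  - move=> u /andP[u0 u1].
    have uI : b1 <= u <= a2 by rewrite u0 ltW.
    have := jumpE (x0, u) (dom0 _ _ _) (nA0 u (or_intror (or_introl uI))).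
    by rewrite mvz //; apply; apply/andP; split; lra.
  - move=> u /andP[u0 u1]; rewrite c2 /Vz u1 mulg1; case: (leP u b1) => // k.
    by have -> : u = b1 by apply/eqP; rewrite eq_le u0 k.
  - lra.
  - lra.
apply: (flat_arc (g := jump c') (z := c (x0, b2))) => [u /andP[u1 u2]|u /andP[u1 u2]|].
- by apply: jump_flat; right; split => //=; right; rewrite u1.
- by rewrite c2 /Vz leNgt (le_lt_trans b1a2) //= leNgt u1.
rewrite c2 /Vz lexx leNgt ba /= e2; apply/esym/ceqJ.
have aI : b1 <= a2 <= a2 by rewrite b1a2 lexx.
have := jumpE (x0, a2) (dom0 _ _ _) (nA0 a2 (or_intror (or_introl aI))).
by rewrite mvz //; apply; apply/andP; split; lra.
Qed.

End SplitStep.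

Section SplitStep.
Variables (R : realType) (m : nat) (D D' : diagram R m) (s : loop D -> loop D').
Variables (x0 : curve D) (z : loop D').

(** The defect [w] of the loop split off flows into it from [x0].  Once the loops
    close up, [w] is trivial, and the two points joined by the band have the same
    colour. *)
Lemma split_step : split_off s x0 z ->
  exists sd, step_spec (Saddle (lab z))
    (fun x x' => x' = curve_map s x \/ (x = x0 /\ x' = inr z)) sd.
Proof.
move=> [a1 [b1 [a2 [b2 [c0 [r [hm hab dA dA' hs]]]]]]].
have [more _] := hm; have [s_inj _ _] := more.
have [/andP[a10 ab1] /andP[ba ab2] b21] := hab.
have not_z x : (curve_map s x == inr z) = false.
  by apply/eqP; exact: (curve_map_not_new more).
pose sd : step_data D D' := StepData
  (fun _ x' => if x' == inr z then b1 else 0) (fun _ _ => 0)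
  (fun x t u => [/\ x = x0, t = b1 & u = b2]) (@no_band R m D').
exists sd; set T := (X in step_spec _ X _).
have Tmap x : T x (curve_map s x) by left.
have Tz : T x0 (inr z) by right.
have transfer n (N : groupType) (c : point D -> N) (c' : point D' -> N) :
    central_pair n T sd c c' ->
    exists (h : loop D -> center N) (zeta : curve D -> center N) (w : center N),
    [/\ forall l, c (inr l, 1) = (c (inr l, 0) * val (h l))%g,
        c (x0, b2) = (c (x0, b1) * val w)%g,
        c' (inr z, 1) = (c' (inr z, 0) * val w)%g,
        forall x, c' (curve_map s x, 0) = (c (x, 0) * val (zeta x))%g
      & forall x, c' (curve_map s x, 1) =
          (c (x, 1%R) * val (zeta x - (if x == x0 then w else 0)))%g].
  case=> hN hc hc' cl _ mt bd _.
  have /choice[h hh] l := ceq_center (cl l).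
  have [w hw] := ceq_center (bd x0 b1 b2 (And3 erefl erefl erefl)).
  have /choice[zeta hz] x := ceq_center (mt x (curve_map s x) (Tmap x)).
  have [zz hzz] := ceq_center (mt x0 (inr z) Tz).
  rewrite /= eqxx in hzz.
  have [c1 hc1 [h1 h2 h3 h4 h5]] :=
    split_coloring hm hab dA dA' hs hc (centerP w) hw.
  have [Z [Z1 Z2]] := extend_to_loop more (fun x _ => zeta x) (fun=> zz).
  have hc2 := coloring_shift (fun x' => centerP (Z (x', 0))) hc1.
  have c2E p : 0 <= p.2 <= 1 -> (c1 p * val (Z (p.1, 0%R)))%g = c' p.
    apply: (coloring_unique hN hc2 hc') => x' /=.
    have [[x ->]|->] := curve_cases more x'; last by rewrite Z2 h2 hzz.
    by rewrite Z1 h1 hz /= not_z.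
  exists h, zeta, w; split=> // [|x|x].
  - rewrite -!c2E ?lexx ?ler01 //= h2 h3 -!mulgA; congr (_ * _)%g.
    exact: centerP.
  - by rewrite hz /= not_z.
  rewrite -c2E ?lexx ?ler01 //= Z1; have [->|/eqP ne] := eqVneq x x0.
    by rewrite h5 -mulgA; congr (_ * _)%g; rewrite centerP.
  by rewrite h4 // invg1 mulg1.
have one (N : groupType) (g : N) (w : center N) : g = (g * val w)%g -> w = 0.
  by move=> e; apply: val_inj; apply: (mulgI g); rewrite -e mulg1.
have w_inr (N : groupType) (c : point D' -> N) (w : center N) :
    closed_by eq c -> c (inr z, 1) = (c (inr z, 0) * val w)%g -> w = 0.
  by move=> cl /esym e; apply: (one _ (c (inr z, 0))); rewrite e; exact: cl.
split=> //.
- move=> x x' _; rewrite /= lexx ler01; case: ifP => _; rewrite ?lexx ?ler01 //.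
  by split => //; apply/andP; split; lra.
- by move=> x t u [_ -> ->]; split; apply/andP; split; lra.
- by move=> i j [[->]|[]].
- pose edge o := if o is Some l then (inr l : curve D, inr (s l) : curve D') else (x0, inr z).
  have inj : injective edge.
    have nz l : (inr (s l) : curve D') <> inr z := curve_map_not_new more (x := inr l).
    move=> [l|] [l'|] //=; first by case=> ->.
      by case=> _ e; case: (nz l); rewrite e.
    by case=> _ e; case: (nz l'); rewrite -e.
  have -> : #|loop_edges T| = #|loop D|.+1.
    rewrite -card_option -(card_codom inj); apply: eq_card => -[x x'].
    apply/idP/codomP => [|[[l|] [-> ->]]].
    + rewrite unfold_in /loop_edges /= => /andP[/asboolP[->|[-> ->]] hx].
        by case: x hx => [i|l] //= _; exists (Some l).
      by exists None.
    + by rewrite unfold_in /loop_edges /= andbT; apply/asboolP; exact: (Tmap (inr l)).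
    + by rewrite unfold_in /loop_edges /= orbT andbT; apply/asboolP.
  rewrite (card_one_more more) (euler_total_loop _).2; lia.
- move=> n N c c' /transfer[h [zeta [w [h1 h2 h3 h4 h5]]]].
  pose k x : center N := if x == x0 then w else 0.
  pose f (x : curve D) (x' : curve D') : center N :=
    if x' == inr z then k x
    else if x is inr l then if x' == inr (s l) then h l - k x else 0 else 0.
  exists f; split.
  + move=> x x' ne; rewrite /f; case: eqP => [e|_].
      by rewrite /k; case: eqP => // ex; case: ne; right.
    by case: x ne => // l ne; case: eqP => // e; case: ne; left.
  + move=> l; rewrite h1; congr (_ * val _)%g; apply/esym.
    have sz : inr (s l) != inr z :> curve D' by rewrite (not_z (inr l)).
    rewrite (bigD1 (inr z)) //= (bigD1 (inr (s l))) //= big1 ?addr0.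
      by rewrite /f eqxx (negbTE sz) eqxx addrC subrK.
    by move=> x' /andP[/negbTE e1 /negbTE e2]; rewrite /f e1 e2.
  + move=> l'; have [[[//|l] [->]]|[->]] := curve_cases more (inr l').
      rewrite (h4 (inr l)) (h5 (inr l)) h1 -!mulgA; congr (_ * _)%g.
      have -> : \sum_x f x (inr (s l)) = h l - k (inr l).
        rewrite (bigD1 (inr l)) //= big1 ?addr0.
          by rewrite /f (not_z (inr l)) eqxx.
        move=> [i|l2] //= ne; rewrite /f (not_z (inr l)) //; case: eqP => // -[] /s_inj e.
        by rewrite e eqxx in ne.
      exact: (congr1 val (addrCA (h l) (zeta (inr l)) (- k (inr l)))).
    rewrite h3; congr (_ * val _)%g; rewrite (bigD1 x0) //= big1 ?addr0.
      by rewrite /f /k !eqxx.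
    by move=> x /negbTE ne; rewrite /f eqxx /k ne.
- move=> n N c c' /transfer[h [zeta [w [h1 h2 h3 h4 h5]]]] _ cl'; split; last by move=> x t u [].
  by move=> x t u [-> -> ->]; rewrite h2 (w_inr _ _ _ cl' h3) mulg1.
- move=> n N c c' /transfer[h [zeta [w [h1 h2 h3 h4 h5]]]] _ cl' mt i.
  rewrite (h5 (inl i)) (w_inr _ _ _ cl' h3) if_same subr0.
  have /= := mt (inl i) _ (Tmap (inl i)); rewrite (h4 (inl i)) => /one ->.
  by rewrite mulg1.
Qed.

End SplitStep.

(** * Isotopies *)

Section IsotopyAnalysis.
Variable R : realType.

Lemma derive_pos_increasing (f : R^o -> R^o) a b : (forall u, derivable f u 1) ->
  (forall u, a <= u <= b -> 0 < derive1 f u) ->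
  forall s t, a <= s -> s < t -> t <= b -> f s < f t.
Proof.
move=> df f' s t as_ st tb.
have [||c] := @MVT R f (derive1 f) s t st.
- by move=> u _; rewrite derive1E; apply: DeriveDef.
- by apply: derivable_within_continuous => u _; exact: df.
rewrite in_itv /= => /andP[sc ct] e.
rewrite -subr_gt0 e mulr_gt0 ?subr_gt0 // f' //.
by rewrite (le_trans as_ (ltW sc)) (le_trans (ltW ct) tb).
Qed.

Lemma derivable_intermediate (f : R^o -> R^o) a b v : (forall u, derivable f u 1) ->
  a <= b -> f a <= v <= f b -> exists2 u, a <= u <= b & f u = v.
Proof.
move=> df ab /andP[av vb].
have [||u uab fu] := @IVT R f a b v ab.
- by apply: derivable_within_continuous => u _; exact: df.
- by rewrite ge_min av le_max vb orbT.
by exists u => //; rewrite in_itv in uab.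
Qed.

Lemma det2_mulmx (v w : plane R) (J : 'M[R]_2) :
  det2 (v *m J) (w *m J) = \det J * det2 v w.
Proof.
rewrite (expand_det_row J 0) !big_ord_recl big_ord0 /cofactor /=.
rewrite !(expand_det_row _ 0) !big_ord_recl !big_ord0 /cofactor !det_mx00.
rewrite /det2 !mxE !big_ord_recl !big_ord0 /=.
have -> : lift ord0 ord0 = 1 :> 'I_2 by apply/val_inj.
have -> : lift (1 : 'I_2) (ord0 : 'I_1) = 0 by apply/val_inj.
rewrite -[ord0 : 'I_2]/(0 : 'I_2) /bump /= add0n expr0 expr1.
ring.
Qed.

Lemma det2_scale (v w : plane R) (k l : R) : det2 (k *: v) (l *: w) = k * l * det2 v w.
Proof. by rewrite /det2 !mxE; ring. Qed.

Lemma derive1_reparam (h : R^o -> plane R) (rho : R^o -> R^o) t :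
  differentiable rho t -> differentiable h (rho t) ->
  derive1 (h \o rho) t = derive1 rho t *: derive1 h (rho t).
Proof.
move=> dr dh; rewrite !derive1E.
have e1 := deriveE (1 : R^o) dr; have e2 := deriveE (1 : R^o) dh.
have e3 := deriveE (1 : R^o) (differentiable_comp dr dh).
apply: (etrans e3); rewrite {}e1 {}e2 {e3}.
apply: (etrans (f_equal (fun F => F 1) (diff_comp dr dh))).
set k := 'd rho t 1; rewrite /comp -/k.
have kE : k = k *: (1 : R^o) by rewrite /GRing.scale /= mulr1.
apply: (etrans (f_equal ('d h (rho t)) kE)).
exact: linearZ.
Qed.

Lemma derive1_image (Phi : plane R -> plane R) (g : R^o -> plane R) t :
  differentiable g t -> differentiable Phi (g t) ->
  derive1 (Phi \o g) t = derive1 g t *m jacobian Phi (g t).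
Proof.
move=> dg dP; rewrite !derive1E.
have e1 := deriveE (1 : R^o) dg; have e2 := deriveE (1 : R^o) (differentiable_comp dg dP).
apply: (etrans e2); rewrite {}e1 {e2}.
apply: (etrans (f_equal (fun F => F 1) (diff_comp dg dP))).
exact: etrans (esym (deriveE _ dP)) (deriveEjacobian _ dP).
Qed.

(** Chain rule for a curve which is only known on one side of [t] to be a moved
    and reparametrized curve. *)
Lemma moved_velocity (Phi : plane R -> plane R) (g g' : R^o -> plane R)
    (rho : R^o -> R^o) lo hi t : lo < hi -> lo <= t <= hi ->
  differentiable rho t -> differentiable g (rho t) -> differentiable Phi (g (rho t)) ->
  differentiable g' t -> (forall u, lo <= u <= hi -> g' u = Phi (g (rho u))) ->
  derive1 g' t = derive1 rho t *: (derive1 g (rho t) *m jacobian Phi (g (rho t))).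
Proof.
move=> lohi ht dr dg dP dg' e.
have dPg := differentiable_comp dg dP; have d3 := differentiable_comp dr dPg.
have -> : derive1 g' t = derive1 ((Phi \o g) \o rho) t.
  have key j : derive1 g' t 0 j = derive1 ((Phi \o g) \o rho) t 0 j.
    have [k1 <-] := derive1_coord j dg'; have [k2 <-] := derive1_coord j d3.
    by apply: (derive1_local lohi ht k1 k2) => u /e ->.
  exact: plane_ext.
by rewrite (derive1_reparam dr dPg) (derive1_image dg dP).
Qed.

End IsotopyAnalysis.

Section TransportReparam.
Variables (R : realType) (N : groupType).
Implicit Types (g f : R -> N) (rho : R -> R).

Lemma transport_reparam g f rho lo hi :
  (forall s t, lo <= s -> s < t -> t <= hi -> rho s < rho t) ->
  (forall s t v, lo <= s -> s <= t -> t <= hi -> rho s <= v <= rho t ->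
     exists2 u, s <= u <= t & rho u = v) ->
  transport g (rho lo) (rho hi) f -> transport (g \o rho) lo hi (f \o rho).
Proof.
move=> inc ivt tr s t los st thi free /=; apply: tr.
- by move: los; rewrite le_eqVlt => /orP[/eqP->//|los]; apply/ltW/inc => //; exact: ltW (lt_le_trans st thi).
- exact: inc.
- by move: thi; rewrite le_eqVlt => /orP[/eqP->//|thi]; apply/ltW/inc => //; exact: le_trans los (ltW st).
move=> v /andP[sv vt].
have [u /andP[su ut] e] := ivt s t v los (ltW st) thi (introT andP (conj (ltW sv) (ltW vt))).
rewrite -e; apply: free; rewrite !lt_neqAle su ut !andbT.
apply/andP; split; apply/eqP => k; first by rewrite k e ltxx in sv.
by rewrite -k e ltxx in vt.
Qed.

Lemma transport_shift g f k lo hi : transport g lo hi f ->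
  transport (fun v => g (v - k)) (lo + k) (hi + k) (fun v => f (v - k)).
Proof.
move=> tr; apply: (@transport_reparam g f (fun v => v - k)).
- by move=> s t _ st _; rewrite ltrD2r.
- by move=> s t v _ _ _ /andP[sv vt]; exists (v + k); rewrite ?addrK // -lerBlDr sv -lerBrDr.
- by rewrite !addrK.
Qed.

Lemma transport_central g f w lo hi : central w -> transport g lo hi f ->
  transport g lo hi (fun v => f v * w)%g.
Proof.
move=> hw tr s t los st thi free; rewrite (tr s t los st thi free).
by rewrite conj_centralM.
Qed.

End TransportReparam.

Section LoopPeriod.
Variables (R : realType) (m : nat) (D : diagram R m).
Implicit Types (x : curve D) (v t : R).

Lemma dom_reduce x v : (forall i, x = inl i -> 0 <= v <= 1) ->
  dom ((x, reduce x v) : point D).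
Proof.
case: x => [i /(_ i erefl) //|l] _; rewrite /dom /= subr_ge0 floor_le /= ltrBlDl.
by have := floorD1_gt v; rewrite intrD.
Qed.

Lemma curve_path_int (l : loop D) t (k : int) :
  curve_path (inr l : curve D) (t + k%:~R) = curve_path (inr l : curve D) t.
Proof.
have per (n : nat) u : curve_path (inr l : curve D) (u + n%:R) = curve_path (inr l : curve D) u.
  elim: n => [|n IH]; first by rewrite addr0.
  by rewrite -natr1 addrA -IH; exact: (diag_periodic (diagP D)).
case: k => n; first exact: per.
by rewrite NegzE mulrNz -(per n.+1 (t - _)) subrK.
Qed.

Lemma at_reduce x v : at_ ((x, reduce x v) : point D) = at_ ((x, v) : point D).
Proof. by case: x => [//|l]; rewrite /at_ /= -mulrNz curve_path_int. Qed.

Lemma curve_differentiable x t : differentiable (curve_path x : R^o -> plane R) t.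
Proof. by have := diag_smooth (diagP D) x 1%N => /= -[h _]; exact: h. Qed.

Lemma velocity_reduce x v :
  velocity ((x, reduce x v) : point D) = velocity ((x, v) : point D).
Proof.
case: x => [//|l]; rewrite /velocity /=; set k := (Num.floor v)%:~R.
pose sh : R^o -> R^o := fun u => u - k.
have dsh : is_derive (v : R^o) (1 : R^o) sh 1.
  by rewrite -[X in is_derive _ _ _ X]subr0; apply: is_deriveB.
have shd : differentiable sh v by apply/derivable1_diffP.
have := derive1_reparam shd (curve_differentiable (inr l) (sh v)).
rewrite [derive1 sh v]derive1E derive_val scale1r => <-.
congr (derive1 _ v); apply/funext => u.
by rewrite /sh /= /k -mulrNz curve_path_int.
Qed.

Lemma at_box p : dom p -> box m (at_ (p : point D)).
Proof.
have mkE (a b : R) : (mkpt a b 0 0 = a) * (mkpt a b 0 1 = b) by rewrite !mxE.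
have inner q : box_interior m q -> box m (q : plane R).
  by move=> [/andP[/ltW h1 /ltW h2] /andP[/ltW h3 /ltW h4]]; split; apply/andP.
case: p => [[i|l] t] dp; last exact/inner/(diag_inside (diagP D)).
have ib : 0 <= (i.+1%:R : R) <= m.+1%:R by rewrite ler0n ler_nat ltnS ltnW.
have [->|t0] := eqVneq t 0.
  by rewrite (diag_left (diagP D)) /box /= !mkE lexx ler01.
have [->|t1] := eqVneq t 1.
  by rewrite (diag_right (diagP D)) /box /= !mkE lexx ler01.
apply/inner/(diag_proper (diagP D)).
by move: dp; rewrite /dom /= => /andP[h0 h1]; rewrite !lt_neqAle h0 h1 t1 eq_sym t0.
Qed.

End LoopPeriod.

Section IsotopyStep.
Variables (R : realType) (m : nat) (D D' : diagram R m) (s : loop D -> loop D').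
Variables (Phi : plane R -> plane R) (rho : curve D -> R -> R).
Hypothesis s_same : same_loops s.
Hypothesis diffeo : box_diffeo m Phi.
Hypothesis rhoP : forall x : curve D, reparam x (rho x).
Hypothesis moved_at : forall p : point D, dom p ->
  at_ (point_map s p) = Phi (at_ ((p.1, rho p.1 p.2) : point D)).

(** The point of the curve before the isotopy which is moved to the point with
    the parameters [p]. *)
Definition origin (p : point D) : point D := (p.1, reduce p.1 (rho p.1 p.2)).

Hypothesis moved_over : forall p q : point D, dom p -> dom q ->
  (over (point_map s p) (point_map s q) <-> over (origin p) (origin q)).

Lemma rho_differentiable x t : differentiable (rho x : R^o -> R^o) t.
Proof. by have [/(_ 1%N) /= [h _] _] := rhoP x; exact: h. Qed.

Lemma rho_derivable x t : derivable (rho x : R^o -> R^o) t 1.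
Proof. exact/diff_derivable/rho_differentiable. Qed.

Lemma rho_derive_gt0 x t : 0 <= t <= 1 -> 0 < derive1 (rho x : R^o -> R^o) t.
Proof.
have [_] := rhoP x; case: (x) => [i [_ _ h]|l [_ h] _]; first exact: h.
exact: h.
Qed.

Lemma rho_increasing x t u : 0 <= t -> t < u -> u <= 1 -> rho x t < rho x u.
Proof.
move=> t0 tu u1.
exact: (derive_pos_increasing (@rho_derivable x) (@rho_derive_gt0 x) t0 tu u1).
Qed.

Lemma rho_string i : rho (inl i) 0 = 0.
Proof. by have [_ []] := rhoP (inl i). Qed.

Lemma rho1 x : rho x 1 = rho x 0 + 1.
Proof.
have [_] := rhoP x; case: (x) => [i [-> -> _]|l [h _]]; first by rewrite add0r.
by rewrite -{1}[1]add0r h.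
Qed.

Lemma rho_intermediate x t u v : t <= u -> rho x t <= v <= rho x u ->
  exists2 w, t <= w <= u & rho x w = v.
Proof.
move=> tu hv; exact: (derivable_intermediate (@rho_derivable x) tu hv).
Qed.

Lemma rho_bounds x t : 0 <= t <= 1 -> rho x 0 <= rho x t <= rho x 0 + 1.
Proof.
move=> /andP[]; rewrite !le_eqVlt => /orP[/eqP<-|t0].
  by move=> _; rewrite eqxx /= ltrDl ltr01 orbT.
move=> /orP[/eqP->|t1]; first by rewrite rho1 eqxx ltrDl ltr01 !orbT.
by rewrite -rho1 !rho_increasing ?orbT ?(ltW t0) ?(ltW t1) // lexx.
Qed.

Lemma dom_origin p : dom p -> dom (origin p).
Proof.
case: p => x t /dom01 /= t01; apply: dom_reduce => i /= xE.
by have := rho_bounds x t01; rewrite xE rho_string add0r.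
Qed.

Lemma origin_surj q : dom q -> exists2 p, dom p & origin p = q.
Proof.
case: q => -[i|l] v; rewrite /dom /= => hv.
  have [||t t01 e] := @rho_intermediate (inl i) 0 1 v; first exact: ler01.
    by rewrite rho1 rho_string add0r.
  by exists (inl i, t) => //; rewrite /origin /= e.
set n := Num.floor (rho (inr l) 0).
have n1 : n%:~R <= rho (inr l) 0 := floor_le _.
have n2 : rho (inr l) 0 < n%:~R + 1 by have := floorD1_gt (rho (inr l) 0); rewrite intrD.
have /andP[v0 v1] := hv.
have [k hk] : exists k : int, rho (inr l) 0 <= k%:~R + v < rho (inr l) 0 + 1.
  have [h|h] := leP (rho (inr l) 0) (n%:~R + v).
    by exists n; rewrite h /=; lra.
  by exists (n + 1); rewrite intrD; apply/andP; split; lra.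
have /andP[k1 k2] := hk.
have [||t /andP[t0 t1] e] := @rho_intermediate (inr l) 0 1 (k%:~R + v); first exact: ler01.
  by rewrite rho1 k1 ltW.
exists (inr l, t).
  rewrite /dom /= t0 lt_neqAle t1 andbT; apply/eqP => tE.
  by move: k2; rewrite -e tE rho1 ltxx.
rewrite /origin /= e (_ : Num.floor _ = k); first by rewrite addrAC subrr add0r.
by apply: floor_def; rewrite intrD lerDl v0 ltrD2l.
Qed.

Lemma moved_velocity_origin p : dom p -> velocity (point_map s p) =
  derive1 (rho p.1) p.2 *: (velocity (origin p) *m jacobian Phi (at_ (origin p))).
Proof.
case: p => x t dp; have [lo [hi [h1 h2 h3]]] := dom_interval dp.
rewrite /origin /= velocity_reduce at_reduce.
apply: (moved_velocity (g := curve_path x) h1 h2 (rho_differentiable x t)).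
- exact: curve_differentiable.
- by have [/(_ 1%N) /= [h _] _ _ _] := diffeo; exact: h.
- exact: curve_differentiable.
- by move=> u /h3 du; exact: (moved_at du).
Qed.

(** The two velocities at a crossing are multiplied by positive numbers and by
    the same matrix of positive determinant. *)
Lemma moved_positive p q : dom p -> dom q -> at_ (origin p) = at_ (origin q) ->
  positive (point_map s p) (point_map s q) = positive (origin p) (origin q).
Proof.
move=> dp dq e; rewrite /positive !moved_velocity_origin // -e det2_scale det2_mulmx.
have [_ _ detJ _] := diffeo.
have J0 : 0 < \det (jacobian Phi (at_ (origin p))) := detJ _ (at_box (dom_origin dp)).
by rewrite !pmulr_rgt0 ?mulr_gt0 ?rho_derive_gt0 ?dom01.
Qed.

Section Colors.
Variables (N : groupType) (c : point D -> N) (h : loop D -> N).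
Hypothesis hc : coloring c.
Hypothesis h_central : forall l, central (h l).
Hypothesis defect : forall l, c (inr l, 1) = (c (inr l, 0) * h l)%g.

(** The colours along the infinite cyclic covering of a loop: those of the
    second turn are multiplied by the defect. *)
Definition unrolled (x : curve D) (v : R) : N :=
  (c (x, reduce x v) *
   (if x is inr l then
      if v < (Num.floor (rho x 0))%:~R + 1 then 1 else h l
    else 1))%g.

Lemma unrolled_ceq x v : ceq (c (x, reduce x v)) (unrolled x v).
Proof.
by apply: ceqM; case: x => [i|l]; [exact: central1|case: ifP => _; [exact: central1|]].
Qed.

Lemma unrolled_transport x :
  transport (fun v => jump c (x, reduce x v)) (rho x 0) (rho x 1) (unrolled x).
Proof.
rewrite rho1; case: x => [i|l].
  rewrite rho_string add0r; apply: transport_eq (@hc (inl i)) => // u _.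
  by rewrite /unrolled mulg1.
set r := rho _ 0; set n := (Num.floor r)%:~R : R.
have n1 : n <= r := floor_le _.
have n2 : r < n + 1 by have := floorD1_gt r; rewrite intrD.
have turn (k : int) v : k%:~R <= v < k%:~R + 1 -> reduce (inr l : curve D) v = v - k%:~R.
  by move=> hv; rewrite /= (floor_def (m := k)) // intrD.
have E v : unrolled (inr l) v =
    (c (inr l, reduce (inr l : curve D) v) * (if (v < n + 1)%R then 1 else h l))%g by [].
apply: (@transport_glue _ _ _ _ _ (n + 1)).
  apply: (@transport_sub _ _ _ _ n (n + 1)) => //.
  have := transport_shift (k := n) (@hc (inr l)); rewrite add0r [1 + n]addrC.
  apply: transport_eq => u; first by move=> /(turn (Num.floor r)) ->.
  move=> /andP[u1]; rewrite le_eqVlt E => /orP[/eqP->|u2].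
    rewrite (turn (Num.floor r + 1)) ?intrD -/n ?lexx ?ltrDl ?ltr01 //.
    by rewrite subrr ltxx addrAC subrr add0r -defect.
  by rewrite (turn (Num.floor r)) ?u2 ?u1 // mulg1.
have := transport_central (h_central l) (transport_shift (k := n + 1) (@hc (inr l))).
rewrite add0r [1 + _]addrC => tr.
have tE u : n + 1 <= u <= r + 1 -> reduce (inr l : curve D) u = u - (n + 1).
  move=> /andP[u1 u2]; rewrite (turn (Num.floor r + 1)) intrD -/n ?u1 //=.
  by apply: (le_lt_trans u2); rewrite ltrD2r.
apply: transport_eq (transport_sub (lexx _) _ tr) => [u /andP[u1 u2]|u /andP[u1 u2]|].
- by rewrite (tE u) // u1 ltW.
- by rewrite E ltNge u1 (tE u) // u1.
- by rewrite lerD2r ltW.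
Qed.

(** Since the base point of a loop may move, its new colours run through the end of
    one turn and the beginning of the next; the defect being central, the colours
    of both turns have the same effect at the crossings. *)
Lemma isotopy_coloring : exists2 c' : point D' -> N, coloring c' &
  [/\ forall x, c' (curve_map s x, 0) = c (x, reduce x (rho x 0)),
      forall i, c' (inl i, 1) = c (inl i, 1)
    & forall l, c' (inr (s l), 1) = (c' (inr (s l), 0) * h l)%g].
Proof.
have [g gK Kg] := curve_map_bij s_same.
pose c' (p : point D') : N := unrolled (g p.1) (rho (g p.1) p.2).
have c'E x t : c' (curve_map s x, t) = unrolled x (rho x t) by rewrite /c' /= gK.
have u0 x : unrolled x (rho x 0) = c (x, reduce x (rho x 0)).
  rewrite /unrolled; case: x => [i|l]; first by rewrite mulg1.
  have := floorD1_gt (rho (inr l) 0); rewrite intrD => ->.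
  by rewrite mulg1.
exists c'; last first.
  split=> [x|i|l]; first by rewrite c'E u0.
    by rewrite (c'E (inl i)) rho1 rho_string add0r /unrolled mulg1.
  rewrite !(c'E (inr l)) u0 rho1 /unrolled ltrD2r ltNge floor_le /=.
  by congr (c (_, _) * _)%g; rewrite floorDrz // floor1 intrD opprD addrACA subrr addr0.
have point_eq p : point_map s p = (curve_map s p.1, p.2) by [].
have pK (p' : point D') : exists p, p' = point_map s p.
  by case: p' => y t; exists (g y, t); rewrite /point_map /= Kg.
have domE p : dom (point_map s p) <-> dom p by case: p => -[].
have jumpE p : dom p -> ceq (jump c (origin p)) (jump c' (point_map s p)).
  move=> dp; have [[q0 ov]|n] := pselect (under (origin p)).
    have [q dq qE] := origin_surj (over_dom ov).1; rewrite -qE in ov.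
    have ov' := (moved_over dq dp).2 ov.
    have [_ _ _ e] := over_crossing ov.
    rewrite (jump_over _ ov) (jump_over _ ov') moved_positive //.
    have k : ceq (c (origin q)) (c' (point_map s q)).
      by case: (q) => y t; rewrite point_eq c'E; exact: unrolled_ceq.
    by case: ifP => _ //; exact: ceqV.
  rewrite !jump1 //; first exact: ceq_refl.
  move=> [q' ov]; have [q qE] := pK q'; rewrite qE in ov.
  have dq : dom q by apply/domE; exact: (over_dom ov).1.
  by apply: n; exists (origin q); apply/(moved_over dq dp).
have dom0 x (u : R) : 0 <= u < 1 -> dom ((x, u) : point D).
  by rewrite /dom /=; case: (x) => _ // /andP[-> /ltW ->].
move=> x'; rewrite -(Kg x'); set x := g x'.
have [S hS] := under_seq D'.
pose G u := if 0 <= u < 1 then jump c (origin (x, u)) else 1%g.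
have GS : supported G S.
  move=> u; rewrite /G; case: ifP => // u01 ne.
  apply: (hS (point_map s (x, u))); apply: contrapT => n; apply: ne; apply: jump1.
  move=> [q0 ov]; have [q dq qE] := origin_surj (over_dom ov).1; rewrite -qE in ov.
  by apply: n; exists (point_map s q); apply/(moved_over dq (dom0 x u u01)).
have gS : supported (fun u => jump c' (curve_map s x, u)) S.
  by move=> u ne; apply: (hS (curve_map s x, u)); apply: contrapT => /(jump1 c').
have tr : transport G 0 1 (fun u => unrolled x (rho x u)).
  have := @transport_reparam _ _ _ _ (rho x) 0 1 _ _ (@unrolled_transport x).
  move=> /(_ (@rho_increasing x)) tr.
  apply: transport_eq (tr _) => [u hu|//|t u v _ tu _]; first by rewrite /G hu.
  exact: rho_intermediate.
apply: (transport_ceq GS gS (@central1 N) _ _ tr) => u hu; last by rewrite c'E mulg1.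
by rewrite /G hu; exact: (jumpE (x, u) (dom0 x u hu)).
Qed.

End Colors.
Lemma isotopy_spec : exists sd,
  step_spec (Neutral m) (fun x x' => x' = curve_map s x) sd.
Proof.
eexists; apply: (neutral_step s_same (t := fun x => reduce x (rho x 0))).
- move=> x; apply: (@dom01 _ _ _ ((x, reduce x (rho x 0)) : point D)).
  by apply: dom_reduce => i ->; rewrite rho_string lexx ler01.
- by move=> i; rewrite /= rho_string.
- by move=> N c h hc hz hl; exact: isotopy_coloring.
Qed.

End IsotopyStep.

Lemma isotopy_step (R : realType) m (D D' : diagram R m) (s : loop D -> loop D') :
  isotopy s ->
  exists sd, step_spec (Neutral m) (fun x x' => x' = curve_map s x) sd.
Proof.
move=> [s_same [Phi [rho [h1 h2 h3 h4]]]].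
exact: (isotopy_spec s_same h1 h2 h3 h4).
Qed.

(** * Invariance under the moves and under concordance *)

Section MoveSteps.
Variables (R : realType) (m : nat).
Implicit Types D : diagram R m.

Lemma elementary_step D D' e (T : curve D -> curve D' -> Prop) :
  elementary e T -> exists sd, step_spec e T sd.
Proof.
have local (s : loop D -> loop D') : same_loops s /\ transfers s ->
    exists sd, step_spec (Neutral m) (fun x x' => x' = curve_map s x) sd.
  by move=> [h1 h2]; eexists; exact: transfers_step h1 h2.
case=> [s|s|s|s|s|s|s z|s x0 z] h.
- exact: isotopy_step.
- exact/local/reidemeister1_transfers.
- exact/local/reidemeister2_transfers.
- exact/local/reidemeister3_transfers.
- exact/local/forbidden_overpass_transfers.
- exact/local/detour_transfers.
- by eexists; exact: birth_step h.
- exact: split_step.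
Qed.

Lemma reverse_eventK : involutive (@reverse_event m).
Proof. by case. Qed.

Lemma move_step D D' e (T : curve D -> curve D' -> Prop) :
  move e T -> exists sd, step_spec e T sd.
Proof.
case=> [/elementary_step//|/elementary_step[sd /step_spec_flip]].
by rewrite reverse_eventK; exists (flip_data sd).
Qed.

End MoveSteps.

Theorem theorem5p2p6 (R : realType) (m : nat) (L Ls : diagram R m)
  (hL : string_link L) (hLs : string_link Ls)
  (h : welded_concordant L Ls) (q : nat) (hq : (1 <= q)%N) :
  artin L q = artin Ls q.
Proof.
have [N [D [e [T [[D0 DN] moves connected euler0]]]]] := h.
rewrite -D0 -DN in hL hLs *.
have sd_ex k : exists sd, (k < N)%N -> step_spec (e k) (@T k) sd.
  have [kN|kN] := ltnP k N; first by have [sd hsd] := move_step (moves k kN); exists sd.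
  by exists (StepData (fun _ _ => 0) (fun _ _ => 0) (@no_band R m _) (@no_band R m _)).
pose sd k := sval (cid (sd_ex k)).
have steps k : (k < N)%N -> step_spec (e k) (@T k) (sd k) := svalP (cid (sd_ex k)).
have [c [c' [[hc hc'] c0 c0' cc']]] := movie_string_ends hL hLs connected euler0 steps
  (fun i => to_quo (lower_central _ q.+1) (free_gen i)) (@nilquo_nilpotent q (free_group 'I_m)).
exact: artin_of_colorings hL hLs hc hc' c0 c0' cc'.
Qed.
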